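(* Let $q>1$ and $I=(0,1)$. For every $r\ge1$, every $\boldsymbol\omega=(\omega_0,\ldots,\omega_{r-1})\in\mathbb{T}^r$, and every $u\in BV(I)$, $$\operatorname{Var}\big(\mathcal{L}^{(r)}_{\boldsymbol\omega}u\big)\le4q^{-r}\operatorname{Var}(u)+\frac{8}{\delta_r}\|u\|_1,\qquad \|\mathcal{L}^{(r)}_{\boldsymbol\omega}u\|_1\le\|u\|_1 .$$ Consequently, for all $\zeta,\eta\in\mathbb{T}$, $N\ge1$ and $u\in BV(I)$, $$\operatorname{Var}\big(Q_{q,\zeta,\eta}^{\,N}u\big)\le4q^{-2N}\operatorname{Var}(u)+\frac{8}{\delta_{2N}}\|u\|_1 .$$ In particular, for all $\zeta,\eta,\omega\in\mathbb{T}$, $$r_{\mathrm{ess}}(Q_{q,\zeta,\eta};BV(I))\le q^{-2}<1,\qquad r_{\mathrm{ess}}(\mathcal{L}_{\omega,q};BV(I))\le q^{-1}.$$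
   Context: $\mathbb{T}=\{z\in\mathbb{C}:|z|=1\}$. $BV(I)$ is the space of complex-valued functions in $L^1(I)$ with finite total variation, $\|h\|_{BV}=\|h\|_{L^1}+\operatorname{Var}_I(h)$ (variation of a suitable representative with one-sided traces; $\operatorname{Var}=\operatorname{Var}_I$). For $\omega\in\mathbb{T}$, $$(\mathcal{L}_{\omega,q}h)(x)=\sum_{n\ge1}\omega^n\frac{q}{(n+x)^2}h\Big(\frac{q}{n+x}\Big),\quad 0<x<1,$$ with $h$ extended by zero outside $I$; $\mathcal{L}^{(r)}_{\boldsymbol\omega}=\mathcal{L}_{\omega_{r-1},q}\cdots\mathcal{L}_{\omega_0,q}$; $Q_{q,\zeta,\eta}=\mathcal{L}_{\zeta,q}\mathcal{L}_{\eta,q}$. Let $T_q(y)=\{q/y\}_1$ (fractional part) on $I$, defined a.e. With $m=\lfloor q\rfloor$, its monotonicity intervals are $I_m=(\frac{q}{m+1},1)$ and $I_n=(\frac{q}{n+1},\frac{q}{n})$, $n\ge m+1$. Let $\mathcal{P}_r$ be the collection of maximal open cylinders of $T_q^r$, i.e. the nonempty open intervals of points $y$ with $T_q^{k}y\in I_{n_k}$ for $0\le k<r$, for digit words $(n_0,\dots,n_{r-1})$. For $C\in\mathcal{P}_r$ put $J_C=T_q^r(C)$. For fixed $r$ the family $\{J_C:C\in\mathcal{P}_r\}$ is finite, and $\delta_r=\min_{C\in\mathcal{P}_r}|J_C|>0$. For a bounded operator $L$ on a Banach space $\mathsf{B}$, $r_{\mathrm{ess}}(L;\mathsf{B})$ is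 the spectral radius of the class of $L$ in the Calkin algebra (bounded operators modulo compact operators on $\mathsf{B}$). *)

(* Defs.v *)
From HB Require Import structures.
From mathcomp Require Import all_boot all_order all_algebra.
From mathcomp Require Import all_classical all_reals all_analysis.
From mathcomp Require Import measurable_realfun complex.

Set Implicit Arguments.
Unset Strict Implicit.
Unset Printing Implicit Defensive.

Import Order.TTheory GRing.Theory Num.Theory.
Import numFieldNormedType.Exports.
Import Normc.

Local Open Scope classical_set_scope.
Local Open Scope ring_scope.
Local Open Scope complex_scope.
Local Open Scope quotient_scope.

Section FunctionsOnTheUnitInterval.
Context {R : realType}.
Implicit Types (f g h u : R -> R[i]) (a : R[i]) (s : seq R).

Local Notation mu := (@lebesgue_measure R).

Definition unit_itv : set R := `]0, 1[.

Definition norm1 f : \bar R := (\int[mu]_(x in unit_itv) (normc (f x))%:E)%E.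

Definition inL1 f : Prop :=
  [/\ measurable_fun unit_itv (fun x => complex.Re (f x)),
      measurable_fun unit_itv (fun x => complex.Im (f x)) & (norm1 f < +oo)%E].

Definition variation_along f s : R :=
  \sum_(0 <= i < (size s).-1) normc (f s`_i.+1 - f s`_i).

Definition pointwise_var f : \bar R :=
  ereal_sup [set (variation_along f s)%:E | s in
    [set s | sorted <%R s /\ {in s, forall x, unit_itv x}]].

(* The variation of a class of functions modulo null sets: the infimum runs
   over all representatives, and it is attained by any representative whose
   value at each point lies on the segment joining its one-sided limits. The
   interval is open, so no jump at 0 or 1 is counted. *)
Definition Var f : \bar R :=
  ereal_inf [set pointwise_var g | g in [set g | ae_eq mu unit_itv f g]].

Definition inBV f : Prop := inL1 f /\ (Var f < +oo)%E.

Lemma normc_ge0 a : 0 <= normc a.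
Proof. by case: a => x y /=; exact: sqrtr_ge0. Qed.

Lemma norm1_ge0 f : (0 <= norm1 f)%E.
Proof. by apply: integral_ge0 => x _; rewrite lee_fin normc_ge0. Qed.

Lemma pointwise_var_ge0 f : (0 <= pointwise_var f)%E.
Proof.
apply: ereal_sup_ubound; exists [::] => //.
by rewrite /variation_along big_geq.
Qed.

Lemma Var_ge0 f : (0 <= Var f)%E.
Proof. by apply: le_ereal_inf_tmp => _ [g _ <-]; exact: pointwise_var_ge0. Qed.

Lemma measurable_unit_itv : measurable unit_itv.
Proof. exact: measurable_itv. Qed.

Lemma measurable_normc f :
    measurable_fun unit_itv (fun x => complex.Re (f x)) ->
    measurable_fun unit_itv (fun x => complex.Im (f x)) ->
  measurable_fun unit_itv (fun x => normc (f x)).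
Proof.
move=> mr mi.
have -> : (fun x => normc (f x)) =
    (fun x => Num.sqrt (complex.Re (f x) ^+ 2 + complex.Im (f x) ^+ 2)).
  by apply/funext => x; case: (f x).
apply: (@measurableT_comp _ _ _ R R R (@Num.sqrt R)).
  apply: continuous_measurable_fun; exact: sqrt_continuous.
by apply: measurable_funD; exact: measurable_funX.
Qed.

Lemma measurable_lin a f g :
    measurable_fun unit_itv (fun x => complex.Re (f x)) ->
    measurable_fun unit_itv (fun x => complex.Im (f x)) ->
    measurable_fun unit_itv (fun x => complex.Re (g x)) ->
    measurable_fun unit_itv (fun x => complex.Im (g x)) ->
  measurable_fun unit_itv (fun x => complex.Re (a * f x + g x)) /\
  measurable_fun unit_itv (fun x => complex.Im (a * f x + g x)).
Proof.
move=> mrf mif mrg mig; split.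
- have -> : (fun x => complex.Re (a * f x + g x)) =
      (fun x => (complex.Re a * complex.Re (f x) - complex.Im a * complex.Im (f x)) + complex.Re (g x)).
    by apply/funext => x; case: a (f x) (g x) => ? ? [? ?] [? ?].
  by apply: measurable_funD => //; apply: measurable_funB; exact: measurable_funM.
- have -> : (fun x => complex.Im (a * f x + g x)) =
      (fun x => (complex.Re a * complex.Im (f x) + complex.Im a * complex.Re (f x)) + complex.Im (g x)).
    by apply/funext => x; case: a (f x) (g x) => ? ? [? ?] [? ?].
  by apply: measurable_funD => //; apply: measurable_funD; exact: measurable_funM.
Qed.

Lemma norm1_lin a f g : inL1 f -> inL1 g ->
  (norm1 (a *: f + g)%R <= (normc a)%:E * norm1 f + norm1 g)%E.
Proof.
move=> [mrf mif _] [mrg mig _]; rewrite /norm1.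
have mf := measurable_normc mrf mif; have mg := measurable_normc mrg mig.
have [mrl mil] := measurable_lin a mrf mif mrg mig.
rewrite -ge0_integralZl_EFin//; last 4 first.
- exact: measurable_unit_itv.
- by move=> x _; rewrite lee_fin normc_ge0.
- exact/measurable_EFinP.
- exact: normc_ge0.
rewrite -ge0_integralD//; last 5 first.
- exact: measurable_unit_itv.
- by move=> x _; rewrite mule_ge0// lee_fin normc_ge0.
- by apply/measurable_funeM/measurable_EFinP.
- by move=> x _; rewrite lee_fin normc_ge0.
- exact/measurable_EFinP.
apply: ge0_le_integral => //.
- exact: measurable_unit_itv.
- by move=> x _; rewrite lee_fin normc_ge0.
- by apply/measurable_EFinP; exact: measurable_normc.
- by apply: emeasurable_funD; [apply: measurable_funeM|]; exact/measurable_EFinP.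
- move=> x _; rewrite -EFinM -EFinD lee_fin -normcM.
  exact: le_normcD.
Qed.

Lemma inL1_lin a f g : inL1 f -> inL1 g -> inL1 (a *: f + g)%R.
Proof.
move=> fL gL; have [mrf mif nf] := fL; have [mrg mig ng] := gL.
have [mrl mil] := measurable_lin a mrf mif mrg mig; split => //.
apply: (le_lt_trans (norm1_lin a fL gL)); apply: lte_add_pinfty => //.
by rewrite lte_mul_pinfty// ?lee_fin ?normc_ge0.
Qed.

Lemma norm1_ae f g : inL1 f -> inL1 g -> ae_eq mu unit_itv f g ->
  norm1 f = norm1 g.
Proof.
move=> [mrf mif _] [mrg mig _] fg; apply: ge0_ae_eq_integral.
- exact: measurable_unit_itv.
- by apply/measurable_EFinP; exact: measurable_normc.
- by apply/measurable_EFinP; exact: measurable_normc.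
- by move=> x _; rewrite lee_fin normc_ge0.
- by move=> x _; rewrite lee_fin normc_ge0.
- exact: (ae_eq_comp (fun z => (normc z)%:E) fg).
Qed.

Lemma norm1_eq0 f : inL1 f -> norm1 f = 0%E -> ae_eq mu unit_itv f 0.
Proof.
move=> [mrf mif _] f0.
have /(ae_eq_integral_abs mu measurable_unit_itv) [+ _] :
    measurable_fun unit_itv (fun x => (normc (f x))%:E).
  by apply/measurable_EFinP; exact: measurable_normc.
under eq_integral do rewrite gee0_abs ?lee_fin ?normc_ge0//.
move=> /(_ f0); apply: filterS => x + xI => /(_ xI) [].
exact: eq0_normc.
Qed.

Lemma pointwise_var_lin a f g :
  (pointwise_var (a *: f + g)%R <=
     (normc a)%:E * pointwise_var f + pointwise_var g)%E.
Proof.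
apply: ge_ereal_sup => _ [s sI <-].
apply: (@le_trans _ _
    ((normc a * variation_along f s)%:E + (variation_along g s)%:E)%E).
  rewrite -EFinD lee_fin /variation_along mulr_sumr -big_split/=.
  apply: ler_sum => i _; rewrite -normcM.
  apply: le_trans (le_normcD _ _); rewrite le_eqVlt; apply/orP; left.
  apply/eqP; congr normc; rewrite !fctE.
  by rewrite /GRing.scale/= mulrBr opprD addrACA.
rewrite EFinM; apply: leeD.
  apply: lee_wpmul2l; first by rewrite lee_fin normc_ge0.
  by apply: ereal_sup_ubound; exists s.
by apply: ereal_sup_ubound; exists s.
Qed.

Lemma Var_le_pointwise f : (Var f <= pointwise_var f)%E.
Proof. by apply: ereal_inf_lbound; exists f => //; exact: ae_eq_refl. Qed.

Lemma Var_ae f g : ae_eq mu unit_itv f g -> Var f = Var g.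
Proof.
move=> fg; rewrite /Var; congr (ereal_inf (_ @` _)).
apply/seteqP; split => h /=.
  exact/ae_eq_trans/ae_eq_sym.
exact/ae_eq_trans.
Qed.

Lemma Var0 : Var 0 = 0%E.
Proof.
apply/eqP; rewrite eq_le Var_ge0 andbT (le_trans (Var_le_pointwise _))//.
apply: ge_ereal_sup => _ [s _ <-]; rewrite /variation_along big1// => i _.
by rewrite subrr normc0.
Qed.

Lemma Var_lin a f g : (Var f < +oo)%E -> (Var g < +oo)%E ->
  (Var (a *: f + g)%R <= (normc a)%:E * Var f + Var g)%E.
Proof.
move=> fV gV; apply/lee_addgt0Pr => e e0.
have c0 : 0 < normc a + 1 by rewrite ltr_wpDl ?normc_ge0.
pose d := e / (normc a + 1); have d0 : 0 < d by rewrite divr_gt0.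
have ffin : Var f \is a fin_num by rewrite ge0_fin_numE ?Var_ge0.
have gfin : Var g \is a fin_num by rewrite ge0_fin_numE ?Var_ge0.
have [_ [f' ff' <-] f'V] := lb_ereal_inf_adherent d0 ffin.
have [_ [g' gg' <-] g'V] := lb_ereal_inf_adherent d0 gfin.
apply: (@le_trans _ _ ((normc a)%:E * (Var f + d%:E) + (Var g + d%:E))%E).
  apply: (@le_trans _ _ (pointwise_var (a *: f' + g'))).
    apply: ereal_inf_lbound; exists (a *: f' + g') => //=.
    apply: filterS2 ff' gg' => x + + xI => /(_ xI) fx /(_ xI) gx.
    by rewrite !fctE fx gx.
  apply: (le_trans (pointwise_var_lin _ _ _)); apply: leeD; last exact: ltW.
  by apply: lee_wpmul2l (ltW f'V); rewrite lee_fin normc_ge0.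
rewrite -(fineK ffin) -(fineK gfin) -!EFinD. rewrite lee_fin.
rewrite mulrDr addrACA lerD2l -[X in _ + X]mul1r -mulrDl /d.
by rewrite mulrC divfK// gt_eqF.
Qed.

Lemma inBV_lin a f g : inBV f -> inBV g -> inBV (a *: f + g)%R.
Proof.
move=> [f1 fV] [g1 gV]; split; first exact: inL1_lin.
apply: (le_lt_trans (Var_lin a fV gV)); apply: lte_add_pinfty => //.
by rewrite lte_mul_pinfty// ?lee_fin ?normc_ge0.
Qed.

Lemma inBV0 : inBV 0.
Proof.
split; last by rewrite Var0.
split; [exact: measurable_cst|exact: measurable_cst|].
rewrite /norm1 (eq_integral (cst 0%E)) ?integral0// => x _.
exact: (congr1 EFin (normc0 R)).
Qed.

Definition BVpred : {pred (R -> R[i])} := [pred f | `[< inBV f >]].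

Lemma BVpred_submod_closed : submod_closed BVpred.
Proof.
split; first exact/asboolP/inBV0.
by move=> a f g /asboolP fB /asboolP gB; exact/asboolP/inBV_lin.
Qed.

HB.instance Definition _ := GRing.isSubmodClosed.Build _ _ BVpred
  BVpred_submod_closed.

End FunctionsOnTheUnitInterval.

(* The elements of bv_fun are functions; those of bv_space are classes of such
   functions modulo equality almost everywhere on the unit interval. *)
Record bv_fun (R : realType) := BVFun {
  bv_val :> R -> R[i];
  bv_valP : bv_val \in BVpred }.

HB.instance Definition _ (R : realType) := [isSub of bv_fun R for @bv_val R].
HB.instance Definition _ (R : realType) := [Choice of bv_fun R by <:].
HB.instance Definition _ (R : realType) :=
  [SubChoice_isSubLmodule of bv_fun R by <:].

Definition bv_null (R : realType) : {pred bv_fun R} :=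
  [pred f : bv_fun R | `[< ae_eq (@lebesgue_measure R) unit_itv f 0 >]].

Section BVSpace.
Context {R : realType}.
Implicit Types (f g : bv_fun R) (a : R[i]).

Local Notation mu := (@lebesgue_measure R).

Lemma bv_null_submod_closed : submod_closed (@bv_null R).
Proof.
split; first by apply/asboolP; exact: ae_eq_refl.
move=> a f g /asboolP f0 /asboolP g0; apply/asboolP.
apply: filterS2 f0 g0 => x + + xI => /(_ xI) fx /(_ xI) gx /=.
rewrite /= !fctE in fx gx *.
by rewrite fx gx scaler0 addr0.
Qed.

HB.instance Definition _ := GRing.isSubmodClosed.Build _ _ (@bv_null R)
  bv_null_submod_closed.

End BVSpace.


Definition bv_space (R : realType) : Type := Quotient.quot (@bv_null R).

HB.instance Definition _ (R : realType) := GRing.Zmodule.on (bv_space R).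
HB.instance Definition _ (R : realType) := EqQuotient.on (bv_space R).

Definition bv_class (R : realType) (f : bv_fun R) : bv_space R :=
  \pi_(bv_space R) f.

Section BVSpaceNorm.
Context {R : realType}.
Implicit Types (f g : bv_fun R) (u v : bv_space R) (a b : R[i]).

Local Notation mu := (@lebesgue_measure R).

Lemma bv_class_eq f g : bv_class f = bv_class g <-> ae_eq mu unit_itv f g.
Proof.
rewrite /bv_class; split => [/eqP|fg].
  rewrite -Quotient.idealrBE => /asboolP; apply: filterS => x + xI.
  by move=> /(_ xI) /eqP; rewrite subr_eq0 => /eqP.
apply/eqP; rewrite -Quotient.idealrBE; apply/asboolP.
by apply: filterS fg => x + xI => /(_ xI) /= fgx; rewrite !fctE fgx subrr.
Qed.

Lemma bv_classK u : bv_class (repr u) = u.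
Proof. exact: reprK. Qed.

Lemma bv_classD f g : bv_class (f + g) = bv_class f + bv_class g.
Proof. by rewrite /bv_class !piE. Qed.

Definition bv_scale a u : bv_space R := bv_class (a *: repr u).

Lemma bv_class_scale a f : bv_scale a (bv_class f) = bv_class (a *: f).
Proof.
apply/bv_class_eq.
have /bv_class_eq : bv_class (repr (bv_class f)) = bv_class f by rewrite bv_classK.
by apply: filterS => x + xI => /(_ xI) /= fx; rewrite !fctE fx.
Qed.

Lemma bv_scaleA a b u : bv_scale a (bv_scale b u) = bv_scale (a * b) u.
Proof. by rewrite -(bv_classK u) !bv_class_scale scalerA. Qed.

Lemma bv_scale1 : left_id 1 bv_scale.
Proof. by move=> u; rewrite -(bv_classK u) bv_class_scale scale1r. Qed.

Lemma bv_scaleDr : right_distributive bv_scale +%R.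
Proof.
move=> a u v; rewrite -(bv_classK u) -(bv_classK v).
by rewrite -bv_classD !bv_class_scale -bv_classD scalerDr.
Qed.

Lemma bv_scaleDl u : {morph bv_scale^~ u : a b / a + b}.
Proof.
move=> a b; rewrite -(bv_classK u).
by rewrite !bv_class_scale -bv_classD scalerDl.
Qed.

HB.instance Definition _ := GRing.Zmodule_isLmodule.Build R[i] (bv_space R)
  bv_scaleA bv_scale1 bv_scaleDr bv_scaleDl.

Lemma bv_classZ a f : bv_class (a *: f) = a *: bv_class f.
Proof. by rewrite -bv_class_scale. Qed.

Lemma bv_fun_inBV f : inBV f.
Proof. by have /asboolP := bv_valP f. Qed.

(* Norms of an R[i]-normed module take their values in R[i]; the embedded real
   number is the BV norm of any representative. *)
Definition bv_norm u : R[i] :=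
  (fine (norm1 (repr u)) + fine (Var (repr u)))%:C.

Lemma bv_normE f :
  bv_norm (bv_class f) = (fine (norm1 f) + fine (Var f))%:C.
Proof.
have /bv_class_eq ff : bv_class (repr (bv_class f)) = bv_class f.
  by rewrite bv_classK.
have [L1r _] := bv_fun_inBV (repr (bv_class f)); have [L1f _] := bv_fun_inBV f.
by rewrite /bv_norm (norm1_ae L1r L1f ff) (Var_ae ff).
Qed.

Lemma norm1_fin f : norm1 f \is a fin_num.
Proof. by have [[_ _ ?] _] := bv_fun_inBV f; rewrite ge0_fin_numE ?norm1_ge0. Qed.

Lemma Var_fin f : Var f \is a fin_num.
Proof. by have [_ ?] := bv_fun_inBV f; rewrite ge0_fin_numE ?Var_ge0. Qed.

Lemma bv_norm_lin a u v :
  bv_norm (a *: u + v) <= `|a| * bv_norm u + bv_norm v.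
Proof.
rewrite -(bv_classK u) -(bv_classK v) -bv_classZ -bv_classD !bv_normE.
set f := repr u; set g := repr v.
have -> : `|a| = (normc a)%:C by [].
rewrite -rmorphM -rmorphD /= lecR.
have [L1f Vf] := bv_fun_inBV f; have [L1g Vg] := bv_fun_inBV g.
have := norm1_lin a L1f L1g; have := Var_lin a Vf Vg.
rewrite -[X in norm1 X]/(bv_val (a *: f + g)) -[X in Var X]/(bv_val (a *: f + g)).
rewrite -(fineK (norm1_fin f)) -(fineK (norm1_fin g)) -(fineK (Var_fin f)).
rewrite -(fineK (Var_fin g)) -(fineK (norm1_fin (a *: f + g))).
rewrite -(fineK (Var_fin (a *: f + g))) -!EFinD !lee_fin => hV h1.
by rewrite mulrDr addrACA lerD.
Qed.

Lemma bv_norm0 : bv_norm 0 = 0.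
Proof.
have -> : 0 = bv_class (0 : bv_fun R) by rewrite /bv_class !piE.
rewrite bv_normE Var0 [norm1 _](_ : _ = 0%E) ?addr0//.
rewrite /norm1 (eq_integral (cst 0%E)) ?integral0// => x _.
exact: (congr1 EFin (normc0 R)).
Qed.

Lemma bv_normD u v : bv_norm (u + v) <= bv_norm u + bv_norm v.
Proof. by have := bv_norm_lin 1 u v; rewrite scale1r normr1 mul1r. Qed.

Lemma bv_normZ a u : bv_norm (a *: u) = `|a| * bv_norm u.
Proof.
have le b w : bv_norm (b *: w) <= `|b| * bv_norm w.
  by have := bv_norm_lin b w 0; rewrite bv_norm0 !addr0.
have [->|a0] := eqVneq a 0.
  by rewrite scale0r bv_norm0 normr0 mul0r.
apply/eqP; rewrite eq_le le/=.
have := le a^-1 (a *: u); rewrite scalerA mulVf// scale1r normfV.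
by rewrite ler_pdivlMl// normr_gt0.
Qed.

Lemma bv_norm_eq0 u : bv_norm u = 0 -> u = 0.
Proof.
rewrite -(bv_classK u) bv_normE => /complexI /eqP; set f := repr u.
rewrite paddr_eq0; last 2 first.
- exact/fine_ge0/norm1_ge0.
- exact/fine_ge0/Var_ge0.
move=> /andP[/eqP f0 _]; have -> : 0 = bv_class (0 : bv_fun R).
  by rewrite /bv_class !piE.
apply/bv_class_eq/norm1_eq0; first by have [] := bv_fun_inBV f.
by rewrite -(fineK (norm1_fin f)) f0.
Qed.

HB.instance Definition _ := Lmodule_isNormed.Build R[i] (bv_space R)
  bv_normD bv_normZ bv_norm_eq0.

End BVSpaceNorm.

Section EssentialSpectralRadius.
Context {R : realType} {B : normedModType R[i]}.

Definition compact_op (K : B -> B) : Prop :=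
  compact (closure (K @` [set x | `|x| <= 1])).

(* lambda - L is invertible in the quotient of the algebra of bounded operators
   by the ideal of compact ones *)
Definition calkin_resolvent (L : B -> B) : set R[i] :=
  [set lambda | exists S : {linear B -> B}, [/\ continuous S,
    compact_op (fun x => S (lambda *: x - L x) - x) &
    compact_op (fun x => (lambda *: S x - L (S x)) - x)]].

(* The supremum is taken in the extended reals, so that it has its usual
   meaning without assuming that the spectrum is bounded. *)
Definition ess_spectral_radius (L : {linear B -> B}) : \bar R :=
  ereal_sup [set (normc lambda)%:E | lambda in ~` calkin_resolvent L].

End EssentialSpectralRadius.

Section TransferOperators.
Context {R : realType}.
Implicit Types (q x y : R) (h u : R -> R[i]) (omega zeta eta : R[i]) (r N : nat).

Definition ext0 h : R -> R[i] := fun y => if 0 < y < 1 then h y else 0.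

(* The copy R[i]^o of R[i] carries its topology. *)
Definition transfer q omega h : R -> R[i] := fun x =>
  lim ((fun N => \sum_(1 <= n < N.+1)
          omega ^+ n * (q / (n%:R + x) ^+ 2)%:C *
          ext0 h (q / (n%:R + x)) : R[i]^o) @ \oo).

(* [:: omega_0; ...; omega_(r-1)]: omega_0 acts first *)
Definition transfer_seq q (omegas : seq R[i]) h : R -> R[i] :=
  foldl (fun g omega => transfer q omega g) h omegas.

Definition transferQ q zeta eta h : R -> R[i] :=
  transfer q zeta (transfer q eta h).

Definition Tq q y : R := q / y - (Num.floor (q / y))%:~R.

Definition digit_itv q (n : nat) : set R :=
  let m := Num.truncn q in
  if n == m then [set` `]q / m.+1%:R, 1[]
  else if (m < n)%N then [set` `]q / n.+1%:R, q / n%:R[]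
  else set0.

Definition cylinder q r (w : r.-tuple nat) : set R :=
  [set y | forall k : 'I_r, digit_itv q (tnth w k) (iter k (Tq q) y)].

Definition cylinders q r : set (set R) :=
  [set C | C !=set0 /\ exists w : r.-tuple nat, C = cylinder q w].

Definition delta q r : R :=
  inf [set fine (lebesgue_measure (iter r (Tq q) @` C)) | C in cylinders q r].

(* T is the operator that F induces on classes modulo null sets. *)
Definition induces (F : (R -> R[i]) -> (R -> R[i]))
    (T : bv_space R -> bv_space R) : Prop :=
  forall f : bv_fun R, exists2 g : bv_fun R,
    F f = g :> (R -> R[i]) & T (bv_class f) = bv_class g.

End TransferOperators.

(* Main.v *)
Require Import Defs.
From HB Require Import structures.
From mathcomp Require Import all_boot all_order all_algebra.
From mathcomp Require Import all_classical all_reals all_analysis.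
From mathcomp Require Import measurable_realfun complex ring lra.

Import Order.TTheory GRing.Theory Num.Theory.
Import numFieldNormedType.Exports.
Import Normc.

Set Implicit Arguments.
Unset Strict Implicit.
Unset Printing Implicit Defensive.

Local Open Scope classical_set_scope.
Local Open Scope ring_scope.
Local Open Scope complex_scope.

(** Write T for the map y |-> fractional part of q / y. The r-fold product of
    transfer operators is a sum over words v of length r,

      (L u)(x) = \sum_v c_v w_v(x) u(psi_v(x)),

    where psi_v is the inverse branch of T^r on the cylinder of v, the term is cut
    off outside the image J_v of that cylinder, w_v = |psi_v'| and |c_v| = 1. It
    is studied one word at a time.

    L1 bound. By the change of variables y = psi_v(x) a single branch carries
    the measure with density w_v to a measure below Lebesgue measure
    (branch_mass_le), and the images of different branches are disjoint, so that
    the operator does not increase the L1 norm (branches_change_le,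
    norm1_transfer_le). The same
    estimate shows that it respects equality almost everywhere, so a
    representative of almost minimal variation may be used throughout.

    Variation. A branch q / (n + x) with values in (0, 1) has derivative of
    modulus at most 1 / q, so w_v <= q^-r on J_v. Moreover psi_v is a Moebius map
    with a denominator c x + d, 0 <= c <= d, so w_v is monotone and varies by a
    factor of at most 4 (wbranch_length). Cutting the product off outside J_v adds
    its boundary values, so that its variation is at most
    W (D + 2 sup |u|), with W a bound of w_v and D the variation of u over the
    cylinder (cut_product_variation). As sup |u| <= |u(y0)| + D for every y0 in
    the cylinder, this is at most 3 q^-r D + 2 W |u(y0)|; averaging over y0, and
    comparing the length of the cylinder with that of J_v by distortion, replaces
    the last term by 8 / delta_r times the integral of |u| over the cylinder
    (wterm_variation_le). Cylinders being disjoint, the sum over finitely many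
    words is bounded by 3 q^-r Var u + (8 / delta_r) |u|_1 (part_rev_variation).
    Digits up to N give operators that converge uniformly on bounded functions,
    and the bound passes to the limit (transfer_rev_pointwise_var, lasota_yorke).
    The constant delta_r is positive because the endpoints of the sets J_v lie in
    a finite set determined by the orbit of 1 (delta_gt0).

    Essential spectral radius. Let L not increase the L1 norm and satisfy
    Var (L^r u) <= 4 theta^r Var u + D_r |u|_1 for all r. Let E replace a function
    by its averages over m equal cells. Then E has finite rank,
    |u - E u|_1 <= 2 Var u / m and Var (u - E u) <= 5 Var u (step_op_approx);
    for m large L^r (1 - E) has norm at most 21 theta^r, while L^r E has finite
    rank. If |lambda| > theta, the first operator has norm at most |lambda|^r / 2
    for large r; then lambda^r - L^r (1 - E) is inverted by a Neumann series, BV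
    being complete (bv_abs_cvg, bv_inverse). As lambda - L divides lambda^r - L^r,
    it is invertible modulo finite rank, hence modulo compact operators
    (parametrix, finite_rank_compact). So the essential spectral radius of L is at
    most theta (ess_spectral_radius_le). The theorem takes theta = q^-1 for a
    single transfer operator and theta = q^-2 for a product of two, whose powers
    are again products of transfer operators (block_operator). *)

(** * Limits of complex sequences *)

Section ComplexLimits.
Context {R : realType}.
Implicit Types (z l : R[i]) (S : nat -> R[i]) (f : R -> R[i]).

Lemma abs_Re_le_normc z : `|complex.Re z| <= normc z.
Proof. by rewrite -lecR; exact: normc_ge_Re. Qed.

Lemma abs_Im_le_normc z : `|complex.Im z| <= normc z.
Proof.
case: z => x y /=; rewrite -sqrtr_sqr; apply: ler_wsqrtr.
by rewrite lerDr sqr_ge0.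
Qed.

Lemma normc_le_ReIm z : normc z <= `|complex.Re z| + `|complex.Im z|.
Proof.
case: z => x y /=.
rewrite -[leRHS]ger0_norm ?addr_ge0// -[leRHS]sqrtr_sqr; apply: ler_wsqrtr.
rewrite sqrrD !real_normK ?num_real// lerD2r lerDl.
by rewrite mulrn_wge0// mulr_ge0.
Qed.

Lemma normcR (x : R) : normc x%:C = `|x|.
Proof. by rewrite /= expr0n/= addr0 sqrtr_sqr. Qed.

Lemma normcB z l : normc (z - l) = normc (l - z).
Proof. by rewrite -normcN opprB. Qed.

Lemma ReB z l : complex.Re (z - l) = complex.Re z - complex.Re l.
Proof. by case: z l => ? ? []. Qed.

Lemma ImB z l : complex.Im (z - l) = complex.Im z - complex.Im l.
Proof. by case: z l => ? ? []. Qed.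

Lemma normcX z n : normc (z ^+ n) = normc z ^+ n.
Proof. by elim: n => [|n ih]; rewrite ?normc1// !exprS normcM ih. Qed.

Lemma normc_sum (I : Type) (r : seq I) (P : pred I) (F : I -> R[i]) :
  normc (\sum_(i <- r | P i) F i) <= \sum_(i <- r | P i) normc (F i).
Proof.
elim/big_ind2: _ => [|x1 x2 y1 y2 h1 h2|//]; first by rewrite normc0.
exact: (le_trans (le_normcD _ _) (lerD h1 h2)).
Qed.

Lemma ltc_real (e : R[i]) : 0 < e -> exists2 d : R, 0 < d & e = d%:C.
Proof.
case: e => d e; rewrite ltcE /= => /andP[/eqP -> d0].
by exists d.
Qed.

Lemma cvgc_dist S l :
  ((S n : R[i]^o) @[n --> \oo] --> (l : R[i]^o)) <->
  (forall e : R, 0 < e -> \forall n \near \oo, normc (S n - l) < e).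
Proof.
split=> [/cvgrPdist_lt Sl e e0|Sl].
  have e0' : 0 < e%:C by rewrite ltcR.
  have := Sl _ e0'; apply: filterS => n.
  rewrite (_ : `|l - S n : R[i]^o| = (normc (l - S n))%:C)// ltcR.
  by rewrite normcB.
apply/cvgrPdist_lt => _ /ltc_real[e e0 ->]; have := Sl e e0; apply: filterS => n.
rewrite (_ : `|l - S n : R[i]^o| = (normc (l - S n))%:C)// ltcR.
by rewrite normcB.
Qed.

Lemma cvgc_ReIm S l :
  ((S n : R[i]^o) @[n --> \oo] --> (l : R[i]^o)) <->
  (complex.Re (S n) @[n --> \oo] --> complex.Re l) /\
  (complex.Im (S n) @[n --> \oo] --> complex.Im l).
Proof.
split=> [/cvgc_dist Sl|[rl il]].
  split; apply/cvgrPdist_lt => e e0; apply: filterS (Sl e e0) => n; apply: le_lt_trans.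
    by rewrite -ReB normcB abs_Re_le_normc.
  by rewrite -ImB normcB abs_Im_le_normc.
apply/cvgc_dist => e e0; have e20 : 0 < e / 2 by rewrite divr_gt0.
move/cvgrPdist_lt/(_ _ e20) : rl => rl; move/cvgrPdist_lt/(_ _ e20) : il => il.
apply: filterS2 rl il => n rn inn; rewrite normcB.
by apply: le_lt_trans (normc_le_ReIm _) _; rewrite ReB ImB (splitr e) ltrD.
Qed.

Lemma abs_cvgc (a : nat -> R[i]) (B : R) :
    (forall N, \sum_(0 <= k < N) normc (a k) <= B) ->
  exists l, forall e : R, 0 < e ->
    \forall N \near \oo, normc (\sum_(0 <= k < N) a k - l) < e.
Proof.
move=> aB.
have ReS N : complex.Re (\sum_(0 <= k < N) a k) = \sum_(0 <= k < N) complex.Re (a k).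
  elim: N => [|N ih]; first by rewrite !big_geq.
  by rewrite !big_nat_recr//= -ih; case: (\sum_(_ <= _ < _) _) (a N) => ? ? [].
have ImS N : complex.Im (\sum_(0 <= k < N) a k) = \sum_(0 <= k < N) complex.Im (a k).
  elim: N => [|N ih]; first by rewrite !big_geq.
  by rewrite !big_nat_recr//= -ih; case: (\sum_(_ <= _ < _) _) (a N) => ? ? [].
have cv (u : nat -> R) : (forall k, `|u k| <= normc (a k)) -> cvgn (series u).
  move=> ua; apply: normed_cvg; apply: nondecreasing_is_cvgn.
    apply/nondecreasing_seqP => N; rewrite /normed_series_of /=.
    by rewrite /series /= big_nat_recr//= lerDl.
  exists B => _ [N _ <-]; apply: le_trans (aB N).
  by apply: ler_sum => k _; exact: ua.
have /cvg_ex[r rl] := cv _ (fun k => abs_Re_le_normc (a k)).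
have /cvg_ex[i il] := cv _ (fun k => abs_Im_le_normc (a k)).
exists (r +i* i); apply/cvgc_dist/cvgc_ReIm; split => /=.
  by under eq_fun do rewrite ReS.
by under eq_fun do rewrite ImS.
Qed.

Lemma cvgc_dist_normc_le (S : nat -> R[i]) (l c : R[i]) (B : R) :
    (forall e : R, 0 < e -> \forall n \near \oo, normc (S n - l) < e) ->
    (\forall n \near \oo, normc (S n - c) <= B) ->
  normc (l - c) <= B.
Proof.
move=> Sl SB; apply/ler_addgt0Pr => e e0.
have [n [h1 h2]] : exists n, normc (S n - l) < e /\ normc (S n - c) <= B.
  have [M _ hM] : \forall n \near \oo, normc (S n - l) < e /\ normc (S n - c) <= B.
    by apply: filterS2 (Sl e e0) SB.
  by exists M; exact: hM (leqnn M).
rewrite (_ : l - c = (S n - c) + (l - S n)); last by rewrite [RHS]addrC addrA subrK.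
by apply: le_trans (le_normcD _ _) _; rewrite lerD// normcB ltW.
Qed.

Definition limc S : R[i] := lim ((S n : R[i]^o) @[n --> \oo]).

Lemma limcE S l :
  (forall e : R, 0 < e -> \forall n \near \oo, normc (S n - l) < e) -> limc S = l.
Proof. by move=> /cvgc_dist; exact: cvg_lim. Qed.

Lemma normc_limc_le S (B : R) :
  (exists l, forall e : R, 0 < e -> \forall n \near \oo, normc (S n - l) < e) ->
  (forall n, normc (S n) <= B) -> normc (limc S) <= B.
Proof.
move=> [l Sl] SB; rewrite (limcE Sl); apply/ler_addgt0Pr => e e0.
have [N _ /(_ _ (leqnn N)) /= h] := Sl e e0.
rewrite -[l](subrK (S N)) addrC; apply: le_trans (le_normcD _ _) _.
by rewrite lerD// normcB ltW.
Qed.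

(** Off the set where it converges the limit takes a fixed default value, so that
    it stays measurable: the set of convergence is described by the Cauchy
    criterion, which is a countable combination of measurable conditions. *)
Lemma measurable_limc (D : set R) (f_ : nat -> R -> R[i]) : measurable D ->
    (forall n, measurable_fun D (fun x => complex.Re (f_ n x))) ->
    (forall n, measurable_fun D (fun x => complex.Im (f_ n x))) ->
  measurable_fun D (fun x => complex.Re (limc (f_ ^~ x))) /\
  measurable_fun D (fun x => complex.Im (limc (f_ ^~ x))).
Proof.
move=> mD mr mi.
pose cr := [set x | cvg (complex.Re (f_ n x) @[n --> \oo])].
pose ci := [set x | cvg (complex.Im (f_ n x) @[n --> \oo])].
have mcvg (h : nat -> R -> R) : (forall n, measurable_fun D (h n)) ->
    measurable (D `&` [set x | cvg (h n x @[n --> \oo])]).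
  move=> mh.
  (* The radii 1 / (k + 1) suffice in the Cauchy criterion. *)
  have -> : D `&` [set x | cvg (h n x @[n --> \oo])] =
      \bigcap_(k in [set: nat]) \bigcup_(M in [set: nat])
        \bigcap_(n in [set n | (M <= n)%N])
        (D `&` [set x | `|h M x - h n x| < k.+1%:R^-1]).
    apply/seteqP; split => [x [Dx /cvg_ex[l /cvgrPdist_lt hl]] k _|x hx].
      have k0 : (0 : R) < k.+1%:R^-1 / 2 by rewrite divr_gt0// invr_gt0.
      have [M _ hM] := hl _ k0; exists M => // n /= Mn; split => //=.
      rewrite (splitr k.+1%:R^-1); apply: le_lt_trans (ler_distD l _ _) _.
      by apply: ltrD; [rewrite distrC|]; apply: hM => /=.
    split; first by have [M _ /(_ M (leqnn _)) []] := hx 0 I.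
    apply/cauchy_cvgP/cauchy_exP => e e0.
    have [k ke] : exists k, k.+1%:R^-1 < e :> R.
      by have [k _ /(_ k (leqnn k))] := near_infty_natSinv_lt (PosNum e0); exists k.
    have [M _ hM] := hx k I; exists (h M x); exists M => // n /= /hM [_ /=].
    by move=> /lt_trans; apply.
  apply: bigcapT_measurable => k; apply: bigcupT_measurable => M.
  apply: bigcap_measurable => [|n _]; first by exists M => /=.
  have mB : measurable_fun D (fun x => `|h M x - h n x|).
    by apply: measurableT_comp => //; exact: measurable_funB.
  have mT : measurable [set true] by [].
  exact: (measurable_fun_ltr mB (measurable_cst (k.+1%:R^-1 : R)) mD mT).
pose A := (D `&` cr) `&` (D `&` ci).
have mA : measurable A by apply: measurableI; exact: mcvg.
have climE x : A x -> (f_ n x : R[i]^o) @[n --> \oo] --> (limc (f_ ^~ x) : R[i]^o).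
  move=> [[_ /cvg_ex[a ra]] [_ /cvg_ex[b ib]]].
  have fl : (f_ n x : R[i]^o) @[n --> \oo] --> (a +i* b : R[i]^o) by exact/cvgc_ReIm.
  by rewrite /limc (cvg_lim _ fl).
(* No limit exists off A, and lim is then the default value. *)
have nclim x : D x -> ~ A x -> limc (f_ ^~ x) = (point : R[i]^o).
  move=> Dx nA; apply: xgetPN => l /cvgc_ReIm[rl il]; apply: nA.
  by split; split=> //; apply/cvg_ex; [exists (complex.Re l)|exists (complex.Im l)].
have glue (h : R -> R) (g_ : nat -> R -> R) (c : R) :
    (forall n, measurable_fun D (g_ n)) ->
    (forall x, A x -> g_ n x @[n --> \oo] --> h x) ->
    (forall x, D x -> ~ A x -> h x = c) -> measurable_fun D h.
  move=> mg gh hc.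
  have AD : A `<=` D by move=> x [[]].
  rewrite -(setDUK AD); apply/measurable_funU => //; first exact: measurableD.
  split.
    apply: (measurable_fun_cvg (h := g_)) => // n; exact: measurable_funS (mg n).
  apply: (eq_measurable_fun (cst c)); last exact: measurable_cst.
  by move=> x; rewrite inE => -[Dx nA]; rewrite hc.
split.
- apply: (glue _ (fun n x => complex.Re (f_ n x))
    (complex.Re (point : R[i]^o))) => // x.
    by move=> /climE/cvgc_ReIm[].
  by move=> Dx nA; rewrite nclim.
- apply: (glue _ (fun n x => complex.Im (f_ n x))
    (complex.Im (point : R[i]^o))) => // x.
    by move=> /climE/cvgc_ReIm[].
  by move=> Dx nA; rewrite nclim.
Qed.

End ComplexLimits.

(** * Change of variables along an inverse branch *)

Section Branches.
Context {R : realType}.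
Implicit Types (q x y : R) (n : nat).

Local Notation mu := (@lebesgue_measure R).
Local Notation I := (@unit_itv R).

Definition branch q n x : R := q / (n%:R + x).
(** The modulus of the derivative of branch q n. *)
Definition branch_wt q n x : R := q / (n%:R + x) ^+ 2.

Lemma unit_itvP x : I x <-> 0 < x < 1.
Proof. by rewrite /unit_itv /= in_itv. Qed.

Section OneBranch.
Variables (q : R) (n : nat).
Hypotheses (q0 : 0 < q) (n0 : (0 < n)%N).

Lemma branch_den_gt0 x : 0 <= x -> 0 < n%:R + x.
Proof. by move=> x0; rewrite ltr_pwDl ?ltr0n. Qed.

Lemma branch_wt_ge0 x : 0 <= branch_wt q n x.
Proof. by rewrite /branch_wt divr_ge0 ?sqr_ge0 ?ltW. Qed.

Lemma branch_gt0 x : 0 <= x -> 0 < branch q n x.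
Proof. by move=> x0; rewrite divr_gt0// branch_den_gt0. Qed.

Lemma branch_derive x : 0 <= x -> is_derive x 1 (fun t => - branch q n t) (branch_wt q n x).
Proof.
move=> x0; have d0 : n%:R + x != 0 by rewrite gt_eqF// branch_den_gt0.
have dd : is_derive x 1 (fun t : R => n%:R + t) 1.
  rewrite -[X in is_derive _ _ _ X]add0r; exact: is_deriveD.
have dv := is_deriveV d0 dd.
have dm : is_derive x 1 (fun t : R => (- q) *: (n%:R + t)^-1) ((- q) *: (- (n%:R + x) ^- 2 *: (1 : R))).
  exact: is_deriveZ.
have -> : (fun t => - branch q n t) = (fun t : R => (- q) *: (n%:R + t)^-1).
  by apply/funext => t; rewrite /branch /GRing.scale/= mulNr.
apply: is_derive_eq dm _.
by rewrite /GRing.scale /branch_wt/= mulr1 mulrNN.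
Qed.

Lemma branch_continuous x : 0 <= x -> {for x, continuous (branch q n)}.
Proof.
move=> x0; apply: cvgMr; apply: cvgV; first by rewrite gt_eqF// branch_den_gt0.
by apply: cvgD; [exact: cvg_cst|exact: cvg_id].
Qed.

Lemma branch_wt_continuous x : 0 <= x -> {for x, continuous (branch_wt q n)}.
Proof.
move=> x0; apply: cvgMr; apply: cvgV; first by rewrite expf_neq0// gt_eqF// branch_den_gt0.
apply: cvgM; (apply: cvgD; [exact: cvg_cst|exact: cvg_id]).
Qed.

Lemma integral_branch_wt (a b : R) : 0 <= a -> a < b ->
  (\int[mu]_(x in `[a, b]) (branch_wt q n x)%:E = (branch q n a - branch q n b)%:E)%E.
Proof.
move=> a0 ab; rewrite (continuous_FTC2 (F := fun t => - branch q n t) ab).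
- by rewrite -EFinB opprK addrC.
- apply: continuous_in_subspaceT => x; rewrite inE/= in_itv/= => /andP[ax _].
  exact/branch_wt_continuous/(le_trans a0).
- split.
  + move=> x; rewrite in_itv/= => /andP[/ltW ax _].
    by have [] := branch_derive (le_trans a0 ax).
  + by apply: cvg_at_right_filter; apply: cvgN; exact: branch_continuous.
  + apply: cvg_at_left_filter; apply: cvgN; apply: branch_continuous.
    exact/ltW/(le_lt_trans a0).
- move=> x; rewrite in_itv/= => /andP[/ltW ax _].
  have xd := branch_derive (le_trans a0 ax).
  by rewrite derive1E derive_val.
Qed.

Lemma measurable_branch : measurable_fun I (branch q n).
Proof.
apply: open_continuous_measurable_fun; first exact: interval_open.
move=> x; rewrite inE => /unit_itvP/andP[x0 _].
exact/branch_continuous/ltW.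
Qed.

Lemma measurable_branch_wt : measurable_fun I (branch_wt q n).
Proof.
apply: open_continuous_measurable_fun; first exact: interval_open.
move=> x; rewrite inE => /unit_itvP/andP[x0 _].
exact/branch_wt_continuous/ltW.
Qed.

Lemma branch_le x t : 0 <= x -> 0 < t -> (branch q n x <= t) = (q / t - n%:R <= x).
Proof.
move=> x0 t0; rewrite /branch ler_pdivrMr ?branch_den_gt0// lerBlDl.
by rewrite ler_pdivrMr// mulrC.
Qed.

Lemma branch_ge x t : 0 <= x -> 0 < t -> (t <= branch q n x) = (x <= q / t - n%:R).
Proof.
move=> x0 t0; rewrite /branch ler_pdivlMr ?branch_den_gt0// lerBrDl.
by rewrite ler_pdivlMr// mulrC.
Qed.

Lemma branchK t : 0 < t -> branch q n (q / t - n%:R) = t.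
Proof.
move=> t0; rewrite /branch addrCA subrr addr0 invf_div mulrCA divff ?mulr1//.
by rewrite gt_eqF.
Qed.

Lemma measurable_wt_comp (F : R -> \bar R) : measurable_fun setT F ->
  measurable_fun I (fun x => ((branch_wt q n x)%:E * F (branch q n x))%E).
Proof.
move=> mF; apply: emeasurable_funM; first by apply/measurable_EFinP; exact: measurable_branch_wt.
by apply: measurableT_comp => //; exact: measurable_branch.
Qed.

Lemma measurable_wt_indic (A : set R) : measurable A ->
  measurable_fun I (fun x => ((branch_wt q n x)%:E * (\1_A (branch q n x))%:E)%E).
Proof.
move=> mA; apply: (measurable_wt_comp (F := fun y => (\1_A y)%:E)).
by apply/measurable_EFinP; exact: measurable_indic.
Qed.

(** Only the part of the interval inside the range of the branch has preimages;
    on it the branch is a decreasing bijection, so the weight integrates to its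
    length. *)
Lemma branch_mass_ocitv (c d : R) :
  (\int[mu]_(x in I) ((branch_wt q n x)%:E * (\1_(`]c, d]) (branch q n x))%:E)
     <= wlength idfun `]c, d])%E.
Proof.
pose c' := Num.max c (branch q n 1); pose d' := Num.min d (branch q n 0).
have b1 : 0 < branch q n 1 by exact: branch_gt0.
have c'0 : 0 < c' by rewrite lt_max b1 orbT.
have sub x : I x -> branch q n x \in `]c, d] -> c' <= branch q n x <= d'.
  move=> /unit_itvP/andP[/ltW x0 /ltW x1]; rewrite in_itv/= => /andP[cx xd].
  rewrite /c' /d' ge_max le_min xd (ltW cx)/=.
  rewrite branch_ge ?branch_le ?branch_gt0// ?ler01//.
  have e (z : R) : q / branch q n z - n%:R = z.
    by rewrite /branch invf_div mulrCA divff ?(gt_eqF q0)// mulr1 addrAC subrr add0r.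
  by rewrite !e x0 x1.
have [dc|cd] := ltP d' c'.
  rewrite integral0_eq ?wlength_ge0// => x Ix; rewrite indicE.
  case: (boolP (_ \in _)) => [|_]; last by rewrite mule0.
  by rewrite inE => /(sub _ Ix)/andP[/le_trans/[apply]]; rewrite leNgt dc.
have d'0 : 0 < d' by exact: lt_le_trans cd.
(* The preimages of the endpoints, exchanged because the branch decreases. *)
pose lo := q / d' - n%:R; pose hi := q / c' - n%:R.
have lo0 : 0 <= lo.
  rewrite /lo subr_ge0 ler_pdivlMr// mulrC -ler_pdivlMr ?ltr0n//.
  by rewrite /d' ge_min /branch addr0 lexx orbT.
apply: (@le_trans _ _ (\int[mu]_(x in `[lo, hi]) (branch_wt q n x)%:E)%E).
  have mlo : measurable_fun `[lo, hi] (branch_wt q n).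
    apply: subspace_continuous_measurable_fun => //.
    apply: continuous_in_subspaceT => x; rewrite inE/= in_itv/= => /andP[ax _].
    exact/branch_wt_continuous/(le_trans lo0).
  apply: (@le_trans _ _ (\int[mu]_(x in I `&` `[lo, hi]) (branch_wt q n x)%:E)%E).
    rewrite integral_mkcondr; apply: ge0_le_integral => //.
    - exact: measurable_unit_itv.
    - by move=> x _; rewrite mule_ge0// lee_fin// branch_wt_ge0.
    - exact: measurable_wt_indic.
    - apply/measurable_restrict => //; first exact: measurable_unit_itv.
      apply/measurable_EFinP; apply: measurable_funS measurable_branch_wt => //.
      exact: measurable_unit_itv.
    - move=> x Ix; rewrite patchE indicE; case: (boolP (branch q n x \in _)).
        rewrite inE => /(sub _ Ix)/andP[cx xd]; rewrite mule1.
        rewrite ifT// inE/= in_itv/=.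
        move: (Ix) => /unit_itvP/andP[/ltW x0 _].
        by rewrite /lo /hi -branch_le -?branch_ge ?cx ?xd.
      by rewrite mule0; case: ifP => _ _ //; rewrite lee_fin branch_wt_ge0.
  apply: ge0_subset_integral => //.
  - by apply: measurableI => //; exact: measurable_unit_itv.
  - exact/measurable_EFinP.
  - by move=> x _; rewrite lee_fin branch_wt_ge0.
move: cd; rewrite le_eqVlt => /predU1P[cd|cd].
  by rewrite /lo /hi cd set_itv1 integral_set1 wlength_ge0.
have lohi : lo < hi by rewrite /lo /hi ltrD2r ltr_pM2l// ltf_pV2 ?posrE.
rewrite integral_branch_wt// /lo /hi !branchK// wlength_itv/= lte_fin.
have cd' : c < d.
  apply: le_lt_trans (_ : c <= c') _; first by rewrite /c' le_max lexx.
  by apply: lt_le_trans cd _; rewrite /d' ge_min lexx.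
rewrite cd' -EFinB lee_fin lerB//; first by rewrite /d' ge_min lexx.
by rewrite /c' le_max lexx.
Qed.

(** The weighted image measure is dominated by Lebesgue measure on half-open
    intervals, hence, Lebesgue measure being the infimum over countable covers by
    such intervals, on every Borel set. *)
Lemma branch_mass_le (A : set R) : measurable A ->
  (\int[mu]_(x in I) ((branch_wt q n x)%:E * (\1_A (branch q n x))%:E) <= mu A)%E.
Proof.
move=> mA; apply: le_ereal_inf_tmp => _ [F [mF AF] <-].
have mFm k : measurable (F k : set R).
  have := mF k; exact: sub_sigma_algebra.
apply: (@le_trans _ _ (\sum_(0 <= k <oo) \int[mu]_(x in I)
    ((branch_wt q n x)%:E * (\1_(F k) (branch q n x))%:E))%E); last first.
  apply: lee_nneseries => k _.
    by move=> _; apply: integral_ge0 => x _; rewrite mule_ge0// lee_fin// branch_wt_ge0.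
  have [[c d] _ <-] := mF k; exact: branch_mass_ocitv.
have mg k : measurable_fun I (fun x => ((branch_wt q n x)%:E * (\1_(F k) (branch q n x))%:E)%E).
  exact: measurable_wt_indic.
have g0 k x : (0 <= (branch_wt q n x)%:E * (\1_(F k) (branch q n x))%:E)%E.
  by rewrite mule_ge0// lee_fin// branch_wt_ge0.
rewrite -integral_nneseries//; last exact: measurable_unit_itv.
apply: ge0_le_integral => //.
- exact: measurable_unit_itv.
- by move=> x _; rewrite mule_ge0// lee_fin// branch_wt_ge0.
- exact: measurable_wt_indic.
- apply: ge0_emeasurable_sum => [k x _ _|k _]; [exact: g0|exact: mg].
- move=> x Ix; rewrite indicE; case: (boolP (_ \in _)) => [|_]; last first.
    by rewrite mule0; apply: nneseries_ge0 => k _ _.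
  rewrite inE => /AF[k _ Fk]; apply: le_trans (nneseries_lim_ge k.+1 _) => //.
  rewrite big_nat_recr//= indicE mem_set// leeDr//.
  by apply: sume_ge0 => // i _; exact: g0.
Qed.

Import HBNNSimple.

Lemma branch_change_le (F : R -> \bar R) : measurable_fun setT F ->
    (forall y, (0 <= F y)%E) ->
  (\int[mu]_(x in I) ((branch_wt q n x)%:E * F (branch q n x)) <= \int[mu]_y F y)%E.
Proof.
move=> mF F0; pose f_ := nnsfun_approx measurableT mF.
have mf k : measurable_fun setT (fun x => (f_ k x)%:E) by exact/measurable_EFinP.
have w0 x : (0 <= (branch_wt q n x)%:E)%E by rewrite lee_fin branch_wt_ge0.
have F_lim y : F y = limn (fun k => (f_ k y)%:E).
  by apply/esym/cvg_lim => //=; exact: cvg_nnsfun_approx.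
have nd x : {homo (fun k => (f_ k x)%:E) : a b / (a <= b)%N >-> (a <= b)%E}.
  by move=> a b ab; rewrite lee_fin; exact/lefP/nd_nnsfun_approx.
have mwf k : measurable_fun I
    (fun x => ((branch_wt q n x)%:E * (f_ k (branch q n x))%:E)%E).
  exact: (measurable_wt_comp (F := fun y => (f_ k y)%:E)).
have ndw x : {homo (fun k => ((branch_wt q n x)%:E * (f_ k (branch q n x))%:E)%E) :
    a b / (a <= b)%N >-> (a <= b)%E}.
  by move=> a b ab; apply: lee_wpmul2l => //; exact: nd.
have simple k : (\int[mu]_(x in I) ((branch_wt q n x)%:E * (f_ k (branch q n x))%:E)
    <= \int[mu]_y (f_ k y)%:E)%E.
  have mA r : measurable (f_ k @^-1` [set r]) by exact: measurable_sfunP.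
  under [leLHS]eq_integral.
    move=> x xD; rewrite fimfunE -fsumEFin// ge0_mule_fsumr; last first.
      by move=> r; rewrite EFinM nnfun_muleindic_ge0.
    over.
  under [leRHS]eq_integral do rewrite fimfunE -fsumEFin//.
  rewrite ge0_integral_fsum//=; last 3 first.
  - exact: measurable_unit_itv.
  - move=> r; apply: (eq_measurable_fun (fun x => (r%:E * ((branch_wt q n x)%:E *
        (\1_(f_ k @^-1` [set r]) (branch q n x))%:E))%E)).
      by move=> x _; rewrite (EFinM r) muleCA.
    by apply: measurable_funeM; apply: measurable_wt_indic; exact: mA.
  - by move=> r x _; rewrite mule_ge0// EFinM nnfun_muleindic_ge0.
  rewrite [leRHS]ge0_integral_fsum//; last 2 first.
  - move=> r; apply/measurable_EFinP; apply: measurable_funM => //.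
    by apply: measurable_indic; exact: mA.
  - by move=> r x _; rewrite EFinM nnfun_muleindic_ge0.
  apply: lee_fsum => // r _.
  have [r0|r0] := ltP r 0.
    rewrite !integral0_eq// => x _; rewrite preimage_nnfun0// indic0/=.
      by rewrite mulr0 mule0.
    by rewrite mulr0.
  under [leLHS]eq_integral do rewrite (EFinM r) muleCA.
  under [leRHS]eq_integral do rewrite (EFinM r).
  rewrite ge0_integralZl_EFin//; last 3 first.
  - exact: measurable_unit_itv.
  - by move=> x _; rewrite mule_ge0// lee_fin.
  - by apply: measurable_wt_indic; exact: mA.
  rewrite [leRHS]ge0_integralZl_EFin//; last first.
    by apply/measurable_EFinP; apply: measurable_indic; exact: mA.
  apply: lee_wpmul2l; first by rewrite lee_fin.
  rewrite integral_indic//; last exact: mA.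
  by rewrite setIT; apply: branch_mass_le; exact: mA.
have -> : (\int[mu]_y F y = \int[mu]_y (limn (fun k => (f_ k y)%:E)))%E.
  by apply: eq_integral => y _; rewrite F_lim.
have -> : (\int[mu]_(x in I) ((branch_wt q n x)%:E * F (branch q n x)) =
    \int[mu]_(x in I) limn (fun k =>
      ((branch_wt q n x)%:E * (f_ k (branch q n x))%:E)%E))%E.
  apply: eq_integral => x _; rewrite limeMl// ?F_lim//.
  by apply: ereal_nondecreasing_is_cvgn; exact: nd.
have wf0 k x : I x -> (0 <= (branch_wt q n x)%:E * (f_ k (branch q n x))%:E)%E.
  by move=> _; rewrite mule_ge0// lee_fin.
rewrite (monotone_convergence mu measurable_unit_itv mwf wf0)//.
have f0 k y : setT y -> (0 <= (f_ k y)%:E)%E by move=> _; rewrite lee_fin.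
rewrite (monotone_convergence mu measurableT mf f0)//.
apply: lee_lim.
- apply: ereal_nondecreasing_is_cvgn => a b ab; apply: ge0_le_integral => //.
  + exact: measurable_unit_itv.
  + exact: wf0.
  + exact: mwf.
  + exact: mwf.
  + by move=> x _; exact: ndw.
- apply: ereal_nondecreasing_is_cvgn => a b ab; apply: ge0_le_integral => //.
  + by move=> x _; rewrite lee_fin.
  + exact: mf.
  + exact: mf.
  + by move=> x _; exact: nd.
- by apply: nearW => k; exact: simple.
Qed.

(** The weight is positive, so a null set pulls back to a null set. *)
Lemma branch_null (N : set R) : mu.-negligible N ->
  mu.-negligible (I `&` branch q n @^-1` N).
Proof.
move=> [A [mA A0 NA]]; pose F y : \bar R := (\1_A y)%:E.
have mF : measurable_fun setT F.
  by apply/measurable_EFinP; exact: measurable_indic.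
have F0 y : (0 <= F y)%E by rewrite lee_fin.
have wF0 x : (0 <= (branch_wt q n x)%:E * F (branch q n x))%E.
  by rewrite mule_ge0// lee_fin branch_wt_ge0//.
have Fi0 : (\int[mu]_y F y = 0)%E.
  by rewrite /F integral_indic// setIT; exact: A0.
have := branch_change_le mF F0; rewrite Fi0 => int0.
have /(ae_eq_integral_abs mu measurable_unit_itv) [+ _] := measurable_wt_comp mF.
under eq_integral do rewrite gee0_abs ?wF0//.
have -> : (\int[mu]_(x in I) ((branch_wt q n x)%:E * F (branch q n x)) = 0)%E.
  by apply/eqP; rewrite eq_le int0/=; apply: integral_ge0.
move=> /(_ erefl); apply: negligibleS => x [Ix Nx] /=.
move=> /(_ Ix)/eqP; rewrite /F indicE mem_set ?mule1 ?gt_eqF//; last exact: NA.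
rewrite lte_fin divr_gt0// exprn_gt0// branch_den_gt0//.
by case/unit_itvP/andP: Ix => /ltW.
Qed.

End OneBranch.
(** The images of the branches are pairwise disjoint, so that summing the
    estimate for one branch over all branches counts no mass twice. *)
Lemma branches_change_le q (F : R -> \bar R) : 0 < q ->
    measurable_fun setT F -> (forall y, (0 <= F y)%E) ->
  (\int[mu]_(x in I) (\sum_(0 <= k <oo)
     ((branch_wt q k.+1 x)%:E * F (branch q k.+1 x))) <= \int[mu]_y F y)%E.
Proof.
move=> q0 mF F0; pose D k : set R := [set` `]q / k.+2%:R, q / k.+1%:R[ ].
have mD k : measurable (D k) by exact: measurable_itv.
rewrite integral_nneseries//; last 3 first.
- exact: measurable_unit_itv.
- by move=> k; exact: measurable_wt_comp.
- by move=> k x _; rewrite mule_ge0// lee_fin branch_wt_ge0//.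
apply: (@le_trans _ _ (\sum_(0 <= k <oo) \int[mu]_(y in D k) F y)%E).
  apply: lee_nneseries => k _.
    by move=> _; apply: integral_ge0 => x _; rewrite mule_ge0// lee_fin branch_wt_ge0//.
  rewrite [leRHS]integral_mkcond.
  apply: le_trans (branch_change_le (n := k.+1) q0 _ _ _) => //; last 2 first.
  - by apply/(measurable_restrictT _ (mD k)); exact: measurable_funTS.
  - by move=> y; rewrite patchE; case: ifP.
  rewrite le_eqVlt; apply/orP; left; apply/eqP; apply: eq_integral => x.
  rewrite inE => /unit_itvP/andP[x0 x1]; rewrite patchE ifT//.
  have d0 : 0 < k.+1%:R + x by rewrite addr_gt0.
  rewrite inE /D /= in_itv/= /branch ltr_pM2l// ltr_pM2l// !ltf_pV2 ?posrE ?ltr0n//.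
  by rewrite -[k.+2]addn1 natrD ltrD2l x1 ltrDl x0.
have tD : trivIset setT D.
  apply: ltn_trivIset => j i ij; apply/seteqP; split => // y [].
  rewrite /D /= !in_itv/= => /andP[y1 y2] /andP[y3 y4].
  have := lt_trans y1 y4; have := lt_trans y3 y2.
  rewrite !ltr_pM2l// !ltf_pV2 ?posrE ?ltr0n// !ltr_nat !ltnS => h1 h2.
  by have := leq_trans ij h2; rewrite ltnn.
rewrite -ge0_integral_bigcup//; last first.
  exact: (measurable_funS measurableT (@subsetT _ _) mF).
apply: ge0_subset_integral => //.
by apply: bigcup_measurable => k _; exact: mD.
Qed.

End Branches.

(** * The transfer operator on integrable functions *)

Section TransferL1.
Context {R : realType}.
Implicit Types (q x y : R) (n N : nat) (f g h : R -> R[i]) (omega : R[i]).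

Local Notation mu := (@lebesgue_measure R).
Local Notation I := (@unit_itv R).

Definition transfer_term q omega h x k : R[i] :=
  omega ^+ k.+1 * (branch_wt q k.+1 x)%:C * ext0 h (branch q k.+1 x).

Definition transfer_part q omega N h x : R[i] :=
  \sum_(0 <= k < N) transfer_term q omega h x k.

Lemma transferE q omega h x :
  transfer q omega h x = limc (fun N => transfer_part q omega N h x).
Proof.
by rewrite /transfer /limc; under eq_fun do rewrite big_add1.
Qed.

Lemma normc_transfer_term q omega h x k : 0 < q -> normc omega = 1 ->
  normc (transfer_term q omega h x k) =
    branch_wt q k.+1 x * normc (ext0 h (branch q k.+1 x)).
Proof.
move=> q0 o1; rewrite /transfer_term !normcM normcX o1 expr1n mul1r normcR.
by rewrite ger0_norm// branch_wt_ge0.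
Qed.

Lemma ext0_unit h y : I y -> ext0 h y = h y.
Proof. by move=> /unit_itvP yI; rewrite /ext0 yI. Qed.

Lemma ext0_out h y : ~ I y -> ext0 h y = 0.
Proof. by move=> yI; rewrite /ext0; case: ifPn => // /unit_itvP. Qed.

Lemma measurable_ext0 h :
    measurable_fun I (fun x => complex.Re (h x)) ->
    measurable_fun I (fun x => complex.Im (h x)) ->
  measurable_fun setT (fun x => complex.Re (ext0 h x)) /\
  measurable_fun setT (fun x => complex.Im (ext0 h x)).
Proof.
move=> mr mi; have mI := @measurable_unit_itv R; split.
- rewrite (_ : (fun x => complex.Re (ext0 h x)) = (fun x => complex.Re (h x)) \_ I).
    exact/(measurable_restrictT _ mI).
  apply/funext => x; rewrite patchE; case: ifPn => [|]; rewrite ?inE ?notin_setE => xI.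
    by rewrite ext0_unit.
  by rewrite ext0_out.
- rewrite (_ : (fun x => complex.Im (ext0 h x)) = (fun x => complex.Im (h x)) \_ I).
    exact/(measurable_restrictT _ mI).
  apply/funext => x; rewrite patchE; case: ifPn => [|]; rewrite ?inE ?notin_setE => xI.
    by rewrite ext0_unit.
  by rewrite ext0_out.
Qed.

Lemma measurable_transfer_part q omega N h : 0 < q ->
    measurable_fun I (fun x => complex.Re (h x)) ->
    measurable_fun I (fun x => complex.Im (h x)) ->
  measurable_fun I (fun x => complex.Re (transfer_part q omega N h x)) /\
  measurable_fun I (fun x => complex.Im (transfer_part q omega N h x)).
Proof.
move=> q0 mr mi; have [mer mei] := measurable_ext0 mr mi.
elim: N => [|N [ihr ihi]].
  by split; (under eq_fun do rewrite /transfer_part big_geq//); exact: measurable_cst.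
have mw := @measurable_branch_wt _ q N.+1 isT.
have mb := @measurable_branch _ q N.+1 isT.
have mfr : measurable_fun I (fun x => complex.Re (ext0 h (branch q N.+1 x))).
  exact: (measurableT_comp mer mb).
have mfi : measurable_fun I (fun x => complex.Im (ext0 h (branch q N.+1 x))).
  exact: (measurableT_comp mei mb).
pose z := omega ^+ N.+1.
split; under eq_fun do rewrite /transfer_part big_nat_recr//=.
  apply: (eq_measurable_fun (fun x => complex.Re (transfer_part q omega N h x) +
    branch_wt q N.+1 x * (complex.Re z * complex.Re (ext0 h (branch q N.+1 x)) -
       complex.Im z * complex.Im (ext0 h (branch q N.+1 x))))).
    move=> x _; rewrite /transfer_term -/z -[X in _ = complex.Re (X + _)]/(transfer_part q omega N h x).
    case: (transfer_part _ _ _ _ _) => a b; case: z => c d; case: (ext0 h _) => s t /=.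
    by ring.
  apply: measurable_funD => //; apply: measurable_funM => //.
  by apply: measurable_funB; apply: measurable_funM.
apply: (eq_measurable_fun (fun x => complex.Im (transfer_part q omega N h x) +
  branch_wt q N.+1 x * (complex.Re z * complex.Im (ext0 h (branch q N.+1 x)) +
     complex.Im z * complex.Re (ext0 h (branch q N.+1 x))))).
  move=> x _; rewrite /transfer_term -/z -[X in _ = complex.Im (X + _)]/(transfer_part q omega N h x).
  case: (transfer_part _ _ _ _ _) => a b; case: z => c d; case: (ext0 h _) => s t /=.
  by ring.
apply: measurable_funD => //; apply: measurable_funM => //.
by apply: measurable_funD; apply: measurable_funM.
Qed.

Lemma measurable_transfer q omega h : 0 < q ->
    measurable_fun I (fun x => complex.Re (h x)) ->
    measurable_fun I (fun x => complex.Im (h x)) ->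
  measurable_fun I (fun x => complex.Re (transfer q omega h x)) /\
  measurable_fun I (fun x => complex.Im (transfer q omega h x)).
Proof.
move=> q0 mr mi.
have [mr' mi'] := @measurable_limc R I (fun N x => transfer_part q omega N h x)
  (@measurable_unit_itv R) (fun N => (measurable_transfer_part omega N q0 mr mi).1)
  (fun N => (measurable_transfer_part omega N q0 mr mi).2).
by split; under eq_fun do rewrite transferE.
Qed.

Lemma transfer_ae q omega f g : 0 < q -> ae_eq mu I f g ->
  ae_eq mu I (transfer q omega f) (transfer q omega g).
Proof.
move=> q0 fg.
have : mu.-negligible (\bigcup_k (I `&` branch q k.+1 @^-1` (~` [set x | I x -> f x = g x]))).
  by apply: negligible_bigcup => k; exact: branch_null.
apply: negligibleS => x /= /not_implyP[Ix].
apply: contra_notP => nx; rewrite !transferE; congr limc; apply/funext => N.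
apply: eq_bigr => k _; rewrite /transfer_term; congr (_ * _).
have [yI|yI] := pselect (I (branch q k.+1 x)); last by rewrite !ext0_out.
rewrite !ext0_unit//; apply: contrapT => fgn; apply: nx; exists k => //.
by split => //= /(_ yI).
Qed.

Lemma normc_transfer_le q omega h x : 0 < q -> normc omega = 1 ->
  ((normc (transfer q omega h x))%:E <= \sum_(0 <= k <oo)
     ((branch_wt q k.+1 x)%:E * (normc (ext0 h (branch q k.+1 x)))%:E))%E.
Proof.
move=> q0 o1; set S := (X in (_ <= X)%E).
have t0 k : (0 <= (branch_wt q k.+1 x)%:E * (normc (ext0 h (branch q k.+1 x)))%:E)%E.
  by rewrite mule_ge0// lee_fin ?branch_wt_ge0 ?normc_ge0.
have partS N : ((\sum_(0 <= k < N) normc (transfer_term q omega h x k))%:E <= S)%E.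
  rewrite -sumEFin; under eq_bigr do rewrite normc_transfer_term// EFinM.
  by apply: nneseries_lim_ge.
have S0 : (0 <= S)%E by apply: nneseries_ge0 => k _ _.
have [Soo|Soo] := eqVneq S +oo%E; first by rewrite Soo leey.
have Sfin : S \is a fin_num by rewrite ge0_fin_numE// lt_neqAle Soo leey.
have sB N : \sum_(0 <= k < N) normc (transfer_term q omega h x k) <= fine S.
  by rewrite -lee_fin fineK.
rewrite -(fineK Sfin) lee_fin transferE; apply: normc_limc_le (abs_cvgc sB) _ => N.
exact: le_trans (normc_sum _ _ _) (sB N).
Qed.

Lemma measurable_normc_ext0 h : inL1 h ->
  measurable_fun setT (fun y => (normc (ext0 h y))%:E).
Proof.
move=> [mr mi _]; apply/measurable_EFinP.
have mI := @measurable_unit_itv R.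
rewrite (_ : (fun x => normc (ext0 h x)) = (fun x => normc (h x)) \_ I).
  by apply/(measurable_restrictT _ mI); exact: measurable_normc.
apply/funext => x; rewrite patchE; case: ifPn => [|]; rewrite ?inE ?notin_setE => xI.
  by rewrite ext0_unit.
by rewrite ext0_out// normc0.
Qed.

Lemma norm1_ext0 h : norm1 h = (\int[mu]_y (normc (ext0 h y))%:E)%E.
Proof.
rewrite /norm1 integral_mkcond; apply: eq_integral => x _; rewrite patchE.
case: ifPn => [|]; rewrite ?inE ?notin_setE => xI; first by rewrite ext0_unit.
by rewrite ext0_out// (normc0 R).
Qed.

Lemma norm1_transfer_le q omega h : 0 < q -> normc omega = 1 -> inL1 h ->
  (norm1 (transfer q omega h) <= norm1 h)%E.
Proof.
move=> q0 o1 hL; have [mr mi _] := hL.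
have [mtr mti] := measurable_transfer omega q0 mr mi.
have mF := measurable_normc_ext0 hL.
apply: (@le_trans _ _ (\int[mu]_(x in I) (\sum_(0 <= k <oo)
     ((branch_wt q k.+1 x)%:E * (normc (ext0 h (branch q k.+1 x)))%:E)))%E).
  apply: ge0_le_integral => //.
  - exact: measurable_unit_itv.
  - by move=> x _; rewrite lee_fin normc_ge0.
  - by apply/measurable_EFinP; exact: measurable_normc.
  - apply: ge0_emeasurable_sum => [k x _ _|k _].
      by rewrite mule_ge0// lee_fin ?branch_wt_ge0 ?normc_ge0.
    exact: (measurable_wt_comp _ _ mF).
  - by move=> x _; exact: normc_transfer_le.
rewrite norm1_ext0; apply: (branches_change_le (F := fun y => (normc (ext0 h y))%:E)) => //.
by move=> y; rewrite lee_fin normc_ge0.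
Qed.

Lemma inL1_transfer q omega h : 0 < q -> normc omega = 1 -> inL1 h ->
  inL1 (transfer q omega h).
Proof.
move=> q0 o1 hL; have [mr mi h1] := hL.
have [mtr mti] := measurable_transfer omega q0 mr mi.
by split => //; exact: le_lt_trans (norm1_transfer_le q0 o1 hL) h1.
Qed.

End TransferL1.

(** * The transfer operator on bounded functions *)

Section TransferBounded.
Context {R : realType}.
Implicit Types (q x y K : R) (n N : nat) (f g h : R -> R[i]) (omega : R[i]).

Local Notation I := (@unit_itv R).

(** The weight of branch k + 1 is at most q / k - q / (k + 1), which telescopes. *)
Lemma branch_wt_sum q x (M N : nat) : 0 < q -> 0 <= x -> (0 < M)%N ->
  \sum_(M <= k < N) branch_wt q k.+1 x <= q / M%:R.
Proof.
move=> q0 x0 M0.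
have [NM|MN] := leqP N M; first by rewrite big_geq// divr_ge0// ltW.
apply: (@le_trans _ _ (\sum_(M <= k < N) (- (q / k.+1%:R) - - (q / k%:R)))); last first.
  rewrite telescope_sumr ?(ltnW MN)// opprK addrC gerBl.
  by rewrite divr_ge0// ltW.
apply: ler_sum_nat => k /andP[Mk _].
have k0 : 0 < k%:R :> R by rewrite ltr0n (leq_trans M0).
have k10 : 0 < k.+1%:R :> R by rewrite ltr0n.
rewrite opprK addrC -mulrBr /branch_wt ler_pM2l//.
apply: (@le_trans _ _ (k.+1%:R ^- 2)).
  have d0 := branch_den_gt0 (ltn0Sn k) x0.
  by rewrite lef_pV2 ?posrE ?exprn_gt0// ler_pXn2r ?nnegrE ?(ltW d0)// lerDl.
rewrite -subr_ge0.
have -> : k%:R^-1 - k.+1%:R^-1 - k.+1%:R ^- 2 = (k%:R * k.+1%:R ^+ 2)^-1 :> R.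
  have -> : k.+1%:R = k%:R + 1 :> R by rewrite -addn1 natrD.
  by field; rewrite gt_eqF//= gt_eqF// ltr_wpDl ?ltr0n// ltW.
by rewrite invr_ge0 mulr_ge0 ?exprn_ge0 ?ltW.
Qed.

Definition bounded_by K h := forall y, I y -> normc (h y) <= K.

Lemma bounded_ext0 K h y : 0 <= K -> bounded_by K h -> normc (ext0 h y) <= K.
Proof.
move=> K0 hK; have [yI|yI] := pselect (I y); first by rewrite ext0_unit// hK.
by rewrite ext0_out// normc0.
Qed.

Lemma transfer_terms_le q omega h K x (M N : nat) : 0 < q -> normc omega = 1 ->
    0 <= K -> bounded_by K h -> I x -> (0 < M)%N ->
  \sum_(M <= k < N) normc (transfer_term q omega h x k) <= K * (q / M%:R).
Proof.
move=> q0 o1 K0 hK /unit_itvP/andP[/ltW x0 _] M0.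
apply: (@le_trans _ _ (\sum_(M <= k < N) K * branch_wt q k.+1 x)).
  apply: ler_sum => k _; rewrite normc_transfer_term// mulrC.
  by rewrite ler_wpM2r ?branch_wt_ge0// bounded_ext0.
by rewrite -mulr_sumr ler_wpM2l// branch_wt_sum.
Qed.

(** The first branch is treated apart: the telescoping bound of its weight would be
    q / 0. *)
Lemma transfer_terms0_le q omega h K x (N : nat) : 0 < q -> normc omega = 1 ->
    0 <= K -> bounded_by K h -> I x ->
  \sum_(0 <= k < N) normc (transfer_term q omega h x k) <= K * (2 * q).
Proof.
move=> q0 o1 K0 hK xI; case: N => [|N].
  by rewrite big_geq// mulr_ge0// mulr_ge0// ltW.
rewrite big_nat_recl//= (mulr_natl q 2) mulr2n mulrDr lerD//.
  rewrite normc_transfer_term// mulrC ler_pM ?normc_ge0 ?branch_wt_ge0//.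
    exact: bounded_ext0.
  have /andP[x0 _] := (unit_itvP x).1 xI.
  rewrite /branch_wt ler_piMr//; first exact: ltW.
  by rewrite invf_le1 ?exprn_gt0 ?addr_gt0// exprn_ege1// lerDl ltW.
have := transfer_terms_le N.+1 q0 o1 K0 hK xI (ltn0Sn 0).
by rewrite big_add1/= divr1.
Qed.

Lemma bounded_transfer_part q omega h K N : 0 < q -> normc omega = 1 ->
    0 <= K -> bounded_by K h ->
  bounded_by (K * (2 * q)) (transfer_part q omega N h).
Proof.
move=> q0 o1 K0 hK x xI; apply: le_trans (normc_sum _ _ _) _.
exact: transfer_terms0_le.
Qed.

Lemma transfer_cvg q omega h K x : 0 < q -> normc omega = 1 ->
    0 <= K -> bounded_by K h -> I x ->
  forall e : R, 0 < e -> \forall N \near \oo,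
    normc (transfer_part q omega N h x - transfer q omega h x) < e.
Proof.
move=> q0 o1 K0 hK xI; rewrite transferE.
have [l hl] := abs_cvgc (fun N => transfer_terms0_le N q0 o1 K0 hK xI).
by rewrite (limcE hl).
Qed.

Lemma bounded_transfer q omega h K : 0 < q -> normc omega = 1 ->
    0 <= K -> bounded_by K h -> bounded_by (K * (2 * q)) (transfer q omega h).
Proof.
move=> q0 o1 K0 hK x xI; rewrite -[transfer _ _ _ _]subr0.
apply: cvgc_dist_normc_le (transfer_cvg q0 o1 K0 hK xI) _.
by apply: nearW => N; rewrite subr0; exact: bounded_transfer_part.
Qed.

Lemma transfer_tail q omega h K N x : 0 < q -> normc omega = 1 ->
    0 <= K -> bounded_by K h -> I x -> (0 < N)%N ->
  normc (transfer_part q omega N h x - transfer q omega h x) <= K * (q / N%:R).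
Proof.
move=> q0 o1 K0 hK xI N0; rewrite normcB.
apply: cvgc_dist_normc_le (transfer_cvg q0 o1 K0 hK xI) _.
exists N => // M /= NM; rewrite /transfer_part (big_cat_nat (n := N))//=.
rewrite addrAC subrr add0r; apply: le_trans (normc_sum _ _ _) _.
exact: transfer_terms_le.
Qed.

Lemma transfer_part_lin q omega N (a : R[i]) f g x :
  transfer_part q omega N (a *: f + g)%R x =
    a * transfer_part q omega N f x + transfer_part q omega N g x.
Proof.
rewrite /transfer_part mulr_sumr -big_split/=; apply: eq_bigr => k _.
rewrite /transfer_term; have e y : ext0 (a *: f + g)%R y = a * ext0 f y + ext0 g y.
  rewrite /ext0; case: ifP => _ //.
  by rewrite mulr0 addr0.
by rewrite e; ring.
Qed.

(** The sum defining the operator is only known to converge everywhere on bounded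
    functions; on integrable functions additivity could fail at some points. *)
Lemma transfer_lin q omega (a : R[i]) f g K x : 0 < q -> normc omega = 1 ->
    0 <= K -> bounded_by K f -> bounded_by K g -> I x ->
  transfer q omega (a *: f + g)%R x = a * transfer q omega f x + transfer q omega g x.
Proof.
move=> q0 o1 K0 fK gK xI; rewrite transferE; apply: limcE => e e0.
have c0 : 0 < normc a + 1 by rewrite ltr_wpDl ?normc_ge0.
have d0 : 0 < e / (normc a + 1) by rewrite divr_gt0.
apply: filterS2 (transfer_cvg q0 o1 K0 fK xI d0) (transfer_cvg q0 o1 K0 gK xI d0).
move=> N fN gN; rewrite transfer_part_lin opprD addrACA -mulrBr.
apply: le_lt_trans (le_normcD _ _) _; rewrite normcM.
rewrite -[ltRHS](divfK (lt0r_neq0 c0)) mulrDr mulr1 mulrC.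
by rewrite ler_ltD// ler_wpM2r ?normc_ge0// ltW.
Qed.

End TransferBounded.

(** * Variation through a dominating nondecreasing function *)

Section Domination.
Context {R : realType}.
Implicit Types (x y V B : R) (s : seq R) (f g h u : R -> R[i]) (phi Phi : R -> R).

Local Notation mu := (@lebesgue_measure R).
Local Notation I := (@unit_itv R).

Definition dominated g phi :=
  forall x y, I x -> I y -> x <= y -> normc (g y - g x) <= phi y - phi x.

Lemma variation_along_rcons g s x y :
  variation_along g (rcons (rcons s x) y) =
    variation_along g (rcons s x) + normc (g y - g x).
Proof.
rewrite /variation_along !size_rcons /= big_nat_recr//=; congr (_ + normc (_ - _)).
- apply: eq_big_nat => i /andP[_ ilt].
  by rewrite !(nth_rcons _ (rcons s x)) size_rcons !ltnS ilt (ltnW ilt).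
- by rewrite nth_rcons size_rcons ltnn eqxx.
- by rewrite nth_rcons size_rcons ltnSn nth_rcons ltnn eqxx.
Qed.

Lemma variation_along_cons g x y s :
  variation_along g [:: x, y & s] =
    normc (g y - g x) + variation_along g (y :: s).
Proof. by rewrite /variation_along /= big_nat_recl. Qed.

Lemma dominated_variation g Phi x s : dominated g Phi ->
    path <%R x s -> I x -> {in s, forall z, I z} ->
  variation_along g (x :: s) <= Phi (last x s) - Phi x.
Proof.
move=> gPhi; elim: s x => [|y s ih] x /=.
  by rewrite /variation_along big_geq// subrr.
move=> /andP[xy ys] xI sI; rewrite variation_along_cons.
have yI : I y by apply: sI; rewrite mem_head.
have := ih _ ys yI (fun z zs => sI z (mem_behead (s := y :: s) zs)).
by have := gPhi _ _ xI yI (ltW xy); lra.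
Qed.

(** The increments of Phi telescope along a list, leaving one difference of two
    values. *)
Lemma pointwise_var_dominated g Phi B : dominated g Phi -> 0 <= B ->
    (forall x y, I x -> I y -> Phi y - Phi x <= B) ->
  (pointwise_var g <= B%:E)%E.
Proof.
move=> gPhi B0 PB; apply: ge_ereal_sup => _ [[|x s] [xs sI] <-]; rewrite lee_fin.
  by rewrite /variation_along big_geq.
have xI : I x by apply: sI; rewrite mem_head.
have sI' : {in s, forall z, I z} by move=> z zs; apply: sI; rewrite inE zs orbT.
apply: le_trans (dominated_variation gPhi xs xI sI') _; apply: PB => //.
by have := mem_last x s; rewrite inE => /orP[/eqP ->|/sI'].
Qed.

Lemma pointwise_var_ge g V s : (pointwise_var g <= V%:E)%E ->
  sorted <%R s -> {in s, forall z, I z} -> variation_along g s <= V.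
Proof.
move=> gV ss sI; rewrite -lee_fin; apply: le_trans gV.
by apply: ereal_sup_ubound; exists s.
Qed.

(** The value at x is the supremum of the variations along lists that end at x;
    appending y to such a list gives the domination. *)
Lemma dominating_fun g V : (pointwise_var g <= V%:E)%E -> exists phi,
  [/\ {homo phi : x y / x <= y}, forall x, 0 <= phi x <= V & dominated g phi].
Proof.
move=> gV.
have V0 : 0 <= V by rewrite -lee_fin; exact: le_trans (pointwise_var_ge0 g) gV.
pose A x := [set variation_along g (rcons s x) | s in
   [set s | sorted <%R (rcons s x) /\ {in rcons s x, forall z, I z}]].
have AV x : ubound (A x) V.
  by move=> _ [s [ss sI] <-]; exact: pointwise_var_ge gV ss sI.
have A0 x : I x -> A x 0.
  move=> xI; exists [::] => /=; last by rewrite /variation_along big_geq.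
  by split => // z; rewrite inE => /eqP ->.
have supA x : I x -> has_sup (A x).
  by move=> xI; split; [exists 0; exact: A0|exists V; exact: AV].
(* The constants outside (0, 1) make phi monotone on the whole line. *)
pose phi x := if x <= 0 then 0 else if x < 1 then sup (A x) else V.
have phiI x : I x -> phi x = sup (A x).
  by move=> /unit_itvP/andP[x0 x1]; rewrite /phi leNgt x0 x1.
have phi0 x : 0 <= phi x <= V.
  rewrite /phi; case: (leP x 0) => x0; first by rewrite lexx.
  case: (ltP x 1) => x1; last by rewrite lexx andbT.
  have xI : I x by apply/unit_itvP; rewrite x0.
  apply/andP; split; first by apply: ub_le_sup (A0 _ xI); exists V; exact: AV.
  by apply: ge_sup; [exists 0; exact: A0|exact: AV].
have dom : dominated g phi.
  move=> x y xI yI; rewrite le_eqVlt => /predU1P[->|xy].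
    by rewrite !subrr normc0.
  rewrite lerBrDr -lerBrDl (phiI x xI); apply: ge_sup; first by exists 0; exact: A0.
  move=> _ [s [ss sI] <-]; rewrite lerBrDl (phiI y yI) addrC.
  apply: ub_le_sup; first by exists V; exact: AV.
  exists (rcons s x); last by rewrite variation_along_rcons.
  split; last by move=> z; rewrite mem_rcons inE => /orP[/eqP ->|/sI].
  by case: s ss {sI} => [|t s] /=; rewrite ?andbT ?rcons_path// => ->; rewrite last_rcons.
exists phi; split => // x y xy.
have [x0|x0] := leP x 0.
  by have -> : phi x = 0; [rewrite /phi x0|have /andP[] := phi0 y].
have [y1|y1] := leP 1 y.
  have -> : phi y = V; last by have /andP[] := phi0 x.
  by rewrite /phi leNgt (lt_le_trans ltr01 y1)/= ltNge y1.
have xI : I x by apply/unit_itvP; rewrite x0 (le_lt_trans xy).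
have yI : I y by apply/unit_itvP; rewrite y1 (lt_le_trans x0).
by rewrite -subr_ge0; apply: le_trans (dom _ _ xI yI xy); exact: normc_ge0.
Qed.

(** Lebesgue measure does the bookkeeping: the images by phi of disjoint intervals
    span disjoint intervals of [0, V]. *)
Lemma sum_disjoint_increments (T : choiceType) (r : seq T) (c d : T -> R) phi V :
    uniq r -> {homo phi : x y / x <= y} -> (forall x, 0 <= phi x <= V) ->
    (forall i, i \in r -> c i <= d i) ->
    (forall i j, i \in r -> j \in r -> i != j -> d i <= c j \/ d j <= c i) ->
  \sum_(i <- r) (phi (d i) - phi (c i)) <= V.
Proof.
move=> ur phim phi0 cd dis.
pose J i : set R := `]phi (c i), phi (d i)[%classic.
have mJ i : measurable (J i) by exact: measurable_itv.
have tJ : trivIset [set` r] J.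
  apply/trivIsetP => i j /= ir jr ij; apply/seteqP; split => // y [].
  rewrite /J /= !in_itv/= => /andP[y1 y2] /andP[y3 y4].
  have [h|h] := dis _ _ ir jr ij.
    by have := lt_trans y3 y2; rewrite ltNge phim.
  by have := lt_trans y1 y4; rewrite ltNge phim.
have V0 : 0 <= V by have /andP[a b] := phi0 0; exact: le_trans b.
have JE i : i \in r -> (\int[mu]_(x in J i) (cst 1%E) x = (phi (d i) - phi (c i))%:E)%E.
  move=> ir; rewrite integral_cst; last exact: mJ.
  rewrite mul1e /J /= lebesgue_measure_itv/= lte_fin.
  case: ltP => [//|h]; suff -> : phi (d i) = phi (c i) by rewrite subrr.
  by apply/eqP; rewrite eq_le h phim// cd.
rewrite -lee_fin -sumEFin big_seq.
under eq_bigr do rewrite -JE//.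
rewrite -big_seq -(@ge0_integral_bigsetU _ _ _ mu _ J (cst 1%E) r mJ ur tJ)//=.
apply: (@le_trans _ _ (\int[mu]_(x in `[0%R, V]) 1)%E).
  apply: ge0_subset_integral => //; first by apply: bigsetU_measurable => i _; exact: mJ.
  rewrite -bigcup_seq => y [i /= ir]; rewrite /J /= !in_itv/= => /andP[y1 y2].
  have /andP[a _] := phi0 (c i); have /andP[_ b] := phi0 (d i).
  by rewrite (ltW (le_lt_trans a y1)) (ltW (lt_le_trans y2 b)).
rewrite integral_cst//= mul1e lebesgue_measure_itv/= lte_fin.
by case: ifP => // _; rewrite sube0.
Qed.

Lemma sum_disjoint_integrals (T : choiceType) (r : seq T) (c d : T -> R) u :
    uniq r -> inL1 u ->
    (forall i, i \in r -> 0 <= c i /\ d i <= 1) ->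
    (forall i j, i \in r -> j \in r -> i != j -> d i <= c j \/ d j <= c i) ->
  (\sum_(i <- r) \int[mu]_(x in `]c i, d i[) (normc (u x))%:E <= norm1 u)%E.
Proof.
move=> ur uL cd dis; have [mr mi _] := uL.
pose J i : set R := `]c i, d i[%classic.
have mJ i : measurable (J i) by exact: measurable_itv.
have tJ : trivIset [set` r] J.
  apply/trivIsetP => i j /= ir jr ij; apply/seteqP; split => // y [].
  rewrite /J /= !in_itv/= => /andP[y1 y2] /andP[y3 y4].
  have [h|h] := dis _ _ ir jr ij.
    by have := lt_trans y3 y2; rewrite ltNge h.
  by have := lt_trans y1 y4; rewrite ltNge h.
have JI : \big[setU/set0]_(i <- r) J i `<=` I.
  rewrite -bigcup_seq => y [i /= /cd[c0 d1]]; rewrite /J /= !in_itv/= => /andP[y1 y2].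
  by apply/unit_itvP; rewrite (le_lt_trans c0 y1) (lt_le_trans y2 d1).
have mu_ := measurable_normc mr mi.
have mU : measurable (\big[setU/set0]_(i <- r) J i) by apply: bigsetU_measurable => i _; exact: mJ.
rewrite -(@ge0_integral_bigsetU _ _ _ mu _ J (fun x => (normc (u x))%:E) r mJ ur tJ)//=.
- apply: ge0_subset_integral => //.
  + exact: measurable_unit_itv.
  + exact/measurable_EFinP.
  + by move=> x _; rewrite lee_fin normc_ge0.
- apply/measurable_EFinP; apply: measurable_funS mu_ => //; exact: measurable_unit_itv.
- by move=> x _; rewrite lee_fin normc_ge0.
Qed.

(** Integrating the hypothesis over (c, d) turns a bound by one value of g into a
    bound by the average of u. *)
Lemma integral_lower_bound u g (c d X Y k : R) : inL1 u -> ae_eq mu I u g ->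
    0 <= c -> c < d -> d <= 1 -> 0 <= k ->
    (forall y, c < y < d -> X <= Y + k * normc (g y)) ->
  (((X - Y) * (d - c))%:E <= k%:E * \int[mu]_(x in `]c, d[) (normc (u x))%:E)%E.
Proof.
move=> uL ug c0 cd d1 k0 XY; have [mr mi _] := uL.
have JI : (`]c, d[%classic : set R) `<=` I.
  move=> y; rewrite /= !in_itv/= => /andP[y1 y2].
  by apply/unit_itvP; rewrite (le_lt_trans c0 y1) (lt_le_trans y2 d1).
have mI := @measurable_unit_itv R.
have mJ : measurable_fun `]c, d[ (fun x => (normc (u x))%:E).
  by apply/measurable_EFinP; apply: measurable_funS (measurable_normc mr mi).
(* The comparison of integrals needs a nonnegative constant. *)
have [XY0|XY0] := leP (X - Y) 0.
  apply: (@le_trans _ _ 0%E).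
    by rewrite lee_fin mulr_le0_ge0// subr_ge0 ltW.
  by apply: mule_ge0; rewrite ?lee_fin//; apply: integral_ge0 => x _; rewrite lee_fin normc_ge0.
rewrite -ge0_integralZl_EFin//; last by move=> x _; rewrite lee_fin normc_ge0.
rewrite (_ : ((X - Y) * (d - c))%:E = (\int[mu]_(x in `]c, d[) (cst (X - Y)%:E) x)%E); last first.
  by rewrite integral_cst//= lebesgue_measure_itv/= lte_fin cd -EFinB EFinM.
apply: ae_ge0_le_integral => //.
- by move=> x _; rewrite lee_fin ltW.
- by move=> x _; rewrite mule_ge0// lee_fin// normc_ge0.
- exact: measurable_funeM.
- apply: filterS ug => x ugx xJ; rewrite ugx; last exact: JI.
  rewrite -EFinM lee_fin lerBlDl; apply: XY.
  by move: xJ; rewrite /= in_itv.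
Qed.

End Domination.

(** * Cylinders and their inverse branches *)

Section Words.
Context {R : realType}.
Implicit Types (q x y : R) (n : nat) (v : seq nat).

Local Notation mu := (@lebesgue_measure R).
Local Notation I := (@unit_itv R).

(** Words are read backwards: the head of v is the digit of the branch applied
    first, which is the last digit of the cylinder. *)
Fixpoint wbranch q v x : R :=
  if v is n :: v' then wbranch q v' (branch q n x) else x.

(** Every intermediate value of the composed branch lies in (0, 1), which means
    that x is in the image of the corresponding cylinder. *)
Fixpoint wdom q v x : bool :=
  if v is n :: v' then (0 < x < 1) && wdom q v' (branch q n x) else 0 < x < 1.

(** The modulus of the derivative of wbranch q v. *)
Fixpoint wder q v x : R :=
  if v is n :: v' then branch_wt q n x * wder q v' (branch q n x) else 1.

(** The bottom row (c, d) of the matrix of the Moebius map wbranch q v. *)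
Fixpoint wden q v : R * R :=
  if v is n :: v' then ((wden q v').2, (wden q v').1 * q + (wden q v').2 * n%:R)
  else (0, 1).

Definition wdenom q v x : R := (wden q v).1 * x + (wden q v).2.

Lemma wdom_unit q v x : wdom q v x -> 0 < x < 1.
Proof. by case: v => [|n v] //= /andP[]. Qed.

Section Moebius.
Variable q : R.
Hypothesis q1 : 1 < q.

Let q0 : 0 < q. Proof. exact: lt_trans ltr01 q1. Qed.

Lemma wden_bounds v : all (leq 1) v ->
  0 <= (wden q v).1 <= (wden q v).2 /\ 0 < (wden q v).2.
Proof.
elim: v => [|n v ih] /=; first by rewrite lexx ler01 ltr01.
move=> /andP[n0 /ih[/andP[c0 cd] d0]].
have n1 : 1 <= n%:R :> R by rewrite ler1n.
have cq : 0 <= (wden q v).1 * q by rewrite mulr_ge0// ltW.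
have dn : (wden q v).2 <= (wden q v).2 * n%:R by rewrite ler_peMr// ltW.
by split; [rewrite (ltW d0)/=|]; lra.
Qed.

Lemma wdenom_gt0 v x : all (leq 1) v -> 0 <= x -> 0 < wdenom q v x.
Proof.
move=> /wden_bounds[/andP[c0 cd] d0] x0.
by rewrite /wdenom ltr_wpDl// mulr_ge0.
Qed.

Lemma wdenom_cons n v x : (0 < n)%N -> 0 <= x ->
  wdenom q v (branch q n x) = wdenom q (n :: v) x / (n%:R + x).
Proof.
move=> n0 x0; have d0 := branch_den_gt0 n0 x0.
by rewrite /wdenom /branch /=; field; rewrite gt_eqF.
Qed.

Lemma wderE v x : all (leq 1) v -> 0 <= x ->
  wder q v x = q ^+ size v / wdenom q v x ^+ 2.
Proof.
elim: v x => [|n v ih] x /=.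
  by move=> _ _; rewrite /wdenom/= mul0r add0r expr1n divr1.
move=> /andP[n0 va] x0; have b0 := ltW (branch_gt0 q0 n0 x0).
have d0 := branch_den_gt0 n0 x0.
have nva : all (leq 1) (n :: v) by rewrite /= n0.
have D0 := wdenom_gt0 nva x0.
rewrite ih// wdenom_cons// /branch_wt (exprS q (size v)); field.
by rewrite !gt_eqF.
Qed.

(** A Moebius map of determinant +-q^r satisfies this identity; it gives the
    monotonicity of the branch and the exact length of the image of an interval. *)
Lemma wbranch_sub v x y : all (leq 1) v -> 0 <= x -> 0 <= y ->
  wbranch q v y - wbranch q v x =
    (-1) ^+ size v * (q ^+ size v * (y - x) / (wdenom q v x * wdenom q v y)).
Proof.
elim: v x y => [|n v ih] x y /=.
  by move=> _ _ _; rewrite /wdenom/= !mul0r !add0r !mul1r divr1.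
move=> /andP[n0 va] x0 y0.
have nva : all (leq 1) (n :: v) by rewrite /= n0.
rewrite ih//; try exact/ltW/(branch_gt0 q0 n0).
have dx0 := branch_den_gt0 n0 x0; have dy0 := branch_den_gt0 n0 y0.
have Dx0 := wdenom_gt0 nva x0; have Dy0 := wdenom_gt0 nva y0.
rewrite !wdenom_cons// !exprS /branch; field.
by rewrite !gt_eqF.
Qed.

Lemma wder_ge0 v x : 0 <= wder q v x.
Proof.
by elim: v x => [|n v ih] x /=; rewrite ?ler01// mulr_ge0// branch_wt_ge0.
Qed.

(** Each branch q / (n + x) has derivative of modulus (q / (n + x))^2 / q, so it
    contracts by 1 / q wherever its value stays below 1. *)
Lemma wder_le v x : all (leq 1) v -> wdom q v x -> wder q v x <= q ^- size v.
Proof.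
elim: v x => [|n v ih] x /=; first by rewrite expr0 invr1.
move=> /andP[n0 va] /andP[/andP[/ltW x0 _] vx].
rewrite exprS invfM ler_pM ?branch_wt_ge0 ?wder_ge0//; last exact: ih.
have /andP[/ltW b0 /ltW b1] := wdom_unit vx.
have d0 := branch_den_gt0 n0 x0.
have -> : branch_wt q n x = branch q n x ^+ 2 / q.
  by rewrite /branch_wt /branch; field; rewrite !gt_eqF.
by rewrite ler_piMl ?invr_ge0 ?(ltW q0)// exprn_ile1.
Qed.

Lemma wder_antitone v x y : all (leq 1) v -> 0 <= x -> x <= y ->
  wder q v y <= wder q v x.
Proof.
move=> va x0 xy; have y0 := le_trans x0 xy.
have Dx0 := wdenom_gt0 va x0; have Dy0 := wdenom_gt0 va y0.
rewrite !wderE// ler_pM2l ?exprn_gt0// lef_pV2 ?posrE ?exprn_gt0//.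
rewrite ler_pXn2r ?nnegrE ?(ltW Dx0) ?(ltW Dy0)// /wdenom lerD2r.
by have [/andP[c0 _] _] := wden_bounds va; rewrite ler_wpM2l.
Qed.

(** Bounded distortion: the denominator c x + d with 0 <= c <= d varies by a
    factor of at most 2 over [0, 1], so the derivative varies by at most 4 and
    the length of an image is at least a quarter of what the largest derivative
    predicts. *)
Lemma wbranch_length v x y z : all (leq 1) v -> 0 <= x <= 1 -> 0 <= y <= 1 ->
    0 <= z <= 1 -> x <= y ->
  wder q v z * (y - x) <= 4 * `|wbranch q v y - wbranch q v x|.
Proof.
move=> va /andP[x0 x1] /andP[y0 y1] /andP[z0 z1] xy.
have Dx0 := wdenom_gt0 va x0; have Dy0 := wdenom_gt0 va y0.
have Dz0 := wdenom_gt0 va z0.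
rewrite wbranch_sub// normrM normrX normrN1 expr1n mul1r ger0_norm; last first.
  apply: divr_ge0; last by rewrite mulr_ge0// ltW.
  by rewrite mulr_ge0 ?exprn_ge0 ?subr_ge0// ltW.
have [/andP[c0 cd] d0] := wden_bounds va.
have bd t : 0 <= t -> t <= 1 -> wdenom q v t <= 2 * wdenom q v z.
  move=> t0 t1; rewrite /wdenom.
  have : (wden q v).1 * t <= (wden q v).1 by rewrite ler_piMr.
  have : 0 <= (wden q v).1 * z by rewrite mulr_ge0.
  by lra.
have key : (wdenom q v z ^+ 2)^-1 <= 4 / (wdenom q v x * wdenom q v y).
  rewrite ler_pdivlMr ?mulr_gt0// ler_pdivrMl ?exprn_gt0//.
  rewrite (_ : _ * 4 = (2 * wdenom q v z) * (2 * wdenom q v z)); last by ring.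
  by rewrite ler_pM// ?bd// ltW.
rewrite wderE//.
rewrite [leLHS](_ : _ = (q ^+ size v * (y - x)) * (wdenom q v z ^+ 2)^-1); last by ring.
rewrite [leRHS](_ : _ = (q ^+ size v * (y - x)) * (4 / (wdenom q v x * wdenom q v y))); last by ring.
by rewrite ler_wpM2l// mulr_ge0 ?exprn_ge0 ?subr_ge0// ltW.
Qed.

End Moebius.

Section Itineraries.
Variable q : R.
Hypothesis q1 : 1 < q.

Let q0 : 0 < q. Proof. exact: lt_trans ltr01 q1. Qed.

Lemma Tq_unique y n t : q / y = n%:R + t -> 0 <= t -> t < 1 -> Tq q y = t.
Proof.
move=> e t0 t1; rewrite /Tq e; have -> : Num.floor (n%:R + t) = n%:Z.
  apply: floor_def; rewrite intrD /= -!pmulrn lerDl t0/=.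
  by rewrite ltrD2l.
by rewrite -pmulrn addrAC subrr add0r.
Qed.

Lemma inv_branch n x : (0 < n)%N -> 0 <= x -> q / branch q n x = n%:R + x.
Proof.
move=> n0 x0; have d0 := branch_den_gt0 n0 x0.
by rewrite /branch; field; rewrite !gt_eqF.
Qed.

Lemma Tq_branch n x : (0 < n)%N -> 0 < x < 1 -> Tq q (branch q n x) = x.
Proof.
move=> n0 /andP[/ltW x0 x1].
by apply: (Tq_unique (n := n)) => //; rewrite inv_branch.
Qed.

(** The intervals of monotonicity are described uniformly in the digit, including
    the incomplete first one. *)
Lemma digit_itvP n y : digit_itv q n y <->
  [/\ (0 < n)%N, 0 < y < 1 & 0 < q / y - n%:R < 1].
Proof.
have /andP[mq qm] := truncn_itv (ltW q0); set m := Num.truncn q in mq qm *.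
have m0 : (0 < m)%N by rewrite /m truncn_gt0 ltW.
have S k : k.+1%:R = k%:R + 1 :> R by rewrite -addn1 natrD.
have k0 k : 0 < k.+1%:R :> R by rewrite ltr0n.
have E y' k : 0 < y' -> (0 < q / y' - k.+1%:R) = (y' < q / k.+1%:R).
  by move=> y0; rewrite subr_gt0 ltr_pdivlMr// ltr_pdivlMr// mulrC.
have F y' k : 0 < y' -> (q / y' - k%:R < 1) = (q / k.+1%:R < y').
  by move=> y0; rewrite ltrBlDl -S ltr_pdivrMr// ltr_pdivrMr// mulrC.
have qy y' : 0 < y' -> y' < 1 -> q < q / y'.
  by move=> y0 y1; rewrite ltr_pdivlMr// gtr_pMr.
rewrite /digit_itv -/m; split.
  case: eqP => [->|_].
    rewrite /= in_itv/= => /andP[y1 y2].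
    have y0 : 0 < y by apply: le_lt_trans y1; rewrite divr_ge0// ltW.
    split; rewrite ?y0//= F// y1 andbT subr_gt0.
    exact: le_lt_trans mq (qy _ y0 y2).
  case: ifP => // mn; rewrite /= in_itv/= => /andP[y1 y2].
  have n0 : (0 < n)%N := leq_trans m0 (ltnW mn).
  have y0 : 0 < y by apply: le_lt_trans y1; rewrite divr_ge0// ltW.
  split; rewrite ?y0//=.
    apply: lt_le_trans y2 _; rewrite ler_pdivrMr ?ltr0n// mul1r.
    by apply: (ltW (lt_le_trans qm _)); rewrite ler_nat.
  by rewrite F// y1 andbT -(prednK n0) E// prednK.
case=> n0 /andP[y0 y1]; rewrite F// -(prednK n0) E// prednK// => /andP[y2 y3].
case: eqP => [nm|nm]; first by rewrite /= in_itv/= -nm y3.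
case: ifPn => [mn|]; first by rewrite /= in_itv/= y3.
rewrite -leqNgt leq_eqVlt => /predU1P[//|{}nm].
have : 1 <= q / n.+1%:R.
  by rewrite ler_pdivlMr// mul1r; apply: le_trans mq; rewrite ler_nat.
by rewrite leNgt (lt_trans y3 y1).
Qed.

(** The cylinder of the word rev v, in the recursive form adapted to reversed
    words. *)
Fixpoint rcyl v y : Prop :=
  if v is n :: v' then rcyl v' y /\ digit_itv q n (iter (size v') (Tq q) y)
  else 0 < y < 1.

Lemma rcyl_iter v y : rcyl v y ->
  [/\ all (leq 1) v, wdom q v (iter (size v) (Tq q) y) &
      wbranch q v (iter (size v) (Tq q) y) = y].
Proof.
elim: v y => [|n v ih] y /=; first by move=> ->.
move=> [/ih[va vd vb] /digit_itvP[n0 d01 t01]].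
set z := iter (size v) (Tq q) y in vd vb d01 t01 *.
have zt : Tq q z = q / z - n%:R.
  have /andP[t0 t1] := t01.
  by apply: (Tq_unique (n := n)) => //; [rewrite addrCA subrr addr0|exact: ltW].
have bz : branch q n (Tq q z) = z.
  by rewrite zt branchK//; have /andP[] := d01.
have t01' : 0 < Tq q z < 1 by rewrite zt.
by rewrite n0 va bz t01'.
Qed.

Lemma rcyl_wbranch v x : all (leq 1) v -> wdom q v x ->
  rcyl v (wbranch q v x) /\ iter (size v) (Tq q) (wbranch q v x) = x.
Proof.
elim: v x => [|n v ih] x //= /andP[n0 va] /andP[x01 vx].
have [rc it] := ih _ va vx; rewrite it Tq_branch//; split => //; split => //.
apply/digit_itvP; split => //; first exact: wdom_unit vx.
have /andP[/ltW x0 _] := x01.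
by rewrite inv_branch// addrAC subrr add0r.
Qed.

Lemma wbranch_inj v1 v2 x1 x2 : all (leq 1) v1 -> all (leq 1) v2 ->
    size v1 = size v2 -> wdom q v1 x1 -> wdom q v2 x2 ->
  wbranch q v1 x1 = wbranch q v2 x2 -> v1 = v2.
Proof.
elim: v1 v2 x1 x2 => [|n1 v1 ih] [|n2 v2] x1 x2 //= /andP[n10 a1] /andP[n20 a2].
move=> [sz] /andP[x101 d1] /andP[x201 d2] e.
have vE := ih _ _ _ a1 a2 sz d1 d2 e.
have bE : branch q n1 x1 = branch q n2 x2.
  have [_ it1] := rcyl_wbranch a1 d1; have [_ it2] := rcyl_wbranch a2 d2.
  by rewrite -it1 -it2 e sz.
have xE : x1 = x2 by rewrite -(Tq_branch n10 x101) bE Tq_branch.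
have /andP[/ltW x20 _] := x201.
move: bE => /(congr1 (fun y => q / y)); rewrite xE !inv_branch//.
by move=> /addIr /eqP; rewrite eqr_nat => /eqP ->; rewrite vE.
Qed.

Lemma cylinderE r (w : r.-tuple nat) : (0 < r)%N -> cylinder q w = rcyl (rev w).
Proof.
move=> r0.
have gen (v : seq nat) y : (forall k, (k < size v)%N ->
    digit_itv q (nth 0 (rev v) k) (iter k (Tq q) y)) /\ (0 < y < 1) <-> rcyl v y.
  elim: v => [|n v ih] /=; first by split=> [[]//|->].
  split=> [[h y01]|[/ih[h y01] hn]].
    split; last first.
      by have := h (size v) (ltnSn _); rewrite rev_cons nth_rcons size_rev ltnn eqxx.
    apply/ih; split=> // k kv; have := h k (ltnW kv).
    by rewrite rev_cons nth_rcons size_rev kv.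
  split=> // k; rewrite ltnS leq_eqVlt rev_cons nth_rcons size_rev.
  by case: eqP => [->|_ /= kv]; rewrite ?ltnn ?kv//; exact: h.
apply/seteqP; split => y /=.
  move=> wy; apply/gen; split.
    move=> k; rewrite size_rev size_tuple revK => kr.
    by have := wy (Ordinal kr); rewrite (tnth_nth 0%N).
  by have /digit_itvP[] := wy (Ordinal r0).
move=> /gen[h _] k; rewrite (tnth_nth 0%N).
by have := h k; rewrite size_rev size_tuple revK; apply.
Qed.

(** The endpoints of the images of cylinders lie on the orbit of 1 completed by 0
    and 1, which is why these images form a finite family. *)
Fixpoint endpoints r : seq R :=
  if r is r'.+1 then [:: 0, 1 & map (Tq q) (endpoints r')] else [:: 0; 1].

Definition wdom_endpoints v (a b : R) :=
  [/\ 0 <= a, a < b, b <= 1,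
     (a \in endpoints (size v)) && (b \in endpoints (size v)) &
     forall x, wdom q v x = (a < x < b)].

Lemma wdom_itv v : all (leq 1) v ->
  (forall x, ~~ wdom q v x) \/ exists a b, wdom_endpoints v a b.
Proof.
elim: v => [|n v ih] /=.
  by move=> _; right; exists 0, 1; split; rewrite ?lexx ?ltr01//= !inE !eqxx ?orbT.
move=> /andP[n0 /ih[h|[a [b [a0 ab b1 /andP[aE bE] h]]]]].
  by left => x; rewrite negb_and h orbT.
have b0 : 0 < b := le_lt_trans a0 ab.
pose a' := Num.max 0 (q / b - n%:R).
(* For a = 0 the quotient q / a should be infinite, whereas division by zero
   would return 0. *)
pose b' := if a == 0 then 1 else Num.min 1 (q / a - n%:R).
have dE x : (0 < x < 1) && wdom q v (branch q n x) = (a' < x < b').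
  rewrite h; have [x0|x0] := ltP 0 x; last first.
    by rewrite /a' gt_max ltNge x0.
  have aE' : (a < branch q n x) && (x < 1) = (x < b').
    rewrite /b'; have [->|an0] := eqVneq a 0; first by rewrite branch_gt0// ltW.
    have a00 : 0 < a by rewrite lt_neqAle eq_sym an0.
    by rewrite lt_min andbC (ltNge a) branch_le ?(ltW x0)// -ltNge.
  have bE' : (branch q n x < b) = (a' < x).
    by rewrite /a' gt_max x0/= (ltNge (branch _ _ _)) branch_ge ?(ltW x0)// -ltNge.
  by rewrite -bE' -aE' /=; case: (a < _); case: (x < 1); case: (_ < b).
have [ab'|ba] := ltP a' b'; last first.
  by left => x; rewrite dE; apply/negP => /andP[/lt_trans/[apply]]; rewrite ltNge ba.
right; exists a', b'; split => //.
- by rewrite /a' le_max lexx.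
- by rewrite /b'; case: ifP => _ //; rewrite ge_min lexx.
have b'1 : b' <= 1 by rewrite /b'; case: ifP => _ //; rewrite ge_min lexx.
have a'0 : 0 <= a' by rewrite /a' le_max lexx.
have TqE y t : y \in endpoints (size v) -> t = q / y - n%:R -> 0 <= t -> t < 1 ->
    t \in endpoints (size (n :: v)).
  move=> yE tE t0 t1; rewrite /= !inE -(Tq_unique (y := y) (n := n) _ t0 t1).
    by rewrite map_f// !orbT.
  by rewrite tE addrCA subrr addr0.
apply/andP; split.
  have [h0|h0] := leP (q / b - n%:R) 0.
    by rewrite /a' max_l//= inE eqxx.
  have a'E : a' = q / b - n%:R by rewrite /a' max_r// ltW.
  by apply: (TqE b) => //; exact: lt_le_trans ab' b'1.
have [an0|an0] := eqVneq a 0; first by rewrite /b' an0 eqxx /= !inE eqxx orbT.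
have [h1|h1] := leP 1 (q / a - n%:R).
  by rewrite /b' (negbTE an0) min_l//= !inE eqxx orbT.
have b'E : b' = q / a - n%:R by rewrite /b' (negbTE an0) min_r// ltW.
apply: (TqE a) => //; first exact/ltW/(le_lt_trans a'0 ab').
by rewrite b'E.
Qed.

Lemma cylinder_image r (w : r.-tuple nat) : (0 < r)%N ->
    cylinder q w !=set0 -> exists a b, wdom_endpoints (rev w) a b /\
      iter r (Tq q) @` cylinder q w = `]a, b[%classic.
Proof.
move=> r0 [y0]; rewrite cylinderE// => y0w.
have srw : size (rev w) = r by rewrite size_rev size_tuple.
have [va vd0 _] := rcyl_iter y0w.
case: (wdom_itv va) => [/(_ (iter (size (rev w)) (Tq q) y0))/negP//|].
move=> [a' [b' e]]; exists a', b'; split => //; have [_ _ _ _ h] := e.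
apply/seteqP; split => [_ [y yw <-]|x]; rewrite /= in_itv/= -h.
  by have [_ + _] := rcyl_iter yw; rewrite srw.
move=> vx; have [rc it] := rcyl_wbranch va vx.
by exists (wbranch q (rev w) x) => //; rewrite -[RHS]it srw.
Qed.

Lemma min_positive (s : seq R) : exists2 e, 0 < e & {in s, forall x, 0 < x -> e <= x}.
Proof.
elim: s => [|x s [e e0 h]]; first by exists 1.
have [x0|x0] := ltP 0 x; last first.
  exists e => // y; rewrite inE => /orP[/eqP -> y0|/h//].
  by have := lt_le_trans y0 x0; rewrite ltxx.
exists (Num.min e x); first by rewrite lt_min e0.
move=> y; rewrite inE => /orP[/eqP -> _|/h hy /hy ey].
  by rewrite ge_min lexx orbT.
by rewrite ge_min ey.
Qed.

Definition image_lengths r : set R :=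
  [set fine (mu (iter r (Tq q) @` C)) | C in cylinders q r].

Lemma image_lengths_wdom r t : (0 < r)%N -> image_lengths r t ->
  exists v a b, [/\ size v = r, wdom_endpoints v a b & t = b - a].
Proof.
move=> r0 [C [C0 [w CE]] <-]; rewrite CE in C0 *.
have [a [b [e ->]]] := cylinder_image r0 C0.
exists (rev w), a, b; split => //; first by rewrite size_rev size_tuple.
have [_ ab _ _ _] := e.
by rewrite lebesgue_measure_itv/= lte_fin ab.
Qed.

Lemma delta_le v a b : (0 < size v)%N -> all (leq 1) v -> wdom_endpoints v a b ->
  delta q (size v) <= b - a.
Proof.
move=> r0 va e; have [a0 ab b1 _ h] := e.
apply: ge_inf.
  by exists 0 => t /(image_lengths_wdom r0)[v' [a' [b' [_ [_ /ltW ab' _ _ _] ->]]]]; rewrite subr_ge0.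
have sv : size (rev v) == size v by rewrite size_rev.
pose w : (size v).-tuple nat := Tuple sv.
have wv : rev w = v by rewrite /= revK.
have mid : wdom q v ((a + b) / 2) by rewrite h !midf_lt.
have wn0 : cylinder q w !=set0.
  exists (wbranch q v ((a + b) / 2)); rewrite cylinderE// wv.
  by have [] := rcyl_wbranch va mid.
exists (cylinder q w); first by split => //; exists w.
have [a' [b' [e' ->]]] := cylinder_image r0 wn0.
rewrite wv in e'; have [_ ab' _ _ h'] := e'.
have hh x : (a < x < b) = (a' < x < b') by rewrite -h h'.
have -> : (`]a', b'[%classic : set R) = `]a, b[%classic.
  by apply/seteqP; split => x /=; rewrite !in_itv/= hh.
by rewrite lebesgue_measure_itv/= lte_fin ab.
Qed.

(** The lengths are positive differences of points of a finite set. *)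
Lemma delta_gt0 r : (0 < r)%N -> 0 < delta q r.
Proof.
move=> r0.
have [e e0 he] := min_positive [seq y - x | x <- endpoints r, y <- endpoints r].
(* A digit greater than q gives a branch from (0, 1) into itself, so its powers
   are admissible words and the infimum is over a nonempty set. *)
have tr1 : q < (Num.truncn q).+1%:R by exact: truncnS_gt.
pose n := (Num.truncn q).+1; pose v := nseq r n.
have va : all (leq 1) v by rewrite all_nseq orbT.
have full k x : 0 < x < 1 -> wdom q (nseq k n) x.
  elim: k x => [//|k ih] x x01 /=; rewrite x01 ih//.
  have /andP[x0 x1] := x01; have d0 : 0 < n%:R + x by rewrite branch_den_gt0// ltW.
  rewrite branch_gt0 ?(ltW x0)//= /branch ltr_pdivrMr// mul1r.
  by apply: lt_trans tr1 _; rewrite ltrDl.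
have half : 0 < (2^-1 : R) < 1 by rewrite invr_gt0 ltr0n invf_lt1// ltr1n.
have sv : size v == r by rewrite size_nseq.
have srv : size (rev v) == r by rewrite size_rev.
pose w : r.-tuple nat := Tuple srv.
have wn0 : cylinder q w !=set0.
  exists (wbranch q v 2^-1); rewrite cylinderE//= revK.
  by have [] := rcyl_wbranch va (full r _ half).
apply: (lt_le_trans e0); apply: lb_le_inf.
  by exists (fine (mu (iter r (Tq q) @` cylinder q w))); exists (cylinder q w) => //; split=> //; exists w.
move=> t /(image_lengths_wdom r0)[v' [a [b [sv' [_ ab _ /andP[aE bE] _] ->]]]].
apply: he; last by rewrite subr_gt0.
by apply/allpairsP; exists (a, b); rewrite -sv'.
Qed.

End Itineraries.
End Words.

(** * The Lasota-Yorke inequality *)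

Local Arguments normc : simpl never.

Section CutProduct.
Context {R : realType}.
Implicit Types (x y a b W K D : R).

Definition cut_product a b (w : R -> R) (f : R -> R[i]) x : R[i] :=
  if a < x < b then (w x)%:C * f x else 0.

(** Cutting a product off outside an interval adds the two boundary values, which
    are controlled by the weight; the nonincreasing weight itself has variation at
    most W inside the interval. *)
Lemma cut_product_variation a b W K D (w p : R -> R) (f : R -> R[i]) :
    0 <= W -> 0 <= K -> 0 <= D ->
    (forall x, a < x < b -> [/\ 0 <= w x <= W, normc (f x) <= K & 0 <= p x <= D]) ->
    (forall x y, a < x -> x <= y -> y < b ->
       w y <= w x /\ normc (f y - f x) <= p y - p x) ->
  (pointwise_var (cut_product a b w f) <= (W * (D + 2 * K))%:E)%E.
Proof.
move=> W0 K0 D0 bd mono.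
(* The jump of Phi at a and at b is at least K w, a bound of the boundary value of
   the product; inside, Phi grows by W times the variation of f plus K times the
   decrease of w. *)
pose Phi x := if x <= a then 0 else if x < b then
  K * W + W * p x + K * (W - w x) else 2 * (K * W) + W * D.
have Pb x : 0 <= Phi x <= W * (D + 2 * K).
  rewrite /Phi; have KW : 0 <= K * W by rewrite mulr_ge0.
  have WD : 0 <= W * D by rewrite mulr_ge0.
  case: (leP x a) => xa; first by rewrite lexx/=; lra.
  case: (ltP x b) => xb; last by lra.
  have [|/andP[w0 wW] _ /andP[p0 pD]] := bd x; first by rewrite xa.
  have : 0 <= W * p x by rewrite mulr_ge0.
  have : W * p x <= W * D by rewrite ler_wpM2l.
  have : 0 <= K * w x by rewrite mulr_ge0.
  have : K * w x <= K * W by rewrite ler_wpM2l.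
  by lra.
apply: (pointwise_var_dominated (Phi := Phi)).
- move=> x y _ _ xy; rewrite /cut_product /Phi.
  have [ya|ya] := leP y a.
    by have xa := le_trans xy ya; rewrite (ltNge a x) xa/= !subr0 normc0.
  have [xa|xa] := leP x a.
    rewrite /= !subr0; have [yb|yb] := ltP y b; last first.
      by rewrite normc0 addr_ge0 ?mulr_ge0.
    have [|/andP[w0 wW] fK /andP[p0 pD]] := bd y; first by rewrite ya.
    rewrite normcM normcR ger0_norm//.
    have : 0 <= W * p y by rewrite mulr_ge0.
    have : w y * normc (f y) <= W * K by rewrite ler_pM ?normc_ge0.
    have : 0 <= K * (W - w y) by rewrite mulr_ge0// subr_ge0.
    by lra.
  have [bx|xb] := leP b x.
    by rewrite (ltNge y b) (le_trans bx xy)/= subr0 normc0 subrr.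
  have [|/andP[w0 wW] fK /andP[p0 pD]] := bd x; first by rewrite xa.
  have [by'|yb] := leP b y => /=.
    rewrite sub0r normcN normcM normcR ger0_norm//.
    have : w x * normc (f x) <= w x * K by rewrite ler_wpM2l.
    have : 0 <= W * (D - p x) by rewrite mulr_ge0// subr_ge0.
    by lra.
  have [|/andP[wy0 wyW] fyK _] := bd y; first by rewrite ya.
  have [wyx fyx] := mono _ _ xa xy yb.
  have -> : (w y)%:C * f y - (w x)%:C * f x =
      (w x)%:C * (f y - f x) + - ((w x - w y)%:C * f y).
    by rewrite rmorphB /=; ring.
  apply: le_trans (le_normcD _ _) _; rewrite normcN !normcM !normcR.
  rewrite !ger0_norm ?subr_ge0//.
  have : w x * normc (f y - f x) <= W * (p y - p x) by rewrite ler_pM ?normc_ge0.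
  have : (w x - w y) * normc (f y) <= (w x - w y) * K by rewrite ler_wpM2l ?subr_ge0.
  by lra.
- by rewrite mulr_ge0// addr_ge0// mulr_ge0.
- by move=> x y _ _; have /andP[+ _] := Pb x; have /andP[_ +] := Pb y; lra.
Qed.

End CutProduct.

Section IteratedTransfer.
Context {R : realType}.
Implicit Types (q x y K V : R) (N : nat) (f g h u : R -> R[i]) (os : seq R[i]) (v : seq nat).

Local Notation mu := (@lebesgue_measure R).
Local Notation I := (@unit_itv R).

(** The operators are listed with the last one applied first, so that a word
    and its list of multipliers are processed in the same order. *)
Definition transfer_rev q os h := foldr (fun omega g => transfer q omega g) h os.

(** The analogue with digits at most N. *)
Definition part_rev q N os h := foldr (fun omega g => transfer_part q omega N g) h os.

Definition unimodular os := {in os, forall omega, normc omega = 1}.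

Lemma transfer_seqE q os h : transfer_seq q os h = transfer_rev q (rev os) h.
Proof. by rewrite /transfer_seq -{1}(revK os) foldl_rev. Qed.

Lemma transfer_rev_ae q os f g : 0 < q -> ae_eq mu I f g ->
  ae_eq mu I (transfer_rev q os f) (transfer_rev q os g).
Proof. by move=> q0 fg; elim: os => //= omega os ih; exact: transfer_ae. Qed.

Lemma unimodular_cons omega os : unimodular (omega :: os) ->
  normc omega = 1 /\ unimodular os.
Proof.
move=> h; split; first by apply: h; rewrite mem_head.
by move=> z zs; apply: h; rewrite inE zs orbT.
Qed.

Lemma norm1_transfer_rev_le q os u : 0 < q -> unimodular os -> inL1 u ->
  inL1 (transfer_rev q os u) /\ (norm1 (transfer_rev q os u) <= norm1 u)%E.
Proof.
move=> q0 + uL; elim: os => [//|omega os ih] /=.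
move=> /unimodular_cons[ o1 /ih[iL i1]].
by split; [exact: inL1_transfer|apply: le_trans i1; exact: norm1_transfer_le].
Qed.

Lemma bounded_transfer_rev q os h K : 0 < q -> unimodular os -> 0 <= K ->
  bounded_by K h -> exists2 K', 0 <= K' & bounded_by K' (transfer_rev q os h).
Proof.
move=> q0 + K0 hK; elim: os => [|omega os ih] /=; first by exists K.
move=> /unimodular_cons[ o1 /ih[K' K'0 hK']].
by exists (K' * (2 * q)); [rewrite !mulr_ge0// ltW|exact: bounded_transfer].
Qed.

Lemma part_rev_cvg q os h K (e : R) : 0 < q -> unimodular os -> 0 <= K ->
    bounded_by K h -> 0 < e ->
  exists N0, forall N, (N0 <= N)%N ->
    bounded_by e (fun x => part_rev q N os h x - transfer_rev q os h x).
Proof.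
move=> q0 + K0 hK; elim: os e => [|omega os ih] e /=.
  by move=> _ e0; exists 0%N => N _ x _; rewrite subrr normc0 ltW.
move=> /unimodular_cons[ o1 os1] e0.
have [K' K'0 hK'] := bounded_transfer_rev q0 os1 K0 hK.
have q20 : 0 < 2 * q by rewrite mulr_gt0.
have e'0 : 0 < e / 2 / (2 * q) by rewrite !divr_gt0.
have [N1 hN1] := ih _ os1 e'0.
(* Half of e goes to replacing the inner function by its limit, the other half to
   the tail of the outer sum. *)
pose N2 := (Num.truncn (K' * q / (e / 2))).+1.
exists (maxn N1 N2) => N; rewrite geq_max => /andP[N1N N2N] x xI.
set P := part_rev q N os h; set T := transfer_rev q os h.
have -> : transfer_part q omega N P x - transfer q omega T x =
    transfer_part q omega N ((-1) *: T + P)%R x +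
    (transfer_part q omega N T x - transfer q omega T x).
  by rewrite transfer_part_lin mulN1r [- _ + _]addrC addrA subrK.
apply: le_trans (le_normcD _ _) _; rewrite (splitr e); apply: lerD.
  rewrite -[leRHS](divfK (lt0r_neq0 q20)).
  apply: bounded_transfer_part => //; first exact: ltW.
  by move=> y yI; have := hN1 _ N1N y yI; rewrite !fctE scaleN1r addrC.
have N0 : (0 < N)%N by exact: leq_trans N2N.
apply: le_trans (transfer_tail q0 o1 K'0 hK' xI N0) _.
rewrite mulrA ler_pdivrMr ?ltr0n// [leRHS]mulrC -ler_pdivrMr ?divr_gt0//.
by apply: le_trans (ltW (truncnS_gt _)) _; rewrite ler_nat.
Qed.

Fixpoint words N r : seq (seq nat) :=
  if r is r'.+1 then [seq k.+1 :: v | k <- index_iota 0 N, v <- words N r'] else [:: [::]].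

Lemma wordsP N r v : v \in words N r -> size v = r /\ all (leq 1) v.
Proof.
elim: r v => [|r ih] v /=; first by rewrite inE => /eqP ->.
by move=> /allpairsP[[k v'] [_ /ih[s a] ->]] /=; rewrite s a.
Qed.

Lemma words_uniq N r : uniq (words N r).
Proof.
elim: r => [|r ih] //=; apply: allpairs_uniq => //; first exact: iota_uniq.
by move=> [k v] [k' v'] _ _ /= [-> ->].
Qed.

Fixpoint wcoef os v : R[i] :=
  if (os, v) is (omega :: os', n :: v') then omega ^+ n * wcoef os' v' else 1.

Lemma normc_wcoef os v : unimodular os -> normc (wcoef os v) = 1.
Proof.
elim: os v => [|omega os ih] [|n v] /= uo; rewrite ?normc1//.
have [ o1 os1] := unimodular_cons uo.
by rewrite normcM normcX o1 expr1n mul1r ih.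
Qed.

(** The contribution of the word v to the composed operator. *)
Definition wterm q os v h x : R[i] :=
  if wdom q v x then wcoef os v * (wder q v x)%:C * h (wbranch q v x) else 0.

Lemma part_rev_words q N os h x : I x ->
  part_rev q N os h x = \sum_(v <- words N (size os)) wterm q os v h x.
Proof.
elim: os x => [|omega os ih] x xI /=.
  rewrite big_seq1 /wterm /=; move/unit_itvP: (xI) => ->.
  by rewrite mul1r mul1r.
rewrite big_allpairs_dep /=; apply: eq_bigr => k _; rewrite /transfer_term.
move/unit_itvP: (xI) => x01.
have [yI|yI] := pselect (I (branch q k.+1 x)).
  rewrite ext0_unit// ih// mulr_sumr; apply: eq_bigr => v _.
  rewrite /wterm /= x01/=; case: ifP => _; last by rewrite mulr0.
  by rewrite (rmorphM (real_complex R) (branch_wt q k.+1 x)); ring.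
rewrite ext0_out// mulr0 big1// => v _; rewrite /wterm /= x01/=.
by case: ifP => // /wdom_unit/unit_itvP.
Qed.

End IteratedTransfer.

Section LasotaYorke.
Context {R : realType}.
Variables (q : R) (q1 : 1 < q).
Implicit Types (x y K V : R) (N : nat) (f g h u : R -> R[i]) (os : seq R[i]) (v : seq nat).

Local Notation mu := (@lebesgue_measure R).
Local Notation I := (@unit_itv R).

Let q0 : 0 < q. Proof. exact: lt_trans ltr01 q1. Qed.

Lemma wdom_wbranch_unit v x : all (leq 1) v -> wdom q v x -> I (wbranch q v x).
Proof.
move=> va vx; have [+ _] := rcyl_wbranch q1 va vx.
move: (wbranch q v x) => y rc; apply/unit_itvP.
by elim: v rc {va vx} => //= n v ih [/ih].
Qed.

Definition wleft v (a b : R) := Num.min (wbranch q v a) (wbranch q v b).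
Definition wright v (a b : R) := Num.max (wbranch q v a) (wbranch q v b).

(** An explicit preimage, obtained one digit at a time: every branch is decreasing
    and has an inverse in closed form. *)
Lemma wbranch_onto v (a b : R) y : all (leq 1) v -> 0 <= a -> a <= b ->
    wleft v a b < y < wright v a b ->
  exists2 x, a < x < b & wbranch q v x = y.
Proof.
rewrite /wleft /wright; elim: v a b => [|n v ih] a b /=.
  by move=> _ _ ab; rewrite min_l// max_r// => yab; exists y.
move=> /andP[n0 va] a0 ab; have b0 := le_trans a0 ab.
have da0 := branch_den_gt0 n0 a0.
have bb0 := branch_gt0 q0 n0 b0.
have bba : branch q n b <= branch q n a.
  by rewrite /branch ler_pM2l// lef_pV2 ?posrE ?branch_den_gt0// lerD2l.
rewrite minC maxC => /(ih _ _ va (ltW bb0) bba)[z /andP[bz za] <-].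
have z0 := lt_trans bb0 bz.
exists (q / z - n%:R); last by rewrite branchK.
by move: bz za; rewrite !ltNge branch_le ?branch_ge// -!ltNge => -> ->.
Qed.

Section OneWord.
Variables (v : seq nat) (a b : R).
Hypotheses (va : all (leq 1) v) (e : wdom_endpoints q v a b).

Let a0 : 0 <= a. Proof. by case: e. Qed.
Let ab : a < b. Proof. by case: e. Qed.
Let b1 : b <= 1. Proof. by case: e. Qed.
Let domE x : wdom q v x = (a < x < b). Proof. by case: e. Qed.
Let b0 : 0 <= b. Proof. exact/ltW/(le_lt_trans a0). Qed.

(** Both bounds of the derivative are kept: q^-r multiplies the variation of the
    function, and the value at the left endpoint, which is its supremum, is
    compared with the length of the cylinder. *)
Let W := Num.min (q ^- size v) (wder q v a).

Let W0 : 0 <= W.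
Proof. by rewrite le_min wder_ge0// invr_ge0 exprn_ge0// ltW. Qed.

Let wderW x : a < x < b -> 0 <= wder q v x <= W.
Proof.
move=> xab; rewrite wder_ge0//= le_min wder_le ?domE//=.
by case/andP: xab => /ltW ax _; exact: wder_antitone.
Qed.

Lemma wright_sub_wleft : wright v a b - wleft v a b = `|wbranch q v b - wbranch q v a|.
Proof.
rewrite /wright /wleft; case: (leP (wbranch q v a) (wbranch q v b)) => h.
  by rewrite ger0_norm// subr_ge0.
by rewrite ltr0_norm ?subr_lt0// opprB.
Qed.

Lemma wleft_lt_wright : wleft v a b < wright v a b.
Proof.
rewrite -subr_gt0 wright_sub_wleft normr_gt0 wbranch_sub//.
have Da := wdenom_gt0 q1 va a0; have Db := wdenom_gt0 q1 va b0.
rewrite mulf_neq0 ?expf_neq0 ?oppr_eq0 ?oner_eq0// gt_eqF//.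
by rewrite divr_gt0 ?mulr_gt0 ?exprn_gt0 ?subr_gt0.
Qed.

Lemma wimage_unit y : wleft v a b < y < wright v a b -> I y.
Proof.
move=> /(wbranch_onto va a0 (ltW ab))[x xab <-].
by apply: wdom_wbranch_unit => //; rewrite domE.
Qed.

(** All points strictly between the two ends lie in (0, 1), so the ends lie in
    [0, 1]: an end outside would leave room for a point that is not in (0, 1). *)
Lemma wimage_bounds : 0 <= wleft v a b /\ wright v a b <= 1.
Proof.
have lr := wleft_lt_wright; split; rewrite leNgt; apply/negP => h.
  pose t := Num.min (wright v a b) 0.
  have lt' : wleft v a b < t by rewrite lt_min lr.
  have /unit_itvP/andP[+ _] : I ((wleft v a b + t) / 2).
    apply: wimage_unit; rewrite midf_lt//=; apply: lt_le_trans (midf_lt lt').2 _.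
    by rewrite ge_min lexx.
  have : t <= 0 by rewrite ge_min lexx orbT.
  by have := midf_lt lt'; lra.
pose t := Num.max (wleft v a b) 1.
have lt' : t < wright v a b by rewrite gt_max lr.
have /unit_itvP/andP[_ +] : I ((t + wright v a b) / 2).
  apply: wimage_unit; rewrite midf_lt// andbT; apply: le_lt_trans (midf_lt lt').1.
  by rewrite le_max lexx.
have : 1 <= t by rewrite le_max lexx orbT.
by have := midf_lt lt'; lra.
Qed.

Lemma wbranch_image x : a < x < b -> wleft v a b <= wbranch q v x <= wright v a b.
Proof.
move=> /andP[ax xb]; have x0 := le_trans a0 (ltW ax).
have Da := wdenom_gt0 q1 va a0; have Db := wdenom_gt0 q1 va b0.
have Dx := wdenom_gt0 q1 va x0.
have s1 := wbranch_sub q1 va a0 x0; have s2 := wbranch_sub q1 va x0 b0.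
have p1 : 0 <= q ^+ size v * (x - a) / (wdenom q v a * wdenom q v x).
  by rewrite divr_ge0 ?mulr_ge0 ?exprn_ge0 ?subr_ge0 ?ltW.
have p2 : 0 <= q ^+ size v * (b - x) / (wdenom q v x * wdenom q v b).
  by rewrite divr_ge0 ?mulr_ge0 ?exprn_ge0 ?subr_ge0 ?ltW.
rewrite /wleft /wright ge_min le_max -signr_odd in s1 s2 *.
by move: s1 s2; case: (odd _); rewrite ?expr0 ?expr1 => s1 s2; apply/andP; split; apply/orP; lra.
Qed.

Lemma wterm_variation os g phi y0 : unimodular os ->
    {homo phi : x y / x <= y} -> dominated g phi ->
    wleft v a b < y0 < wright v a b ->
  (pointwise_var (wterm q os v g) <=
    (W * ((phi (wright v a b) - phi (wleft v a b)) +
       2 * (normc (g y0) + (phi (wright v a b) - phi (wleft v a b)))))%:E)%E.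
Proof.
move=> uos phim gphi y0cd; set D := phi _ - phi _; have y0I := wimage_unit y0cd.
have D0 : 0 <= D by rewrite /D subr_ge0; apply: phim; apply: ltW; exact: wleft_lt_wright.
have phiD y : wleft v a b <= y <= wright v a b ->
    phi (wleft v a b) <= phi y <= phi (wright v a b).
  by move=> /andP[? ?]; rewrite !phim.
have K0 : 0 <= normc (g y0) + D by rewrite addr_ge0 ?normc_ge0.
have bI x : a < x < b -> I (wbranch q v x).
  by move=> xab; apply: wdom_wbranch_unit => //; rewrite domE.
(* The branch reverses the order when the length of the word is odd; p is the
   transported dominating function, made nondecreasing and starting at 0. *)
pose p x := if odd (size v) then phi (wright v a b) - phi (wbranch q v x)
  else phi (wbranch q v x) - phi (wleft v a b).
have -> : wterm q os v g = cut_product a b (wder q v)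
    (fun x => wcoef os v * g (wbranch q v x)).
  apply/funext => x; rewrite /wterm /cut_product domE; case: ifP => _ //.
  by rewrite mulrCA mulrA.
apply: (@cut_product_variation _ a b W _ D _ p) => // [x xab|x y ax xy yb].
  have phix := phiD _ (wbranch_image xab).
  split; first exact: wderW.
    rewrite normcM normc_wcoef// mul1r -[g (wbranch q v x)](subrK (g y0)) addrC.
    apply: le_trans (le_normcD _ _) _; rewrite lerD2l.
    have phi0 : phi (wleft v a b) <= phi y0 <= phi (wright v a b).
      by apply: phiD; case/andP: y0cd => /ltW -> /ltW ->.
    have [h|/ltW h] := leP y0 (wbranch q v x).
      have := gphi _ _ y0I (bI _ xab) h; rewrite /D; lra.
    have := gphi _ _ (bI _ xab) y0I h; rewrite normcB /D; lra.
  by rewrite /p /D; case: ifP => _; lra.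
have x0 := le_trans a0 (ltW ax); have y00 := le_trans x0 xy.
split; first exact: wder_antitone.
have xab : a < x < b by rewrite ax (le_lt_trans xy).
have yab : a < y < b by rewrite yb (lt_le_trans ax).
have Dx := wdenom_gt0 q1 va x0; have Dy := wdenom_gt0 q1 va y00.
have p1 : 0 <= q ^+ size v * (y - x) / (wdenom q v x * wdenom q v y).
  apply: divr_ge0; last by rewrite mulr_ge0// ltW.
  by rewrite mulr_ge0 ?exprn_ge0 ?subr_ge0// ltW.
have := wbranch_sub q1 va x0 y00; rewrite -mulrBr normcM normc_wcoef// mul1r.
rewrite -signr_odd /p; case: (odd _); rewrite ?expr0 ?expr1 => s1.
  have h : wbranch q v y <= wbranch q v x by lra.
  by have := gphi _ _ (bI _ yab) (bI _ xab) h; rewrite normcB; lra.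
have h : wbranch q v x <= wbranch q v y by lra.
by have := gphi _ _ (bI _ xab) (bI _ yab) h; lra.
Qed.

(** The cylinder is the interval from wleft to wright and its image is (a, b).
    Averaging the bound over the cylinder trades the value g y0 for the integral;
    the distortion estimate compares its length with b - a, hence with delta. *)
Lemma wterm_variation_le os u g phi : (0 < size v)%N -> unimodular os ->
    inL1 u -> ae_eq mu I u g ->
    {homo phi : x y / x <= y} -> dominated g phi ->
  (pointwise_var (wterm q os v g) <=
    (3 * q ^- size v * (phi (wright v a b) - phi (wleft v a b)))%:E +
    (8 / delta q (size v))%:E *
      \int[mu]_(x in `]wleft v a b, wright v a b[) (normc (u x))%:E)%E.
Proof.
move=> v0 uos uL ug phim gphi; have cd := wleft_lt_wright.
have [c0 d1] := wimage_bounds.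
set c := wleft v a b in cd c0 *; set d := wright v a b in cd d1 *.
set D := phi d - phi c; set J := (\int[mu]_(x in _) _)%E.
have D0 : 0 <= D by rewrite /D subr_ge0; apply: phim; exact: ltW.
have varW y0 : c < y0 < d ->
    (pointwise_var (wterm q os v g) <= (W * (D + 2 * (normc (g y0) + D)))%:E)%E.
  by move=> y0cd; apply: wterm_variation.
(* Finiteness follows from any value y0, for instance the midpoint. *)
have Xfin : pointwise_var (wterm q os v g) \is a fin_num.
  rewrite ge0_fin_numE ?pointwise_var_ge0//.
  by apply: le_lt_trans (varW ((c + d) / 2) _) (ltry _); rewrite !midf_lt.
rewrite -(fineK Xfin); set X := fine _.
have XY y0 : c < y0 < d -> X <= 3 * W * D + 2 * W * normc (g y0).
  move=> /varW; rewrite -(fineK Xfin) lee_fin -/X => h.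
  by apply: le_trans h _; rewrite le_eqVlt; apply/orP; left; apply/eqP; ring.
have W20 : 0 <= 2 * W by rewrite mulr_ge0.
have avg := integral_lower_bound uL ug c0 cd d1 W20 XY.
have J0 : (0 <= J)%E by apply: integral_ge0 => x _; rewrite lee_fin normc_ge0.
have uI : (J <= norm1 u)%E.
  have [mr mi _] := uL; apply: ge0_subset_integral => //.
  - exact: measurable_unit_itv.
  - by apply/measurable_EFinP; exact: measurable_normc.
  - by move=> x _; rewrite lee_fin normc_ge0.
  - move=> y; rewrite /= in_itv/= => /andP[y1 y2].
    by apply/unit_itvP; rewrite (le_lt_trans c0 y1) (lt_le_trans y2 d1).
have Jfin : J \is a fin_num.
  by rewrite ge0_fin_numE//; apply: le_lt_trans uI _; case: uL.
move: avg J0; rewrite -/J -(fineK Jfin) -!EFinM -EFinD !lee_fin.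
move: (fine J) => j avg j0.
have dl0 := delta_gt0 q1 v0; have dle := delta_le q1 v0 va e.
set dl := delta q (size v) in dl0 dle *.
have WD : W * D <= q ^- size v * D by rewrite ler_wpM2r// ge_min lexx.
have len : W * dl <= 4 * (d - c).
  apply: (@le_trans _ _ (wder q v a * (b - a))).
    by rewrite ler_pM// ?(ltW dl0)// ge_min lexx orbT.
  rewrite wright_sub_wleft; apply: wbranch_length => //; rewrite ?a0 ?b0 ?b1 ?andbT//=.
  - exact/ltW/(lt_le_trans ab).
  - exact/ltW/(lt_le_trans ab).
  - exact: ltW.
have XYj : (X - 3 * W * D) <= 8 / dl * j.
  have dc : 0 < d - c by rewrite subr_gt0.
  have k : 2 * W <= 8 / dl * (d - c).
    rewrite -(ler_pM2r dl0) (_ : 8 / dl * (d - c) * dl = 8 * (d - c)).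
      by move: len; rewrite -mulrA; lra.
    by field; rewrite gt_eqF.
  by rewrite -(ler_pM2r dc) [leRHS]mulrAC; apply: le_trans avg _; rewrite ler_wpM2r.
by move: XYj WD; lra.
Qed.

End OneWord.

Lemma wterm_empty os g v : (forall x, ~~ wdom q v x) -> wterm q os v g = cst 0.
Proof. by move=> h; apply/funext => x; rewrite /wterm (negbTE (h x)). Qed.

Lemma variation_along_sum (T : Type) (r : seq T) (F : T -> R -> R[i]) (s : seq R) :
  variation_along (fun x => \sum_(t <- r) F t x) s <=
    \sum_(t <- r) variation_along (F t) s.
Proof.
rewrite /variation_along exchange_big/=; apply: ler_sum => i _.
by rewrite -sumrB; exact: normc_sum.
Qed.

(** Each of the at most size s increments changes by at most 2 t. *)
Lemma variation_along_near (F G : R -> R[i]) (s : seq R) (t : R) :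
    {in s, forall x, normc (F x - G x) <= t} ->
  variation_along G s <= variation_along F s + (size s)%:R * (2 * t).
Proof.
move=> FG; have [->|s0] := eqVneq s [::].
  by rewrite /variation_along !big_geq// mul0r addr0.
have t0 : 0 <= t.
  by case: s FG s0 => // x s /(_ x (mem_head _ _)) h _; apply: le_trans h; exact: normc_ge0.
apply: (@le_trans _ _ (\sum_(0 <= i < (size s).-1)
    (normc (F s`_i.+1 - F s`_i) + 2 * t))).
  apply: ler_sum_nat => i /andP[_ hi].
  have i1 : (i.+1 < size s)%N by rewrite -[ltnRHS]prednK ?ltnS// lt0n size_eq0.
  have h1 := FG _ (mem_nth 0 i1); have h2 := FG _ (mem_nth 0 (ltnW i1)).
  have -> : G s`_i.+1 - G s`_i = (F s`_i.+1 - F s`_i) +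
      ((F s`_i - G s`_i) + - (F s`_i.+1 - G s`_i.+1)) by ring.
  apply: le_trans (le_normcD _ _) _; rewrite lerD2l.
  by apply: le_trans (le_normcD _ _) _; rewrite normcN; lra.
rewrite big_split/= lerD2l sumr_const_nat subn0 -[leLHS]mulr_natl.
by rewrite ler_wpM2r ?mulr_ge0// ler_nat leq_pred.
Qed.

Lemma part_rev_variation N os u g V s : (0 < size os)%N -> unimodular os ->
    inL1 u -> ae_eq mu I u g -> (pointwise_var g <= V%:E)%E ->
    sorted <%R s -> {in s, forall x, I x} ->
  variation_along (part_rev q N os g) s <=
    3 * q ^- size os * V + 8 / delta q (size os) * fine (norm1 u).
Proof.
move=> os0 uos uL ug gV ss sI; set r := size os.
have [phi [phim phi0 gphi]] := dominating_fun gV.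
have V0 : 0 <= V by have /andP[h1 h2] := phi0 0; exact: le_trans h2.
(* Words with an empty cylinder contribute nothing; on the others the ends of the
   image are chosen once for all. *)
pose good v := `[< exists ab : R * R, wdom_endpoints q v ab.1 ab.2 >].
pose ends v : R * R := xget (0, 0) [set ab | wdom_endpoints q v ab.1 ab.2].
have endsP v : good v -> wdom_endpoints q v (ends v).1 (ends v).2.
  by move=> /asboolP h; exact: (xgetPex (0, 0) h).
pose c v := wleft v (ends v).1 (ends v).2; pose d v := wright v (ends v).1 (ends v).2.
pose ws := [seq v <- words N r | good v].
have wsP v : v \in ws -> [/\ size v = r, all (leq 1) v & wdom_endpoints q v (ends v).1 (ends v).2].
  by rewrite mem_filter => /andP[/endsP h /wordsP[]].
have uws : uniq ws by rewrite filter_uniq// words_uniq.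
have cd v : v \in ws -> c v < d v.
  by move=> /wsP[_ va e]; exact: wleft_lt_wright va e.
have dis v v' : v \in ws -> v' \in ws -> v != v' -> d v <= c v' \/ d v' <= c v.
  move=> vw vw' vv'; have [sv va e] := wsP _ vw; have [sv' va' e'] := wsP _ vw'.
  have [h1|h1] := leP (d v) (c v'); first by left.
  have [h2|h2] := leP (d v') (c v); first by right.
  (* Two overlapping cylinders share the midpoint of their intersection, and a
     point determines its word. *)
  exfalso; move/eqP: vv'; apply.
  pose lo := Num.max (c v) (c v'); pose hi := Num.min (d v) (d v').
  have lohi : lo < hi.
    by rewrite /lo /hi gt_max !lt_min h1 h2 (cd _ vw) (cd _ vw').
  have ymid : lo < (lo + hi) / 2 < hi by rewrite !midf_lt.
  have [y1 y2] : c v < (lo + hi) / 2 < d v /\ c v' < (lo + hi) / 2 < d v'.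
    move: ymid; rewrite /lo /hi; move: (_ / 2) => y.
    by rewrite gt_max lt_min => /andP[/andP[-> ->] /andP[-> ->]].
  have [a0 ab _ _ domE] := e; have [a0' ab' _ _ domE'] := e'.
  have [x xab yx] := wbranch_onto va a0 (ltW ab) y1.
  have [x' xab' yx'] := wbranch_onto va' a0' (ltW ab') y2.
  apply: (@wbranch_inj _ q q1 v v' x x') => //; rewrite ?domE ?domE' ?sv ?sv' ?yx ?yx'//.
have -> : variation_along (part_rev q N os g) s =
    variation_along (fun x => \sum_(v <- ws) wterm q os v g x) s.
  apply: eq_big_nat => i /andP[_ hi].
  have s0 : (0 < size s)%N by case: (s) hi.
  have i1 : (i.+1 < size s)%N by rewrite -[ltnRHS]prednK ?ltnS.
  have E x : I x -> part_rev q N os g x = \sum_(v <- ws) wterm q os v g x.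
    move=> xI; rewrite part_rev_words// [RHS]big_filter [RHS]big_mkcond/= big_seq [RHS]big_seq.
    apply: eq_bigr => v /wordsP[_ va]; case: ifPn => // /asboolPn ng.
    case: (wdom_itv q1 va) => [h|[a [b h]]]; first by rewrite (wterm_empty _ _ h).
    by exfalso; apply: ng; exists (a, b).
  by rewrite !E//; apply: sI; rewrite mem_nth// ltnW.
apply: le_trans (variation_along_sum _ _ _) _.
have u1fin : norm1 u \is a fin_num by rewrite ge0_fin_numE ?norm1_ge0//; case: uL.
rewrite -lee_fin EFinD [((8 / _) * _)%:E]EFinM fineK// -sumEFin.
pose J v := (\int[mu]_(x in `]c v, d v[) (normc (u x))%:E)%E.
have J0 v : (0 <= J v)%E by apply: integral_ge0 => x _; rewrite lee_fin normc_ge0.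
apply: (@le_trans _ _ (\sum_(v <- ws) ((3 * q ^- r * (phi (d v) - phi (c v)))%:E +
    (8 / delta q r)%:E * J v))%E).
  rewrite big_seq [leRHS]big_seq; apply: lee_sum => v vw; have [sv va e] := wsP _ vw.
  have v0 : (0 < size v)%N by rewrite sv.
  have := wterm_variation_le va e v0 uos uL ug phim gphi; rewrite sv.
  by apply: le_trans; apply: ereal_sup_ubound; exists s.
rewrite big_split/=; apply: leeD.
  rewrite sumEFin lee_fin -mulr_sumr ler_wpM2l//.
    by rewrite mulr_ge0// invr_ge0 exprn_ge0// ltW.
  by apply: sum_disjoint_increments => // v /cd/ltW.
rewrite -ge0_sume_distrr; last by move=> v _; exact: J0.
apply: lee_wpmul2l.
  by rewrite lee_fin divr_ge0// ltW// delta_gt0.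
apply: sum_disjoint_integrals => // v /wsP[_ va e].
by have [h1 h2] := wimage_bounds va e.
Qed.

(** The variation along a fixed list passes to the limit of the truncated
    operators, which converge uniformly on bounded functions. *)
Lemma transfer_rev_pointwise_var os u g V : (0 < size os)%N -> unimodular os ->
    inL1 u -> ae_eq mu I u g -> (pointwise_var g <= V%:E)%E ->
  (pointwise_var (transfer_rev q os g) <=
    (3 * q ^- size os * V)%:E + (8 / delta q (size os))%:E * norm1 u)%E.
Proof.
move=> os0 uos uL ug gV; apply: ge_ereal_sup => _ [s [ss sI] <-].
have u1fin : norm1 u \is a fin_num by rewrite ge0_fin_numE ?norm1_ge0//; case: uL.
rewrite -(fineK u1fin) -EFinM -EFinD lee_fin.
have [phi [phim phi0 gphi]] := dominating_fun gV.
have V0 : 0 <= V by have /andP[h1 h2] := phi0 0; exact: le_trans h2.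
have hI : I 2^-1 by apply/unit_itvP; rewrite invr_gt0 ltr0n invf_lt1// ltr1n.
have gK : bounded_by (normc (g 2^-1) + V) g.
  move=> y yI; rewrite -[g y](subrK (g 2^-1)) addrC.
  apply: le_trans (le_normcD _ _) _; rewrite lerD2l.
  have /andP[a1 a2] := phi0 y; have /andP[b1 b2] := phi0 2^-1.
  have [h|/ltW h] := leP y 2^-1; last by have := gphi _ _ hI yI h; lra.
  by have := gphi _ _ yI hI h; rewrite normcB; lra.
have K0 : 0 <= normc (g 2^-1) + V by rewrite addr_ge0 ?normc_ge0.
apply/ler_addgt0Pr => e e0.
have n0 : 0 < (size s).+1%:R * 2 :> R by rewrite mulr_gt0.
have e'0 : 0 < e / ((size s).+1%:R * 2) by rewrite divr_gt0.
have [N0 hN0] := part_rev_cvg q0 uos K0 gK e'0.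
have near' : {in s, forall x, normc (part_rev q N0 os g x - transfer_rev q os g x) <=
    e / ((size s).+1%:R * 2)}.
  by move=> x /sI; exact: (hN0 _ (leqnn _)).
apply: le_trans (variation_along_near near') _; apply: lerD.
  exact: part_rev_variation.
rewrite -[leRHS](divfK (lt0r_neq0 n0)); move: (e / _) e'0 => k k0.
have : k * (size s)%:R <= k * (size s).+1%:R by rewrite ler_wpM2l ?(ltW k0)// ler_nat.
by lra.
Qed.

(** The pointwise bound applies to every function equal to u almost everywhere;
    those whose variation is close to the infimum give the bound for classes. *)
Lemma lasota_yorke os u : (0 < size os)%N -> unimodular os -> inBV u ->
  (Var (transfer_rev q os u) <=
    (4 * q ^- size os)%:E * Var u + (8 / delta q (size os))%:E * norm1 u)%E.
Proof.
move=> os0 uos [uL uV].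
have Vfin : Var u \is a fin_num by rewrite ge0_fin_numE ?Var_ge0.
have qr0 : 0 < 4 * q ^- size os by rewrite mulr_gt0 ?invr_gt0 ?exprn_gt0.
apply/lee_addgt0Pr => e e0.
have e'0 : 0 < e / (4 * q ^- size os) by rewrite divr_gt0.
have [_ [g ug <-] gV] := lb_ereal_inf_adherent e'0 Vfin.
apply: (@le_trans _ _ (pointwise_var (transfer_rev q os g))).
  by apply: ereal_inf_lbound; exists (transfer_rev q os g) => //=; exact: transfer_rev_ae.
have gV' : (pointwise_var g <= (fine (Var u) + e / (4 * q ^- size os))%:E)%E.
  by rewrite EFinD fineK// ltW.
apply: le_trans (transfer_rev_pointwise_var os0 uos uL ug gV') _.
rewrite -(fineK Vfin) -EFinM [leRHS]addeAC leeD2r// -EFinD lee_fin.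
have V0 : 0 <= fine (Var u) by exact/fine_ge0/Var_ge0.
rewrite -[X in _ <= _ + X](divfK (lt0r_neq0 qr0)); move: (e / _) e'0 => k k0.
have h1 : 0 <= q ^- size os * fine (Var u) by rewrite mulr_ge0 ?invr_ge0 ?exprn_ge0 ?(ltW q0).
have h2 : 0 <= q ^- size os * k by rewrite mulr_ge0 ?invr_ge0 ?exprn_ge0 ?(ltW q0) ?(ltW k0).
by lra.
Qed.

End LasotaYorke.

(** * Bounded and finite-rank operators on classes of functions *)

Section BVOperators.
Context {R : realType}.

Local Notation B := (bv_space R).
Local Notation mu := (@lebesgue_measure R).
Local Notation I := (@unit_itv R).
Implicit Types (u v w : B) (a c : R[i]) (F G : B -> B) (C : R).

Definition bv_norm1 u : R := fine (norm1 (repr u)).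
Definition bv_var u : R := fine (Var (repr u)).
(** The real number behind the norm of the space, whose values are complex. *)
Definition nrm u : R := bv_norm1 u + bv_var u.

Lemma normE u : `|u| = (nrm u)%:C.
Proof. by []. Qed.

Lemma bv_norm1_ge0 u : 0 <= bv_norm1 u.
Proof. exact/fine_ge0/norm1_ge0. Qed.

Lemma bv_var_ge0 u : 0 <= bv_var u.
Proof. exact/fine_ge0/Var_ge0. Qed.

Lemma nrm_ge0 u : 0 <= nrm u.
Proof. by rewrite addr_ge0// ?bv_norm1_ge0 ?bv_var_ge0. Qed.

Lemma repr_ae (f : bv_fun R) : ae_eq mu I (repr (bv_class f)) f.
Proof. by apply/bv_class_eq; rewrite bv_classK. Qed.

Lemma bv_norm1_class (f : bv_fun R) : bv_norm1 (bv_class f) = fine (norm1 f).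
Proof.
have [L1r _] := bv_fun_inBV (repr (bv_class f)); have [L1f _] := bv_fun_inBV f.
by rewrite /bv_norm1 (norm1_ae L1r L1f (repr_ae f)).
Qed.

Lemma bv_var_class (f : bv_fun R) : bv_var (bv_class f) = fine (Var f).
Proof. by rewrite /bv_var (Var_ae (repr_ae f)). Qed.

Lemma nrmD u v : nrm (u + v) <= nrm u + nrm v.
Proof. by have := ler_normD u v; rewrite !normE -rmorphD lecR. Qed.

Lemma nrmZ a u : nrm (a *: u) = normc a * nrm u.
Proof.
have := normrZ a u; rewrite !normE (_ : `|a| = (normc a)%:C)// -rmorphM.
exact: complexI.
Qed.

Lemma nrmN u : nrm (- u) = nrm u.
Proof. by have := normrN u; rewrite !normE; exact: complexI. Qed.

Lemma nrm_eq0 u : nrm u = 0 -> u = 0.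
Proof. by move=> u0; apply/eqP; rewrite -normr_eq0 normE u0. Qed.

(** Predicates on bare functions, so that they also apply to inverses obtained by
    choice. *)
Definition bv_linear F := forall a u v, F (a *: u + v) = a *: F u + F v.

Definition bv_bounded F := exists2 C, 0 <= C & forall u, nrm (F u) <= C * nrm u.

Lemma bv_linearD F u v : bv_linear F -> F (u + v) = F u + F v.
Proof. by move=> lF; rewrite -[u]scale1r lF !scale1r. Qed.

Lemma bv_linear0 F : bv_linear F -> F 0 = 0.
Proof. by move=> lF; have := lF (-1) 0 0; rewrite !scaleN1r !addNr. Qed.

Lemma bv_linearZ F a u : bv_linear F -> F (a *: u) = a *: F u.
Proof. by move=> lF; rewrite -[a *: u]addr0 lF bv_linear0// addr0. Qed.

Lemma bv_linearN F u : bv_linear F -> F (- u) = - F u.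
Proof. by move=> lF; rewrite -scaleN1r bv_linearZ// scaleN1r. Qed.

Lemma bv_linear_comp F G : bv_linear F -> bv_linear G -> bv_linear (F \o G).
Proof. by move=> lF lG a u v; rewrite /= lG lF. Qed.

Lemma bv_bounded_comp F G : bv_bounded F -> bv_bounded G -> bv_bounded (F \o G).
Proof.
move=> [C C0 bF] [D D0 bG]; exists (C * D); first exact: mulr_ge0.
by move=> u /=; apply: le_trans (bF _) _; rewrite -mulrA ler_wpM2l.
Qed.

Lemma bv_bounded_lin F G a : bv_bounded F -> bv_bounded G ->
  bv_bounded (fun u => a *: F u + G u).
Proof.
move=> [C C0 bF] [D D0 bG]; exists (normc a * C + D).
  by rewrite addr_ge0// mulr_ge0// normc_ge0.
move=> u; apply: le_trans (nrmD _ _) _; rewrite nrmZ mulrDl -mulrA.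
by rewrite lerD// ler_wpM2l// normc_ge0.
Qed.

Lemma bv_bounded_id : bv_bounded id.
Proof. by exists 1 => // u; rewrite mul1r. Qed.

Lemma bv_linear_pack F : bv_linear F ->
  exists T : {linear B -> B}, F = T :> (B -> B).
Proof.
move=> lF; pose m := GRing.isLinear.Build _ _ _ _ F lF.
by exists (HB.pack F m : {linear B -> B}).
Qed.

Lemma bv_linearP (T : {linear B -> B}) : bv_linear T.
Proof. by move=> a u v; rewrite linearP. Qed.

Lemma bv_bounded_continuous (T : {linear B -> B}) : bv_bounded T -> continuous T.
Proof.
move=> [C C0 bT]; apply: bounded_linear_continuous; apply/bounded_funP => r.
exists (C%:C * r) => u ur; rewrite normE.
apply: (@le_trans _ _ (C%:C * (nrm u)%:C)); first by rewrite -rmorphM lecR.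
by rewrite ler_wpM2l// ler0c.
Qed.

(** Only the image of the unit ball matters for compactness, so the coefficients are
    arbitrary bounded functions. *)
Inductive finite_rank : (B -> B) -> Prop :=
| finite_rank0 : finite_rank (fun _ => 0)
| finite_rank_term (f : B -> R[i]) v F :
    (exists2 C, 0 <= C & forall u, normc (f u) <= C * nrm u) ->
    finite_rank F -> finite_rank (fun u => f u *: v + F u).

Lemma finite_rank_compl S F : bv_linear S -> finite_rank F -> finite_rank (S \o F).
Proof.
move=> lS; elim=> [|f v G bf _ ih].
  rewrite (_ : _ \o _ = fun _ => 0); first exact: finite_rank0.
  by apply/funext => u /=; rewrite bv_linear0.
rewrite (_ : _ \o _ = fun u => f u *: S v + (S \o G) u).
  exact: finite_rank_term.
by apply/funext => u /=; rewrite lS.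
Qed.

Lemma finite_rank_compr S F : bv_bounded S -> finite_rank F -> finite_rank (F \o S).
Proof.
move=> [D D0 bS]; elim=> [|f v G [C C0 bf] _ ih]; first exact: finite_rank0.
apply: (@finite_rank_term (f \o S)) => //; exists (C * D); first exact: mulr_ge0.
by move=> u /=; apply: le_trans (bf _) _; rewrite -mulrA ler_wpM2l.
Qed.

Lemma finite_rankD F G : finite_rank F -> finite_rank G ->
  finite_rank (fun u => F u + G u).
Proof.
move=> fF fG; elim: fF => [|f v F' bf _ ih].
  by rewrite (_ : (fun _ => _) = G)//; apply/funext => u; rewrite add0r.
rewrite (_ : (fun _ => _) = fun u => f u *: v + (F' u + G u)).
  exact: finite_rank_term.
by apply/funext => u; rewrite addrA.
Qed.

Lemma finite_rankN F : finite_rank F -> finite_rank (fun u => - F u).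
Proof.
by apply: (finite_rank_compl (S := -%R)) => a u v; rewrite opprD scalerN.
Qed.

Lemma finite_rank_sum (T : Type) (r : seq T) (f : T -> B -> R[i]) (e : T -> B) :
    (forall t, exists2 C, 0 <= C & forall u, normc (f t u) <= C * nrm u) ->
  finite_rank (fun u => \sum_(t <- r) f t u *: e t).
Proof.
move=> bf; elim: r => [|t r ih].
  by under eq_fun do rewrite big_nil; exact: finite_rank0.
by under eq_fun do rewrite big_cons; exact: finite_rank_term.
Qed.

Lemma scale_real_continuous v : continuous (fun s : R => s%:C *: v : B).
Proof.
move=> s; apply/cvgrPdist_lt => _ /ltc_real[e e0 ->].
have n0 : 0 < nrm v + 1 by rewrite ltr_wpDl ?nrm_ge0.
have d0 : 0 < e / (nrm v + 1) by rewrite divr_gt0.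
near=> t; rewrite -scalerBl -rmorphB normE ltcR nrmZ normcR.
apply: (@le_lt_trans _ _ (`|s - t| * (nrm v + 1))).
  by rewrite ler_wpM2l// lerDl.
rewrite -ltr_pdivlMr//; near: t; exact: (cvgr_dist_lt (cvg_id _)).
Unshelve. all: by end_near. Qed.

(** The image of the unit ball lies in a sum of finitely many segments, two for
    each term because the scalars are complex, and such a sum is compact. *)
Lemma finite_rank_compact F : finite_rank F -> compact_op F.
Proof.
move=> fF.
suff [K cK FK] : exists2 K : set B, compact K & F @` [set x | `|x| <= 1] `<=` K.
  have clK : closed K by apply: compact_closed => //; exact: norm_hausdorff.
  apply: (subclosed_compact _ cK); first exact: closed_closure.
  by move/closure_id: clK => ->; exact: closure_subset.
elim: fF => [|f v G [C C0 bf] _ [K cK GK]].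
  by exists [set 0]; [exact: compact_set1|move=> _ [u _ <-]].
pose seg := (`[- C, C]%classic : set R).
have cseg : compact seg by exact: segment_compact.
have cimg (x : B) : compact ((fun s : R => s%:C *: x) @` seg).
  apply: continuous_compact => //; apply: continuous_subspaceT.
  exact: scale_real_continuous.
have caddset (K1 K2 : set B) : compact K1 -> compact K2 ->
    compact ((fun z : B * B => z.1 + z.2) @` (K1 `*` K2)).
  move=> c1 c2; apply: continuous_compact; last exact: compact_setX.
  by apply: continuous_subspaceT; exact: add_continuous.
exists ((fun z : B * B => z.1 + z.2) @` (((fun z : B * B => z.1 + z.2) @`
   (((fun s : R => s%:C *: v) @` seg) `*` ((fun s : R => s%:C *: ('i%C *: v)) @` seg))) `*` K)).
  by apply: (caddset _ _ (caddset _ _ _ _) _).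
move=> _ [u u1 <-].
have nu : nrm u <= 1 by move: u1; rewrite /= normE (_ : 1 = 1%:C)// lecR.
have fC : normc (f u) <= C by apply: le_trans (bf u) _; rewrite ler_piMr.
exists (f u *: v, G u) => //; split => /=; last by apply: GK; exists u.
exists ((complex.Re (f u))%:C *: v, (complex.Im (f u))%:C *: ('i%C *: v)) => /=.
  split; [exists (complex.Re (f u)) => //|exists (complex.Im (f u)) => //];
    rewrite /seg /= in_itv/= -ler_norml; apply: le_trans fC;
    [exact: abs_Re_le_normc|exact: abs_Im_le_normc].
by rewrite scalerA -scalerDl mulrC -complexE.
Qed.

End BVOperators.

(** * Completeness and the Neumann series *)

Section Completeness.
Context {R : realType}.

Local Notation B := (bv_space R).
Local Notation mu := (@lebesgue_measure R).
Local Notation I := (@unit_itv R).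
Implicit Types (u v w : B) (C t : R).

Lemma geometric_sum_le t (M N : nat) : 0 < t -> t < 1 ->
  \sum_(M <= k < N) t ^+ k <= t ^+ M / (1 - t).
Proof.
move=> t0 t1; have t1' : 0 < 1 - t by rewrite subr_gt0.
have [NM|MN] := leqP N M.
  by rewrite big_geq// divr_ge0 ?exprn_ge0 ?(ltW t0) ?(ltW t1').
rewrite (eq_bigr (fun k => (- t ^+ k.+1 - - t ^+ k) / (1 - t))); last first.
  by move=> k _; rewrite exprS; field; rewrite gt_eqF.
rewrite -mulr_suml ler_pM2r ?invr_gt0// telescope_sumr ?(ltnW MN)//.
by rewrite opprK addrC gerBl exprn_ge0// ltW.
Qed.

(** The value of g at x differs from any other value by at most V, hence also from
    some value bounded by the average of |u|. *)
Lemma bv_sup_le (u g : R -> R[i]) (V : R) x : inL1 u -> ae_eq mu I u g ->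
  (pointwise_var g <= V%:E)%E -> I x -> normc (g x) <= V + fine (norm1 u).
Proof.
move=> uL ug gV xI; have [phi [_ phi0 gphi]] := dominating_fun gV.
have XY y : 0 < y < 1 -> normc (g x) <= V + 1 * normc (g y).
  move=> /unit_itvP yI; rewrite mul1r -[g x](subrK (g y)).
  apply: le_trans (le_normcD _ _) _; rewrite lerD2r.
  have /andP[a1 a2] := phi0 x; have /andP[b1 b2] := phi0 y.
  have [h|/ltW h] := leP x y; last by have := gphi _ _ yI xI h; lra.
  by have := gphi _ _ xI yI h; rewrite normcB; lra.
have := integral_lower_bound uL ug (lexx 0) ltr01 (lexx 1) ler01 XY.
rewrite mul1e -/(norm1 u) subr0 mulr1.
have u1fin : norm1 u \is a fin_num by rewrite ge0_fin_numE ?norm1_ge0//; case: uL.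
by rewrite -(fineK u1fin) lee_fin; lra.
Qed.

Lemma norm1_sup_le (u g : R -> R[i]) C :
    measurable_fun I (fun x => complex.Re (u x)) ->
    measurable_fun I (fun x => complex.Im (u x)) ->
  ae_eq mu I u g -> bounded_by C g -> (norm1 u <= C%:E)%E.
Proof.
move=> mr mi ug gC.
have C0 : 0 <= C.
  by apply: le_trans (gC 2^-1 _); rewrite ?normc_ge0//; apply/unit_itvP; rewrite invr_gt0 ltr0n invf_lt1// ltr1n.
have mI := @measurable_unit_itv R.
apply: (@le_trans _ _ (\int[mu]_(x in I) (cst C%:E) x)%E); last first.
  rewrite integral_cst// /unit_itv /= lebesgue_measure_itv/= lte_fin ltr01 sube0.
  by rewrite mule1.
apply: ae_ge0_le_integral => //.
- by move=> x _; rewrite lee_fin normc_ge0.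
- by apply/measurable_EFinP; exact: measurable_normc.
- by apply: filterS ug => x ugx xI; rewrite ugx// lee_fin gC.
Qed.

Lemma measurable_sum_bv (f_ : nat -> bv_fun R) N :
  measurable_fun I (fun x => complex.Re (\sum_(0 <= k < N) f_ k x)) /\
  measurable_fun I (fun x => complex.Im (\sum_(0 <= k < N) f_ k x)).
Proof.
elim: N => [|N [ihr ihi]].
  by split; (under eq_fun do rewrite big_geq//); exact: measurable_cst.
have [[mr mi _] _] := bv_fun_inBV (f_ N).
split; under eq_fun do rewrite big_nat_recr//=.
  apply: (eq_measurable_fun (fun x => complex.Re (\sum_(0 <= k < N) f_ k x) + complex.Re (f_ N x))).
    by move=> x _; case: (\sum_(_ <= _ < _) _) (f_ N x) => ? ? [].
  exact: measurable_funD.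
apply: (eq_measurable_fun (fun x => complex.Im (\sum_(0 <= k < N) f_ k x) + complex.Im (f_ N x))).
  by move=> x _; case: (\sum_(_ <= _ < _) _) (f_ N x) => ? ? [].
exact: measurable_funD.
Qed.

Lemma bv_class_sum (f_ : nat -> bv_fun R) N :
  \sum_(0 <= k < N) bv_class (f_ k) = bv_class (\sum_(0 <= k < N) f_ k).
Proof.
elim: N => [|N ih]; first by rewrite !big_geq// /bv_class !piE.
by rewrite !big_nat_recr//= ih bv_classD.
Qed.

Lemma bv_val_sum (f_ : nat -> bv_fun R) N x :
  bv_val (\sum_(0 <= k < N) f_ k) x = \sum_(0 <= k < N) f_ k x.
Proof.
elim: N => [|N ih]; first by rewrite !big_geq.
by rewrite !big_nat_recr//= -ih.
Qed.

(** Representatives of almost minimal variation are bounded uniformly by their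
    norms, so their series converges uniformly, and its tails have small variation
    because variation along a fixed list passes to uniform limits. *)
Lemma bv_abs_cvg (w_ : nat -> B) (c t : R) : 0 < t -> t < 1 -> 0 <= c ->
    (forall k, nrm (w_ k) <= c * t ^+ k) ->
  exists v C, forall M, nrm (v - \sum_(0 <= k < M) w_ k) <= C * t ^+ M.
Proof.
move=> t0 t1 c0 wc; pose f_ k := repr (w_ k).
have t1' : 0 < 1 - t by rewrite subr_gt0.
have tk k : 0 < t ^+ k by rewrite exprn_gt0.
have fv k : fine (Var (f_ k)) <= c * t ^+ k.
  by apply: le_trans (wc k); rewrite /nrm lerDr bv_norm1_ge0.
have f1 k : fine (norm1 (f_ k)) <= c * t ^+ k.
  by apply: le_trans (wc k); rewrite /nrm lerDl bv_var_ge0.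
have /boolp.choice[g_ hg] : forall k, exists g : R -> R[i],
    ae_eq mu I (f_ k) g /\ (pointwise_var g <= ((c + 1) * t ^+ k)%:E)%E.
  move=> k.
  have [_ [g fg <-] gV] := lb_ereal_inf_adherent (tk k) (Var_fin (f_ k)).
  exists g; split => //; apply: le_trans (ltW gV) _.
  rewrite -/(Var (f_ k)) -(fineK (Var_fin (f_ k))) -EFinD lee_fin.
  by have := fv k; lra.
have gB k : bounded_by ((2 * c + 1) * t ^+ k) (g_ k).
  move=> x xI; have [fg gV] := hg k; have [fL _] := bv_fun_inBV (f_ k).
  by apply: le_trans (bv_sup_le fL fg gV xI) _; have := f1 k; lra.
pose K := (2 * c + 1) / (1 - t).
have K0 : 0 <= K by rewrite divr_ge0 ?(ltW t1')// addr_ge0// mulr_ge0.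
have gtail (M N : nat) x : I x -> \sum_(M <= k < N) normc (g_ k x) <= K * t ^+ M.
  move=> xI; apply: (@le_trans _ _ (\sum_(M <= k < N) (2 * c + 1) * t ^+ k)).
    by apply: ler_sum => k _; exact: gB.
  rewrite -mulr_sumr /K mulrAC -mulrA ler_wpM2l ?geometric_sum_le//.
  by rewrite addr_ge0// mulr_ge0.
(* G' is the uniform limit that is estimated; G is the limit of the given
   representatives, whose measurability is known, and agrees with G' almost
   everywhere. *)
pose G x := limc (fun N => \sum_(0 <= k < N) f_ k x).
pose G' x := limc (fun N => \sum_(0 <= k < N) g_ k x).
have G'cvg x : I x -> forall e : R, 0 < e -> \forall N \near \oo,
    normc (\sum_(0 <= k < N) g_ k x - G' x) < e.
  move=> xI; have [l hl] := abs_cvgc (fun N => gtail 0 N x xI).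
  by rewrite /G' (limcE hl).
have G'tail M : bounded_by (K * t ^+ M) (fun x => G' x - \sum_(0 <= k < M) g_ k x).
  move=> x xI; apply: cvgc_dist_normc_le (G'cvg x xI) _.
  exists M => // N /= MN; rewrite (big_cat_nat (n := M))//= addrAC subrr add0r.
  exact: le_trans (normc_sum _ _ _) (gtail _ _ _ xI).
have aeall : {ae mu, forall x, I x -> forall k, f_ k x = g_ k x}.
  have : mu.-negligible (\bigcup_k ~` [set x | I x -> f_ k x = g_ k x]).
    by apply: negligible_bigcup => k; have [] := hg k.
  apply: negligibleS => x /= /not_implyP[xI] /existsNP[k fgk].
  by exists k => //= /(_ xI).
have GM M : ae_eq mu I (fun x => G x - \sum_(0 <= k < M) f_ k x)
    (fun x => G' x - \sum_(0 <= k < M) g_ k x).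
  apply: negligibleS aeall; apply: subsetC => x /= + xI => /(_ xI) fgx.
  rewrite /G /G'.
  have E N : \sum_(0 <= k < N) f_ k x = \sum_(0 <= k < N) g_ k x.
    by apply: eq_bigr => k _; exact: fgx.
  by rewrite E; congr (limc _ - _); apply/funext => N; exact: E.
have G'var M : (pointwise_var (fun x => (G' x - \sum_(0 <= k < M) g_ k x)%R) <=
    (K * t ^+ M)%:E)%E.
  apply: ge_ereal_sup => _ [s [ss sI] <-]; rewrite lee_fin.
  apply/ler_addgt0Pr => e e0.
  have n0 : 0 < (size s).+1%:R * 2 :> R by rewrite mulr_gt0.
  pose d := e / ((size s).+1%:R * 2); have d0 : 0 < d by rewrite divr_gt0.
  have [N0 hN0] : exists N0, forall N, (N0 <= N)%N -> K * t ^+ N <= d.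
    have K1 : 0 < K + 1 by rewrite ltr_wpDl.
    have /cvgrPdist_lt/(_ _ (divr_gt0 d0 K1))[N0 _ hN0] : t ^+ N @[N --> \oo] --> (0 : R).
      by apply: cvg_expr; rewrite gtr0_norm.
    exists N0 => N /hN0 /=; rewrite sub0r normrN gtr0_norm// ltr_pdivlMr// => h.
    by have := tk N; lra.
  pose N := maxn M N0; have MN : (M <= N)%N by exact: leq_maxl.
  have near' : {in s, forall x, normc (\sum_(M <= k < N) g_ k x -
      (G' x - \sum_(0 <= k < M) g_ k x)) <= d}.
    move=> x /sI xI; rewrite normcB; apply: le_trans (hN0 N (leq_maxr _ _)).
    apply: le_trans (G'tail N x xI).
    by rewrite (big_cat_nat (m := 0%N) (n := M) (p := N))//= opprD addrA.
  apply: le_trans (variation_along_near near') _.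
  have h1 : variation_along (fun x => \sum_(M <= k < N) g_ k x) s <= K * t ^+ M.
    apply: le_trans (variation_along_sum _ _ _) _.
    apply: (@le_trans _ _ (\sum_(M <= k < N) (2 * c + 1) * t ^+ k)).
      apply: ler_sum => k _; have [_ gV] := hg k.
      apply: le_trans (pointwise_var_ge gV ss sI) _.
      by rewrite ler_wpM2r ?(ltW (tk k))//; lra.
    rewrite -mulr_sumr /K mulrAC -mulrA ler_wpM2l ?geometric_sum_le//.
    by rewrite addr_ge0// mulr_ge0.
  apply: lerD => //.
  rewrite -[leRHS](divfK (lt0r_neq0 n0)) -/d.
  have : d * (size s)%:R <= d * (size s).+1%:R by rewrite ler_wpM2l ?(ltW d0)// ler_nat.
  by lra.
have [mGr mGi] := measurable_limc (@measurable_unit_itv R)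
  (fun N => (measurable_sum_bv f_ N).1) (fun N => (measurable_sum_bv f_ N).2).
have sumE M : (fun x => G x - \sum_(0 <= k < M) f_ k x) =
    ((-1) *: (bv_val (\sum_(0 <= k < M) f_ k)) + G)%R.
  by apply/funext => x; rewrite !fctE scaleN1r bv_val_sum addrC.
have GG' : ae_eq mu I G G'.
  by apply: filterS (GM 0) => x + xI => /(_ xI); rewrite !big_geq// !subr0.
have GL : inL1 G.
  split => //; apply: (@le_lt_trans _ _ K%:E); last exact: ltry.
  apply: norm1_sup_le GG' _ => // x xI.
  by have := G'tail 0 x xI; rewrite big_geq// subr0 expr0 mulr1.
have GV : inBV G.
  split => //; apply: (@le_lt_trans _ _ (K * t ^+ 0)%:E); last exact: ltry.
  apply: le_trans (G'var 0); apply: ereal_inf_lbound.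
  exists (fun x => G' x - \sum_(0 <= k < 0) g_ k x) => //=.
  by apply: filterS GG' => x + xI => /(_ xI) ->; rewrite big_geq// subr0.
have Gin : G \in BVpred by exact/asboolP.
pose v := bv_class (BVFun Gin).
exists v, (2 * K) => M.
have -> : v - \sum_(0 <= k < M) w_ k =
    bv_class ((-1) *: (\sum_(0 <= k < M) f_ k) + BVFun Gin).
  rewrite bv_classD bv_classZ scaleN1r -bv_class_sum [RHS]addrC.
  by congr (_ - _); apply: eq_bigr => k _; rewrite bv_classK.
set D := (_ + BVFun Gin); have DE : bv_val D = (fun x => G x - \sum_(0 <= k < M) f_ k x).
  by rewrite sumE.
rewrite /nrm bv_norm1_class bv_var_class mulr_natl mulr2n mulrDl; apply: lerD.
- rewrite -lee_fin fineK ?norm1_fin// DE.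
  have [[mDr mDi _] _] := bv_fun_inBV D; rewrite DE in mDr mDi.
  exact: norm1_sup_le mDr mDi (GM M) (G'tail M).
- rewrite -lee_fin fineK ?Var_fin// DE; apply: le_trans (G'var M).
  by apply: ereal_inf_lbound; exists (fun x => G' x - \sum_(0 <= k < M) g_ k x) => //=; exact: GM.
Qed.

End Completeness.

(** * Inversion modulo finite-rank operators *)

Section Parametrix.
Context {R : realType}.

Local Notation B := (bv_space R).
Implicit Types (u v w : B) (A F G K T : B -> B) (C t : R) (lambda : R[i]).

Lemma geometric_small t C (e : R) : 0 < t -> t < 1 -> 0 < e ->
  exists N : nat, C * t ^+ N <= e.
Proof.
move=> t0 t1 e0; have C1 : 0 < `|C| + 1 by rewrite ltr_wpDl.
have /cvgrPdist_lt/(_ _ (divr_gt0 e0 C1))[N _ /(_ N (leqnn N))] :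
    t ^+ N @[N --> \oo] --> (0 : R).
  by apply: cvg_expr; rewrite gtr0_norm.
have tN : 0 < t ^+ N by rewrite exprn_gt0.
rewrite /= sub0r normrN gtr0_norm// ltr_pdivlMr// => h; exists N.
have : C * t ^+ N <= `|C| * t ^+ N by rewrite ler_wpM2r ?ler_norm// ltW.
by lra.
Qed.

Lemma bv_neumann A t u : bv_linear A -> 0 < t -> t < 1 ->
  (forall u, nrm (A u) <= t * nrm u) -> exists v, v - A v = u.
Proof.
move=> lA t0 t1 bA.
have bk k : nrm (iter k A u) <= nrm u * t ^+ k.
  elim: k => [|k ih]; first by rewrite expr0 mulr1.
  by rewrite iterS; apply: le_trans (bA _) _; rewrite exprS mulrCA ler_wpM2l// ltW.
have [v [C vC]] := bv_abs_cvg t0 t1 (nrm_ge0 u) bk.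
exists v; apply/eqP; rewrite -subr_eq0; apply/eqP/nrm_eq0/eqP.
rewrite eq_le nrm_ge0 andbT; apply/ler_addgt0Pr => e e0; rewrite add0r.
have [N hN] := geometric_small (C + t * C + nrm u) t0 t1 e0.
apply: le_trans hN; set S := \sum_(0 <= k < N) iter k A u.
(* The partial sums of the Neumann series telescope under 1 - A. *)
have SE : S - A S = u - iter N A u.
  rewrite /S; elim: N {S} => [|N ih]; first by rewrite !big_geq// bv_linear0// !subrr.
  by rewrite !big_nat_recr//= bv_linearD// opprD addrACA ih addrA subrK.
have -> : v - A v - u = (v - S) + (- (A (v - S)) + - iter N A u).
  rewrite (bv_linearD _ _ lA) (bv_linearN _ lA).
  have uE : u = S - A S + iter N A u by rewrite SE subrK.
  by rewrite {1}uE !opprD !opprK !addrA (addrAC v).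
have h1 := vC N; have h2 := bA (v - S); have h3 := bk N.
apply: le_trans (nrmD _ _) _; apply: le_trans (lerD (lexx _) (nrmD _ _)) _.
rewrite !nrmN; have : t * nrm (v - S) <= t * (C * t ^+ N) by rewrite ler_wpM2l// ltW.
by rewrite -/S in h1; lra.
Qed.

Lemma bv_inverse A t (m : R[i]) : bv_linear A -> 0 < t -> t < 1 -> m != 0 ->
    (forall u, nrm (A u) <= t * normc m * nrm u) ->
  exists G, [/\ bv_linear G, bv_bounded G, forall u, m *: G u - A (G u) = u &
    forall u, G (m *: u - A u) = u].
Proof.
move=> lA t0 t1 m0 bA.
have nm0 : 0 < normc m.
  rewrite lt_neqAle normc_ge0 andbT eq_sym; apply: contra_neq m0; exact: eq0_normc.
have ex u : exists v, m *: v - A v = u.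
  have lA' : bv_linear (fun w => m^-1 *: A w).
    by move=> a v w; rewrite lA scalerDr scalerA mulrC -scalerA.
  have bA' w : nrm (m^-1 *: A w) <= t * nrm w.
    rewrite nrmZ normcV; apply: (@le_trans _ _ ((normc m)^-1 * (t * normc m * nrm w))).
      by rewrite ler_wpM2l ?invr_ge0 ?normc_ge0.
    by rewrite le_eqVlt; apply/orP; left; apply/eqP; field; rewrite gt_eqF.
  have [v hv] := bv_neumann (m^-1 *: u) lA' t0 t1 bA'.
  exists v; rewrite -[u](scalerKV m0) -hv scalerBr scalerKV//.
have [G hG] := boolp.choice ex.
(* Injectivity makes the chosen inverse linear and two-sided. *)
have inj v w : m *: v - A v = m *: w - A w -> v = w.
  move=> h; apply/eqP; rewrite -subr_eq0; apply/eqP/nrm_eq0/eqP.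
  have e : m *: (v - w) = A (v - w).
    rewrite scalerBr (bv_linearD _ _ lA) (bv_linearN _ lA).
    move/eqP: h; rewrite subr_eq => /eqP ->.
    by rewrite addrAC [_ - A w - _]addrAC subrr add0r addrC.
  have := bA (v - w); rewrite -e nrmZ => h'.
  have n0 := nrm_ge0 (v - w); rewrite eq_le n0 andbT.
  have : normc m * (1 - t) * nrm (v - w) <= 0 by lra.
  by rewrite pmulr_rle0// mulr_gt0// subr_gt0.
exists G; split => //.
- move=> a u v; apply: inj; rewrite hG scalerDr lA opprD addrACA hG.
  by rewrite scalerA mulrC -scalerA -scalerBr hG.
- have d0 : 0 < normc m * (1 - t) by rewrite mulr_gt0// subr_gt0.
  exists (normc m * (1 - t))^-1; first by rewrite invr_ge0 ltW.
  move=> u; rewrite -(ler_pM2l d0) mulrA divff ?gt_eqF// mul1r.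
  have h1 : nrm (m *: G u) <= nrm u + nrm (A (G u)).
    by rewrite -{2}(hG u); apply: le_trans (nrmD _ _); rewrite subrK.
  by rewrite nrmZ in h1; have := bA (G u); lra.
- by move=> u; apply: inj; rewrite hG.
Qed.

Lemma iter_bv_linear T r : bv_linear T -> bv_linear (iter r T).
Proof. by move=> lT; elim: r => [//|r ih] a u v; rewrite !iterS ih lT. Qed.

(** P is the sum of lambda^(r-1-j) T^j over j < r, so that lambda - T divides
    lambda^r - T^r on both sides. *)
Lemma power_quotient T lambda r : bv_linear T -> bv_bounded T ->
  exists P, [/\ bv_linear P, bv_bounded P,
    forall u, lambda *: P u - T (P u) = lambda ^+ r *: u - iter r T u &
    forall u, P (lambda *: u - T u) = lambda ^+ r *: u - iter r T u].
Proof.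
move=> lT bT; elim: r => [|r [P [lP bP h1 h2]]].
  exists (fun _ => 0); split.
  - by move=> a u v; rewrite scaler0 addr0.
  - by exists 0 => // u; rewrite mul0r -[0](scale0r (0 : B)) nrmZ normc0 mul0r.
  - by move=> u; rewrite scaler0 bv_linear0// subr0 expr0 scale1r subrr.
  - by move=> u; rewrite expr0 scale1r subrr.
have lX u v : T (u - v) = T u - T v by rewrite (bv_linearD _ _ lT) (bv_linearN _ lT).
exists (fun u => lambda ^+ r *: u + T (P u)); split.
- move=> a u v; rewrite lP lT scalerDr scalerA mulrC -scalerA addrACA.
  by rewrite -scalerDr.
- exact: (bv_bounded_lin _ bv_bounded_id (bv_bounded_comp bT bP)).
- move=> u; rewrite scalerDr scalerA -exprS -(bv_linearZ lambda (P u) lT)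
    (bv_linearD _ _ lT) opprD addrACA -(lX (lambda *: P u)) h1 lX.
  rewrite (bv_linearZ _ _ lT) iterS addrA; congr (_ - _).
  by rewrite subrK.
- move=> u; rewrite h2 lX (bv_linearZ _ _ lT) scalerBr scalerA -exprSr addrA.
  by rewrite subrK iterS.
Qed.

(** If T^r is a finite-rank perturbation of an operator A that is small compared
    with lambda^r, then P (lambda^r - A)^-1 and (lambda^r - A)^-1 P are a right
    and a left inverse of lambda - T modulo finite rank, hence they agree modulo
    finite rank. *)
Lemma parametrix (T : {linear B -> B}) A K lambda r t : bv_bounded T ->
    bv_linear A -> finite_rank K -> bv_linear K ->
    (forall u, iter r T u = A u + K u) ->
    lambda != 0 -> 0 < t -> t < 1 ->
    (forall u, nrm (A u) <= t * normc (lambda ^+ r) * nrm u) ->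
  calkin_resolvent T lambda.
Proof.
move=> bT lA fK lK TAK l0 t0 t1 bA.
have lT := bv_linearP T.
have lr0 : lambda ^+ r != 0 by rewrite expf_neq0.
have [G [lG bG hG Gh]] := bv_inverse lA t0 t1 lr0 bA.
have [P [lP bP hP Ph]] := power_quotient lambda r lT bT.
have [S SE] := bv_linear_pack (bv_linear_comp lP lG).
have bS : bv_bounded S by rewrite -SE; exact: bv_bounded_comp.
pose res u := lambda *: u - T u.
have bres : bv_bounded res.
  have bNT : bv_bounded (fun u => - T u).
    by have [C C0 h] := bT; exists C => // u; rewrite nrmN.
  exact: (bv_bounded_lin lambda bv_bounded_id bNT).
have lres : bv_linear res.
  move=> a u v; rewrite /res lT scalerDr opprD addrACA; congr (_ + _).
  by rewrite scalerBr !scalerA mulrC.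
have SuE u : S u = P (G u) by rewrite -SE.
have right u : res (S u) = u - K (G u).
  by rewrite /res SuE hP TAK opprD addrA hG.
have left u : G (P (res u)) = u - G (K u).
  by rewrite /res Ph TAK opprD addrA (bv_linearD _ _ lG) Gh (bv_linearN _ lG).
(* The right inverse S = P G is compared with the left inverse G P through
   S = (G P res + G K) S and res S = 1 - K G, where res = lambda - T. *)
have SG u : S u = G (P u) - G (P (K (G u))) + G (K (S u)).
  have := left (S u); rewrite right.
  rewrite (bv_linearD _ _ lP) (bv_linearN _ lP) (bv_linearD _ _ lG) (bv_linearN _ lG).
  by move=> ->; rewrite subrK.
exists S; split; first exact: bv_bounded_continuous.
- apply: finite_rank_compact.
  rewrite (_ : (fun _ => _) = fun u => - G (K u) + (- G (P (K (G (res u)))) + G (K (S (res u))))).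
    apply: finite_rankD; first exact/finite_rankN/finite_rank_compl.
    apply: finite_rankD.
      apply: finite_rankN; apply: (finite_rank_compl lG); apply: (finite_rank_compl lP).
      exact: (finite_rank_compr (bv_bounded_comp bG bres) fK).
    apply: (finite_rank_compl lG).
    exact: (finite_rank_compr (bv_bounded_comp bS bres) fK).
  apply/funext => u; rewrite -/(res u) {1}SG left.
  by rewrite [LHS]addrC !addrA addNr add0r.
- apply: finite_rank_compact.
  rewrite (_ : (fun _ => _) = fun u => - K (G u)).
    by apply: finite_rankN; exact: (finite_rank_compr bG fK).
  by apply/funext => u; rewrite -/(res (S u)) right addrAC subrr add0r.
Qed.

End Parametrix.

(** * Approximation by averages over a uniform partition *)

Section Averages.
Context {R : realType}.

Local Notation B := (bv_space R).
Local Notation mu := (@lebesgue_measure R).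
Local Notation I := (@unit_itv R).
Implicit Types (u v w : B) (V : R) (f g : R -> R[i]) (j : nat).

Lemma inL1_integrable f : inL1 f ->
  mu.-integrable I (fun x => (complex.Re (f x))%:E) /\
  mu.-integrable I (fun x => (complex.Im (f x))%:E).
Proof.
move=> [mr mi f1]; have mI := @measurable_unit_itv R.
have iN : mu.-integrable I (fun x => (normc (f x))%:E).
  apply/integrableP; split; first by apply/measurable_EFinP; exact: measurable_normc.
  by under eq_integral do rewrite gee0_abs ?lee_fin ?normc_ge0//.
split; apply: (@le_integrable _ _ _ mu I mI _ _ _ _ iN); try exact/measurable_EFinP.
  by move=> x _; rewrite /= lee_fin [leRHS]ger0_norm ?normc_ge0// abs_Re_le_normc.
by move=> x _; rewrite /= lee_fin [leRHS]ger0_norm ?normc_ge0// abs_Im_le_normc.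
Qed.

Lemma Re_lin (a z w : R[i]) : complex.Re (a * z + w) =
  complex.Re a * complex.Re z + (- complex.Im a) * complex.Im z + complex.Re w.
Proof. by case: a z w => ? ? [? ?] [? ?] /=; rewrite mulNr. Qed.

Lemma Im_lin (a z w : R[i]) : complex.Im (a * z + w) =
  complex.Re a * complex.Im z + complex.Im a * complex.Re z + complex.Im w.
Proof. by case: a z w => ? ? [? ?] [? ?]. Qed.

Variable m : nat.
Hypothesis m0 : (0 < m)%N.

Let mR : 0 < m%:R :> R. Proof. by rewrite ltr0n. Qed.

Definition cell_left j : R := j%:R / m%:R.

(** Open, unlike the half-open cells of the step functions, so that it is contained
    in (0, 1) also for j = 0. *)
Definition cell_itv j : set R := `]cell_left j, cell_left j.+1[%classic.

Lemma cell_itv_unit j : (j < m)%N -> cell_itv j `<=` I.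
Proof.
move=> jm x; rewrite /cell_itv /= in_itv/= => /andP[x1 x2]; apply/unit_itvP.
apply/andP; split; first by apply: le_lt_trans x1; rewrite divr_ge0.
by apply: lt_le_trans x2 _; rewrite ler_pdivrMr// mul1r ler_nat.
Qed.

Lemma cell_itv_measure j : mu (cell_itv j) = (m%:R^-1)%:E.
Proof.
rewrite /cell_itv lebesgue_measure_itv/= lte_fin /cell_left ltr_pM2r ?invr_gt0//.
rewrite ltr_nat ltnSn -EFinB -mulrBl -natrB// subSnn mul1r.
by [].
Qed.

Let mJ j : measurable (cell_itv j). Proof. exact: measurable_itv. Qed.

Definition cell_integral j f : R[i] :=
  (\int[mu]_(x in cell_itv j) complex.Re (f x)) +i*
  (\int[mu]_(x in cell_itv j) complex.Im (f x)).

Definition cell_average j f : R[i] := m%:R%:C * cell_integral j f.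

Lemma inL1_integrable_cell j f : (j < m)%N -> inL1 f ->
  mu.-integrable (cell_itv j) (EFin \o (fun x => complex.Re (f x))) /\
  mu.-integrable (cell_itv j) (EFin \o (fun x => complex.Im (f x))).
Proof.
move=> jm /inL1_integrable[h1 h2]; have mI := @measurable_unit_itv R.
split.
  by apply: (@integrableS _ _ _ mu I) h1 => //; [exact: mJ|exact: cell_itv_unit].
by apply: (@integrableS _ _ _ mu I) h2 => //; [exact: mJ|exact: cell_itv_unit].
Qed.

Lemma cell_average_lin j (a : R[i]) f g : (j < m)%N -> inL1 f -> inL1 g ->
  cell_average j (a *: f + g)%R = a * cell_average j f + cell_average j g.
Proof.
move=> jm fL gL; have [fr fi] := inL1_integrable_cell jm fL.
have [gr gi] := inL1_integrable_cell jm gL.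
have iZ (c : R) (p : R -> R) : mu.-integrable (cell_itv j) (EFin \o p) ->
    mu.-integrable (cell_itv j) (EFin \o (fun x => c * p x)).
  move=> ip; rewrite (_ : EFin \o _ = fun x => (c%:E * (EFin \o p) x)%E).
    by apply: integrableZl => //; exact: mJ.
  by apply/funext => x /=; rewrite EFinM.
have iD (p r : R -> R) : mu.-integrable (cell_itv j) (EFin \o p) ->
    mu.-integrable (cell_itv j) (EFin \o r) ->
    mu.-integrable (cell_itv j) (EFin \o (fun x => p x + r x)).
  move=> ip ir; rewrite (_ : EFin \o _ = (EFin \o p) \+ (EFin \o r))%E.
    by apply: integrableD => //; exact: mJ.
  by apply/funext => x /=; rewrite EFinD.
have lin (c d : R) (p r s : R -> R) : mu.-integrable (cell_itv j) (EFin \o p) ->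
    mu.-integrable (cell_itv j) (EFin \o r) -> mu.-integrable (cell_itv j) (EFin \o s) ->
    \int[mu]_(x in cell_itv j) (c * p x + d * r x + s x) =
    c * \int[mu]_(x in cell_itv j) p x + d * \int[mu]_(x in cell_itv j) r x +
    \int[mu]_(x in cell_itv j) s x.
  move=> ip ir is'; rewrite RintegralD; [|exact: mJ|by apply: iD; exact: iZ|by []].
  rewrite RintegralD; [|exact: mJ|exact: iZ|exact: iZ].
  by rewrite !RintegralZl//; exact: mJ.
rewrite /cell_average mulrCA -mulrDr; congr (_ * _); apply/eqP.
rewrite eq_complex; apply/andP; split; apply/eqP; rewrite ?Re_lin ?Im_lin /=.
  by under eq_Rintegral do rewrite Re_lin; exact: lin.
by under eq_Rintegral do rewrite Im_lin; exact: lin.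
Qed.

Lemma cell_average_ae j f g : (j < m)%N -> inL1 f -> inL1 g -> ae_eq mu I f g ->
  cell_average j f = cell_average j g.
Proof.
move=> jm [frm fim _] [grm gim _] fg; have mI := @measurable_unit_itv R.
have sub (p : R -> R) : measurable_fun I p -> measurable_fun (cell_itv j) (EFin \o p).
  move=> mp; apply/measurable_EFinP; exact: (measurable_funS mI (cell_itv_unit jm) mp).
have aeJ (p : R[i] -> R) : ae_eq mu (cell_itv j) (EFin \o (p \o f)) (EFin \o (p \o g)).
  by apply: filterS fg => x + xJ => /(_ (cell_itv_unit jm xJ)) /= ->.
rewrite /cell_average; congr (_ * _); rewrite /cell_integral /Rintegral.
congr (fine _ +i* fine _).
  exact: (ae_eq_integral (mu := mu) _ _ (mJ j) (sub _ frm) (sub _ grm) (aeJ (@complex.Re R))).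
exact: (ae_eq_integral (mu := mu) _ _ (mJ j) (sub _ fim) (sub _ gim) (aeJ (@complex.Im R))).
Qed.

(** The factor 2 comes from treating the real and imaginary parts separately. *)
Lemma cell_average_near j f (c : R[i]) (d : R) : (j < m)%N -> inL1 f -> 0 <= d ->
    {ae mu, forall y, cell_itv j y -> normc (f y - c) <= d} ->
  normc (cell_average j f - c) <= 2 * d.
Proof.
move=> jm fL d0 fc; have [fr fi] := inL1_integrable_cell jm fL.
have mJm : fine (mu (cell_itv j)) = m%:R^-1 by rewrite cell_itv_measure.
have ic (k : R) : mu.-integrable (cell_itv j) (EFin \o cst k).
  apply/integrableP; split; first exact/measurable_EFinP/measurable_cst.
  rewrite (_ : (\int[mu]_(x in _) _)%E = (\int[mu]_(x in cell_itv j) cst `|k|%:E x)%E)//.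
  by rewrite integral_cst ?[X in (_ * X)%E]cell_itv_measure ?ltry//; exact: mJ.
have one (p : R[i] -> R) (k : R) :
    mu.-integrable (cell_itv j) (EFin \o (fun x => p (f x))) ->
    {ae mu, forall y, cell_itv j y -> `|p (f y) - k| <= d} ->
    `|m%:R * (\int[mu]_(x in cell_itv j) p (f x)) - k| <= d.
  move=> ip pk.
  have iB : mu.-integrable (cell_itv j) (EFin \o (fun x => p (f x) - k)).
    rewrite (_ : EFin \o _ = (EFin \o (fun x => p (f x))) \- (EFin \o cst k))%E.
      by apply: integrableB => //; exact: mJ.
    by apply/funext => x /=; rewrite EFinB.
  have -> : m%:R * (\int[mu]_(x in cell_itv j) p (f x)) - k =
      m%:R * (\int[mu]_(x in cell_itv j) (p (f x) - k)).
    rewrite RintegralB; [|exact: mJ|exact: ip|exact: ic].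
    rewrite Rintegral_cst; last exact: mJ.
    by rewrite [fine _]mJm mulrBr mulrCA divff ?mulr1// gt_eqF.
  rewrite normrM ger0_norm// -ler_pdivlMl// mulrC.
  rewrite -lee_fin EFin_normr_Rintegral//; last exact: mJ.
  have mB := (integrableP _ _ _ iB).1.
  apply: le_trans (le_abse_integral mu (mJ j) mB) _.
  apply: (@le_trans _ _ (\int[mu]_(x in cell_itv j) (cst d%:E) x)%E); last first.
    rewrite integral_cst; last exact: mJ.
    by rewrite [X in (_ * X)%E]cell_itv_measure -EFinM lee_fin mulrC.
  apply: ae_ge0_le_integral => //.
  - exact: mJ.
  - exact: measurableT_comp.
have aeS (P Q : R -> Prop) : (forall y, P y -> Q y) ->
    {ae mu, forall y, P y} -> {ae mu, forall y, Q y}.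
  by move=> PQ; apply: negligibleS; apply: subsetC.
have hRe := one (@complex.Re R) (complex.Re c) fr.
have hIm := one (@complex.Im R) (complex.Im c) fi.
apply: le_trans (normc_le_ReIm _) _; rewrite mulr_natl mulr2n; apply: lerD.
  rewrite (_ : complex.Re _ = m%:R * (\int[mu]_(x in cell_itv j) complex.Re (f x)) - complex.Re c).
    apply: hRe; apply: aeS fc => y + yJ => /(_ yJ); apply: le_trans.
    by rewrite -ReB abs_Re_le_normc.
  by rewrite ReB /cell_average /cell_integral /= mul0r subr0.
rewrite (_ : complex.Im _ = m%:R * (\int[mu]_(x in cell_itv j) complex.Im (f x)) - complex.Im c).
  apply: hIm; apply: aeS fc => y + yJ => /(_ yJ); apply: le_trans.
  by rewrite -ImB abs_Im_le_normc.
by rewrite ImB /cell_average /cell_integral /= mul0r addr0.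
Qed.

Lemma normc_cell_average_le j f : (j < m)%N -> inL1 f ->
  normc (cell_average j f) <= 2 * m%:R * fine (norm1 f).
Proof.
move=> jm fL; have [fr fi] := inL1_integrable_cell jm fL.
have [mr mi _] := fL; have mn := measurable_normc mr mi.
have f1fin : norm1 f \is a fin_num by rewrite ge0_fin_numE ?norm1_ge0//; case: fL.
have mI := @measurable_unit_itv R.
have one (p : R[i] -> R) : (forall z, `|p z| <= normc z) ->
    mu.-integrable (cell_itv j) (EFin \o (fun x => p (f x))) ->
    `|\int[mu]_(x in cell_itv j) p (f x)| <= fine (norm1 f).
  move=> pz ip; have mp := (integrableP _ _ _ ip).1.
  rewrite -lee_fin EFin_normr_Rintegral//; last exact: mJ.
  rewrite fineK//; apply: le_trans (le_abse_integral mu (mJ j) mp) _.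
  apply: (@le_trans _ _ (\int[mu]_(x in cell_itv j) (normc (f x))%:E)%E).
    apply: ge0_le_integral => //.
    - exact: mJ.
    - exact: measurableT_comp.
    - by apply/measurable_EFinP; exact: (measurable_funS mI (cell_itv_unit jm) mn).
    - by move=> x _; rewrite /= lee_fin.
  apply: ge0_subset_integral => //; [exact: mJ|exact/measurable_EFinP| |exact: cell_itv_unit].
  by move=> x _; rewrite lee_fin normc_ge0.
have hRe := one _ (@abs_Re_le_normc R) fr.
have hIm := one _ (@abs_Im_le_normc R) fi.
rewrite normcM normcR ger0_norm// mulrAC mulrC ler_wpM2r//.
by apply: le_trans (normc_le_ReIm _) _ => /=; rewrite mulr_natl mulr2n lerD.
Qed.

End Averages.

Section StepProjection.
Context {R : realType}.

Local Notation B := (bv_space R).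
Local Notation mu := (@lebesgue_measure R).
Local Notation I := (@unit_itv R).
Implicit Types (u v w : B) (V x y : R) (f g : R -> R[i]) (j : nat).

Variable m : nat.
Hypothesis m0 : (0 < m)%N.

Let mR : 0 < m%:R :> R. Proof. by rewrite ltr0n. Qed.

Local Notation left_ := (@cell_left R m).

(** Half-open, so that every point of (0, 1) lies in exactly one cell. *)
Definition cell j x : bool := (left_ j <= x) && (x < left_ j.+1).

Definition cell_index x : nat := Num.truncn (m%:R * x).

Lemma cellE j x : 0 <= x -> cell j x = (j == cell_index x).
Proof.
move=> x0; rewrite /cell /cell_left ler_pdivrMr// ltr_pdivlMr// ![x * _]mulrC.
have mx0 : 0 <= m%:R * x by rewrite mulr_ge0// ltW.
have /andP[h1 h2] := truncn_itv mx0; rewrite -/(cell_index x) in h1 h2.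
apply/andP/eqP => [[h3 h4]|->//].
apply/eqP; rewrite eqn_leq -ltnS -(ltr_nat R) (le_lt_trans h3 h2)/=.
by rewrite -ltnS -(ltr_nat R) (le_lt_trans h1 h4).
Qed.

Lemma cell_index_lt x : I x -> (cell_index x < m)%N.
Proof.
move=> /unit_itvP/andP[/ltW x0 x1]; have mx0 : 0 <= m%:R * x by rewrite mulr_ge0// ltW.
have /andP[h1 _] := truncn_itv mx0; rewrite -(ltr_nat R); apply: le_lt_trans h1 _.
by rewrite gtr_pMr.
Qed.

Lemma cell_index_bounds x : I x -> left_ (cell_index x) <= x < left_ (cell_index x).+1.
Proof.
by move=> /unit_itvP/andP[/ltW x0 _]; have := cellE (cell_index x) x0; rewrite eqxx.
Qed.

Lemma cell_index_le x y : x <= y -> (cell_index x <= cell_index y)%N.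
Proof. by move=> xy; apply: le_truncn; rewrite ler_pM2l. Qed.

Lemma cell_left_le i j : (i <= j)%N -> left_ i <= left_ j.
Proof. by move=> ij; rewrite /cell_left ler_pM2r ?invr_gt0// ler_nat. Qed.

Definition cell_fun j x : R[i] := if cell j x then 1 else 0.

Lemma measurable_cell j : measurable [set x | cell j x].
Proof.
rewrite (_ : [set x | cell j x] = `[left_ j, left_ j.+1[%classic)//.
Qed.

Lemma cell_fun_inBV j : inBV (cell_fun j).
Proof.
have ReE x : complex.Re (cell_fun j x) = \1_[set x | cell j x] x.
  rewrite /cell_fun indicE; case: (boolP (cell j x)) => h; first by rewrite mem_set.
  by rewrite memNset//; exact/negP.
have ImE x : complex.Im (cell_fun j x) = 0.
  by rewrite /cell_fun; case: (cell j x).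
have mr : measurable_fun I (fun x => complex.Re (cell_fun j x)).
  under eq_fun do rewrite ReE.
  by apply: measurable_indic; exact: measurable_cell.
have mi : measurable_fun I (fun x => complex.Im (cell_fun j x)).
  by under eq_fun do rewrite ImE; exact: measurable_cst.
split.
  split => //; apply: (@le_lt_trans _ _ 1%:E); last exact: ltry.
  apply: (norm1_sup_le mr mi (ae_eq_refl _ _ _)) => x _.
  by rewrite /cell_fun; case: (cell j x); rewrite ?normc1 ?normc0.
apply: (@le_lt_trans _ _ 2%:E); last exact: ltry.
apply: le_trans (Var_le_pointwise _) _.
pose Phi x : R := (if left_ j <= x then 1 else 0) + (if left_ j.+1 <= x then 1 else 0).
have n11 : normc (1 - 1 : R[i]) = 0 by rewrite subrr normc0.
have n10 : normc (1 - 0 : R[i]) = 1 by rewrite subr0 normc1.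
have n01 : normc (0 - 1 : R[i]) = 1 by rewrite sub0r normcN normc1.
have n00 : normc (0 - 0 : R[i]) = 0 by rewrite subr0 normc0.
apply: (pointwise_var_dominated (Phi := Phi)) => //.
- move=> x y _ _ xy; have ll := cell_left_le (leqnSn j).
  rewrite /cell_fun /cell /Phi.
  have [h1|h1] := leP (left_ j) x; have [h2|h2] := leP (left_ j.+1) x => /=;
  have [h3|h3] := leP (left_ j) y; have [h4|h4] := leP (left_ j.+1) y => /=;
  rewrite ?n11 ?n10 ?n01 ?n00; lra.
- move=> x y _ _; rewrite /Phi.
  by case: (left_ j <= y); case: (left_ j.+1 <= y); case: (left_ j <= x);
    case: (left_ j.+1 <= x) => /=; lra.
Qed.

Definition cell_bv j : bv_fun R :=
  BVFun (introT (asboolP _) (cell_fun_inBV j) : cell_fun j \in BVpred).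

Definition step_fun f : bv_fun R := \sum_(j < m) cell_average m j f *: cell_bv j.

Definition step_op u : B := \sum_(j < m) cell_average m j (repr u) *: bv_class (cell_bv j).

Lemma bv_class_ord_sum (F : 'I_m -> bv_fun R) :
  \sum_(j < m) bv_class (F j) = bv_class (\sum_(j < m) F j).
Proof.
apply/esym/(big_morph (@bv_class R) (@bv_classD R)).
by rewrite /bv_class !piE.
Qed.

Lemma step_opE u : step_op u = bv_class (step_fun (repr u)).
Proof.
by rewrite /step_fun -bv_class_ord_sum; apply: eq_bigr => j _; rewrite bv_classZ.
Qed.

Lemma step_funE f x : I x -> bv_val (step_fun f) x = cell_average m (cell_index x) f.
Proof.
move=> xI; have -> : bv_val (step_fun f) x =
    \sum_(j < m) cell_average m j f * cell_fun j x.
  rewrite /step_fun; elim/big_ind2: _ => [//|F1 z1 F2 z2 <- <- //|//].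
have jm := cell_index_lt xI; rewrite (bigD1 (Ordinal jm))//= big1 ?addr0.
  have /unit_itvP/andP[/ltW x0 _] := xI.
  by rewrite /cell_fun cellE// eqxx mulr1.
move=> i; rewrite -val_eqE /= => ij; have /unit_itvP/andP[/ltW x0 _] := xI.
by rewrite /cell_fun cellE// (negbTE ij) mulr0.
Qed.

Lemma step_op_linear : bv_linear step_op.
Proof.
move=> a u v; rewrite /step_op scaler_sumr -big_split/=; apply: eq_bigr => j _.
have [uL _] := bv_fun_inBV (repr u); have [vL _] := bv_fun_inBV (repr v).
have [wL _] := bv_fun_inBV (repr (a *: u + v)).
have e : ae_eq mu I (repr (a *: u + v)) (a *: bv_val (repr u) + bv_val (repr v))%R.
  rewrite -{1}(bv_classK u) -{1}(bv_classK v) -bv_classZ -bv_classD.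
  exact: repr_ae.
rewrite (cell_average_ae m0 (ltn_ord j) wL _ e); last exact: inL1_lin.
by rewrite cell_average_lin// scalerDl scalerA.
Qed.

Lemma step_op_finite_rank : finite_rank step_op.
Proof.
have -> : step_op = fun u => \sum_(j <- enum 'I_m) cell_average m j (repr u) *: bv_class (cell_bv j).
  by apply/funext => u; rewrite /step_op big_enum.
apply: (@finite_rank_sum _ _ _ (fun (j : 'I_m) u => cell_average m j (repr u))) => j.
exists (2 * m%:R); first by rewrite mulr_ge0// ltW.
move=> u; have [uL _] := bv_fun_inBV (repr u).
apply: le_trans (normc_cell_average_le m0 (ltn_ord j) uL) _.
rewrite ler_wpM2l ?mulr_ge0 ?(ltW mR)// /nrm lerDl; exact: bv_var_ge0.
Qed.

Section Estimates.
Variables (f g : R -> R[i]) (V : R) (phi : R -> R).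
Hypotheses (fL : inL1 f) (fg : ae_eq mu I f g).
Hypotheses (phim : {homo phi : x y / x <= y}) (phi0 : forall x, 0 <= phi x <= V).
Hypothesis gphi : dominated g phi.

Let osc j := phi (left_ j.+1) - phi (left_ j).

Let osc0 j : 0 <= osc j.
Proof. by rewrite subr_ge0; apply: phim; exact: cell_left_le. Qed.

Lemma step_fun_near x : I x ->
  normc (g x - bv_val (step_fun f) x) <= 2 * osc (cell_index x).
Proof.
move=> xI; have jm := cell_index_lt xI; set j := cell_index x in jm *.
have /andP[x1 x2] := cell_index_bounds xI.
rewrite step_funE// normcB; apply: cell_average_near => //.
have sub := @cell_itv_unit R m m0 j jm.
apply: negligibleS fg; apply: subsetC => y /= fgy yJ.
have yI := sub _ yJ; rewrite fgy//.
move: yJ; rewrite /cell_itv /= in_itv/= => /andP[/ltW y1 /ltW y2].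
have a1 := phim x1; have a2 := phim (ltW x2); have a3 := phim y1; have a4 := phim y2.
rewrite /osc; have [h|/ltW h] := leP x y.
  by have := gphi xI yI h; rewrite /j; lra.
by have := gphi yI xI h; rewrite normcB /j; lra.
Qed.

Lemma step_fun_var :
  (pointwise_var (fun x => (g x - bv_val (step_fun f) x)%R) <= (5 * V)%:E)%E.
Proof.
(* Within a cell only g varies. For cells i < j the bound 2 osc i + 2 osc j
   is at most the increment of 2 (phi (right end) + phi (left end)), because the
   right end of cell i does not exceed the left end of cell j. *)
pose Phi x := phi x + 2 * (phi (left_ (cell_index x).+1) + phi (left_ (cell_index x))).
apply: (pointwise_var_dominated (Phi := Phi)).
- move=> x y xI yI xy; have := cell_index_le xy; rewrite leq_eqVlt => /predU1P[e|ij].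
    rewrite /Phi -e !step_funE// -e.
    have := gphi xI yI xy; set A := cell_average _ _ _.
    have -> : g y - A - (g x - A) = g y - g x by ring.
    by lra.
  apply: le_trans (le_normcD _ _) _; rewrite normcN.
  have h1 := step_fun_near xI; have h2 := step_fun_near yI.
  have h3 : phi (left_ (cell_index x).+1) <= phi (left_ (cell_index y)).
    by apply: phim; exact: cell_left_le.
  have h4 := phim xy.
  by rewrite /osc in h1 h2; rewrite /Phi; lra.
- by have /andP[a b] := phi0 0; rewrite mulr_ge0//; exact: le_trans b.
- move=> x y _ _; rewrite /Phi.
  have := phi0 x; have := phi0 y.
  have := phi0 (left_ (cell_index x).+1); have := phi0 (left_ (cell_index x)).
  have := phi0 (left_ (cell_index y).+1); have := phi0 (left_ (cell_index y)).
  by lra.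
Qed.

Lemma step_fun_norm1 :
  (norm1 (fun x => (f x - bv_val (step_fun f) x)%R) <= (2 * V / m%:R)%:E)%E.
Proof.
have mI := @measurable_unit_itv R.
have [[sr si _] _] := bv_fun_inBV (step_fun f).
have dL : inL1 (fun x => f x - bv_val (step_fun f) x).
  have sL : inL1 (step_fun f) by have [] := bv_fun_inBV (step_fun f).
  rewrite (_ : (fun x => _) = ((-1) *: bv_val (step_fun f) + f)%R).
    exact: inL1_lin.
  by apply/funext => x; rewrite !fctE scaleN1r addrC.
have [dr di _] := dL.
have mc j : measurable_fun I (fun x => ((2 * osc j) * \1_[set x | cell j x] x)%:E).
  apply/measurable_EFinP; apply: measurable_funM; first exact: measurable_cst.
  by apply: measurable_indic; exact: measurable_cell.
have c0 j x : (0 <= ((2 * osc j) * \1_[set x | cell j x] x)%:E)%E.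
  by rewrite lee_fin mulr_ge0// mulr_ge0.
apply: (@le_trans _ _ (\int[mu]_(x in I) (\sum_(j <- iota 0 m)
    ((2 * osc j) * \1_[set x | cell j x] x)%:E))%E).
  apply: ae_ge0_le_integral => //.
  - by move=> x _; rewrite lee_fin normc_ge0.
  - by apply/measurable_EFinP; exact: measurable_normc.
  - by move=> x _; apply: sume_ge0.
  - exact: emeasurable_sum.
  - apply: filterS fg => x fgx xI; rewrite fgx//.
    have jm := cell_index_lt xI.
    rewrite (bigD1_seq (cell_index x)) ?mem_iota ?iota_uniq//=.
    apply: (@le_trans _ _ ((2 * osc (cell_index x)) *
        \1_[set x0 | cell (cell_index x) x0] x)%:E); last by rewrite leeDl// sume_ge0.
    rewrite lee_fin indicE mem_set ?mulr1; first exact: step_fun_near.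
    by have /unit_itvP/andP[/ltW x0 _] := xI; rewrite /= cellE.
rewrite ge0_integral_sum//.
apply: (@le_trans _ _ (\sum_(j <- iota 0 m) ((2 * osc j) / m%:R)%:E)%E).
  apply: lee_sum => j _; rewrite EFinM.
  under eq_integral do rewrite EFinM.
  rewrite ge0_integralZl_EFin//; first last.
  - by rewrite mulr_ge0.
  - by apply/measurable_EFinP; apply: measurable_indic; exact: measurable_cell.
  apply: lee_wpmul2l; first by rewrite lee_fin mulr_ge0.
  rewrite integral_indic//; last exact: measurable_cell.
  have -> : (m%:R^-1)%:E = mu (`[left_ j, left_ j.+1[%classic : set R).
    rewrite lebesgue_measure_itv/= lte_fin /cell_left ltr_pM2r ?invr_gt0//.
    by rewrite ltr_nat ltnSn -EFinB -mulrBl -natrB// subSnn mul1r.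
  apply: le_measure; rewrite ?inE//.
  by apply: measurableI => //; exact: measurable_cell.
rewrite sumEFin lee_fin -mulr_suml -mulr_sumr ler_pM2r ?invr_gt0// ler_pM2l//.
rewrite -[m in iota 0 m]subn0 -/(index_iota 0 m) telescope_sumr//.
have /andP[a1 a2] := phi0 (left_ m); have /andP[b1 b2] := phi0 (left_ 0).
by lra.
Qed.

End Estimates.

(** On a cell the average is within twice the oscillation of the dominating
    function there; these oscillations add up to at most the variation, and each is
    integrated over a cell of length 1 / m. *)
Lemma step_op_approx u :
  bv_var (u - step_op u) <= 5 * bv_var u /\
  bv_norm1 (u - step_op u) <= 2 * bv_var u / m%:R.
Proof.
set f := repr u; have [fL fV] := bv_fun_inBV f.
have E : u - step_op u = bv_class ((-1) *: step_fun f + f).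
  by rewrite bv_classD bv_classZ scaleN1r step_opE bv_classK addrC.
set D := (_ + f) in E; have DE : bv_val D = (fun x => f x - bv_val (step_fun f) x).
  apply/funext => x; rewrite [LHS](_ : _ = (-1) *: bv_val (step_fun f) x + f x)//.
  by rewrite scaleN1r addrC.
have main (e : R) : 0 < e ->
    fine (Var D) <= 5 * (bv_var u + e) /\ fine (norm1 D) <= 2 * (bv_var u + e) / m%:R.
  move=> e0; have [_ [g fg <-] gV] := lb_ereal_inf_adherent e0 (Var_fin f).
  have gV' : (pointwise_var g <= (bv_var u + e)%:E)%E.
    by rewrite EFinD fineK ?Var_fin// ltW.
  have [phi [phim phi0 gphi]] := dominating_fun gV'.
  split; rewrite -lee_fin fineK ?Var_fin ?norm1_fin// DE.
    apply: le_trans (step_fun_var fL fg phim phi0 gphi).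
    apply: ereal_inf_lbound; exists (fun x => g x - bv_val (step_fun f) x) => //=.
    by apply: filterS fg => x + xI => /(_ xI) ->.
  exact: (step_fun_norm1 fL fg phim phi0 gphi).
rewrite E bv_var_class bv_norm1_class; split; apply/ler_addgt0Pr => e e0.
  have e5 : 0 < e / 5 by rewrite divr_gt0.
  by have [+ _] := main _ e5; lra.
have e2 : 0 < e * m%:R / 2 by rewrite !divr_gt0// mulr_gt0.
have [_] := main _ e2; rewrite mulrDr mulrDl.
have -> : 2 * (e * m%:R / 2) / m%:R = e by field; rewrite gt_eqF.
by [].
Qed.

End StepProjection.

(** * The essential spectral radius *)

Section EssentialRadius.
Context {R : realType}.

Local Notation B := (bv_space R).
Local Notation mu := (@lebesgue_measure R).
Local Notation I := (@unit_itv R).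
Implicit Types (u v w : B) (theta : R) (lambda : R[i]) (os : seq R[i]) (f g h : R -> R[i]).

(** T^r splits as T^r (1 - E) + T^r E, where E averages over a fine partition:
    the second term has finite rank, and a partition fine enough makes the first
    one as small as 21 theta^r, which is less than half of |lambda|^r once r is
    large. *)
Lemma ess_spectral_radius_le (T : {linear B -> B}) theta : 0 < theta ->
    bv_bounded T -> (forall u, bv_norm1 (T u) <= bv_norm1 u) ->
    (forall r, (0 < r)%N -> exists2 D, 0 <= D & forall u,
      bv_var (iter r T u) <= 4 * theta ^+ r * bv_var u + D * bv_norm1 u) ->
  (ess_spectral_radius T <= theta%:E)%E.
Proof.
move=> th0 bT T1 LY; apply: ge_ereal_sup => _ [lambda nres <-]; rewrite lee_fin.
rewrite leNgt; apply/negP => thl; apply: nres.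
have l0 : 0 < normc lambda by exact: lt_trans thl.
have lne0 : lambda != 0 by apply: contraTneq l0 => ->; rewrite normc0 ltxx.
pose s := theta / normc lambda.
have s0 : 0 < s by rewrite divr_gt0.
have s1 : s < 1 by rewrite ltr_pdivrMr// mul1r.
(* 42 s^r <= 1 makes 21 theta^r at most half of |lambda|^r. *)
have [N sN] := @geometric_small R s 42 1 s0 s1 ltr01.
pose r := N.+1; have [D D0 LYr] := LY r (ltn0Sn N).
have thr : 0 < theta ^+ r by rewrite exprn_gt0.
have thl_r : 21 * theta ^+ r <= 2^-1 * normc (lambda ^+ r).
  have lr0 : 0 < normc lambda ^+ r by rewrite exprn_gt0.
  have : s ^+ r <= s ^+ N by rewrite exprS ler_piMl ?exprn_ge0 ?(ltW s0)// ltW.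
  have -> : theta ^+ r = s ^+ r * normc lambda ^+ r.
    by rewrite -exprMn /s divfK// gt_eqF.
  rewrite normcX => sr; rewrite mulrA ler_pM2r//; lra.
(* With D + 1 for the L1 part of the norm and |u - E u|_1 <= 2 Var u / m, this m
   adds at most theta^r Var u to 4 theta^r Var (u - E u) <= 20 theta^r Var u. *)
pose m := (Num.truncn (2 * (D + 1) / theta ^+ r)).+1.
have m0 : (0 < m)%N by [].
have mR : 0 < m%:R :> R by rewrite ltr0n.
have Dm : 2 * (D + 1) / m%:R <= theta ^+ r.
  by rewrite ler_pdivrMr// [leRHS]mulrC -ler_pdivrMr//; exact/ltW/truncnS_gt.
have lT := bv_linearP T; have lTr := iter_bv_linear r lT.
have lE := @step_op_linear R m m0.
pose A u := iter r T (u - step_op m0 u); pose K u := iter r T (step_op m0 u).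
have lK : bv_linear K by exact: (bv_linear_comp lTr lE).
have lA : bv_linear A.
  move=> a u v; rewrite /A lE -lTr; congr (iter r T _).
  by rewrite opprD addrACA scalerBr.
have half0 : 0 < (2^-1 : R) by rewrite invr_gt0 ltr0n.
have half1 : (2^-1 : R) < 1 by rewrite invf_lt1// ltr1n.
apply: (@parametrix R T A K lambda r 2^-1) => //.
- exact: (finite_rank_compl lTr (step_op_finite_rank m0)).
- move=> u; rewrite /A /K -(bv_linearD _ _ lTr); congr (iter r T _).
  by rewrite subrK.
- move=> u; have [av a1] := step_op_approx m0 u.
  have Tr1 w : bv_norm1 (iter r T w) <= bv_norm1 w.
    by elim: (r) => [//|k ih]; rewrite iterS; apply: le_trans (T1 _) ih.
  have h1 := LYr (u - step_op m0 u); have h2 := Tr1 (u - step_op m0 u).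
  have v0 := bv_var_ge0 u; have n0 := bv_norm1_ge0 u.
  have h3 : 4 * theta ^+ r * bv_var (u - step_op m0 u) <=
      4 * theta ^+ r * (5 * bv_var u).
    by rewrite ler_wpM2l// mulr_ge0// ltW.
  have h4 : (D + 1) * bv_norm1 (u - step_op m0 u) <= theta ^+ r * bv_var u.
    apply: (@le_trans _ _ ((D + 1) * (2 * bv_var u / m%:R))).
      by rewrite ler_wpM2l// addr_ge0.
    rewrite (_ : _ * _ = (2 * (D + 1) / m%:R) * bv_var u); last by ring.
    by rewrite ler_wpM2r.
  have h5 : 21 * theta ^+ r * bv_var u <= 2^-1 * normc (lambda ^+ r) * nrm u.
    apply: (@le_trans _ _ (21 * theta ^+ r * nrm u)).
      by rewrite ler_wpM2l ?mulr_ge0 ?(ltW thr)// /nrm lerDr.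
    by rewrite ler_wpM2r// nrm_ge0.
  by rewrite {1}/nrm /A; lra.
Qed.

Variables (q : R) (q1 : 1 < q).

Let q0 : 0 < q. Proof. exact: lt_trans ltr01 q1. Qed.

Lemma transfer_rev_cat os1 os2 h :
  transfer_rev q (os1 ++ os2) h = transfer_rev q os1 (transfer_rev q os2 h).
Proof. by rewrite /transfer_rev foldr_cat. Qed.

Lemma iter_transfer_rev os N h :
  iter N (transfer_rev q os) h = transfer_rev q (flatten (nseq N os)) h.
Proof. by elim: N => [//|N ih]; rewrite iterS ih -transfer_rev_cat. Qed.

Lemma size_flatten_nseq os N : size (flatten (nseq N os : seq (seq R[i]))) = (size os * N)%N.
Proof. by rewrite size_flatten /shape map_nseq sumn_nseq. Qed.

Lemma unimodular_flatten os N : unimodular os -> unimodular (flatten (nseq N os)).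
Proof.
move=> uos z /flattenP[s]; rewrite mem_nseq => /andP[_ /eqP ->]; exact: uos.
Qed.

Lemma inBV_transfer_rev os f : unimodular os -> inBV f -> inBV (transfer_rev q os f).
Proof.
move=> uos fB; have [fL fV] := fB; have [TL _] := norm1_transfer_rev_le q0 uos fL.
split => //; case: os uos {TL} => [//|omega os] uos.
apply: le_lt_trans (lasota_yorke q1 _ uos fB) _ => //.
have [_ _ f1] := fL; apply: lte_add_pinfty; rewrite lte_mul_pinfty// lee_fin.
  by rewrite mulr_ge0// invr_ge0 exprn_ge0// ltW.
by rewrite divr_ge0// ltW// delta_gt0.
Qed.

Lemma bounded_representative f : inBV f ->
  exists g K, [/\ ae_eq mu I f g, 0 <= K & bounded_by K g].
Proof.
move=> [fL fV]; have Vfin : Var f \is a fin_num by rewrite ge0_fin_numE ?Var_ge0.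
have [_ [g fg <-] gV] := lb_ereal_inf_adherent ltr01 Vfin.
have gV' : (pointwise_var g <= (fine (Var f) + 1)%:E)%E by rewrite EFinD fineK// ltW.
exists g, (fine (Var f) + 1 + fine (norm1 f)); split => //.
  by rewrite !addr_ge0//; apply: fine_ge0; rewrite ?Var_ge0 ?norm1_ge0.
by move=> x xI; exact: bv_sup_le fL fg gV' xI.
Qed.

(** Linearity holds for bounded representatives, hence almost everywhere. *)
Lemma transfer_lin_ae omega (a : R[i]) f g : normc omega = 1 -> inBV f -> inBV g ->
  ae_eq mu I (transfer q omega (a *: f + g)%R)
    (a *: transfer q omega f + transfer q omega g)%R.
Proof.
move=> ow fB gB; have [f' [K [ff' K0 f'K]]] := bounded_representative fB.
have [g' [L [gg' L0 g'L]]] := bounded_representative gB.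
have Tf := transfer_ae omega q0 ff'; have Tg := transfer_ae omega q0 gg'.
have fg : ae_eq mu I (a *: f + g)%R (a *: f' + g')%R.
  by apply: filterS2 ff' gg' => x + + xI => /(_ xI) h1 /(_ xI) h2; rewrite !fctE h1 h2.
have Tfg := transfer_ae omega q0 fg.
have f'M : bounded_by (K + L) f'.
  by move=> x xI; apply: le_trans (f'K x xI) _; rewrite lerDl.
have g'M : bounded_by (K + L) g'.
  by move=> x xI; apply: le_trans (g'L x xI) _; rewrite lerDr.
have KL : 0 <= K + L by rewrite addr_ge0.
apply: (ae_eq_trans Tfg); apply: filterS2 Tf Tg => x + + xI => /(_ xI) h1 /(_ xI) h2.
by rewrite (transfer_lin a q0 ow KL f'M g'M xI) !fctE h1 h2.
Qed.

Lemma transfer_rev_lin_ae os (a : R[i]) f g : unimodular os -> inBV f -> inBV g ->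
  ae_eq mu I (transfer_rev q os (a *: f + g)%R)
    (a *: transfer_rev q os f + transfer_rev q os g)%R.
Proof.
move=> + fB gB; elim: os => [|omega os ih] /=; first by move=> _; exact: ae_eq_refl.
move=> /unimodular_cons[ ow uos].
apply: (ae_eq_trans (transfer_ae omega q0 (ih uos))).
by apply: transfer_lin_ae => //; exact: inBV_transfer_rev.
Qed.

Section BlockOperator.
Variable os : seq R[i].
Hypotheses (uos : unimodular os) (os0 : (0 < size os)%N).

Let inBVF (f : bv_fun R) : transfer_rev q os f \in BVpred.
Proof. by apply/asboolP; apply: inBV_transfer_rev => //; exact: bv_fun_inBV. Qed.

(** The operator acts on an arbitrary representative, since the transfer operator
    preserves equality almost everywhere. *)
Let op u : B := bv_class (BVFun (inBVF (repr u))).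

Let opE (f : bv_fun R) : op (bv_class f) = bv_class (BVFun (inBVF f)).
Proof. by apply/bv_class_eq; apply: transfer_rev_ae => //; exact: repr_ae. Qed.

Let op_linear : bv_linear op.
Proof.
move=> a u v; rewrite -{1}(bv_classK u) -{1}(bv_classK v) -bv_classZ -bv_classD opE.
rewrite /op -bv_classZ -bv_classD; apply/bv_class_eq.
exact: (transfer_rev_lin_ae a uos (bv_fun_inBV _) (bv_fun_inBV _)).
Qed.

Let iter_op u N : exists2 f : bv_fun R,
  iter N (transfer_rev q os) (repr u) = f :> (R -> R[i]) & iter N op u = bv_class f.
Proof.
elim: N => [|N [f fE opf]]; first by exists (repr u) => //=; rewrite bv_classK.
by exists (BVFun (inBVF f)); rewrite !iterS ?fE// opf opE.
Qed.

Let op_norm1 u : bv_norm1 (op u) <= bv_norm1 u.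
Proof.
rewrite /op bv_norm1_class -lee_fin !fineK ?norm1_fin//.
have [uL _] := bv_fun_inBV (repr u).
exact: (norm1_transfer_rev_le q0 uos uL).2.
Qed.

Let op_var N u : (0 < N)%N ->
  bv_var (iter N op u) <= 4 * (q ^- size os) ^+ N * bv_var u +
    8 / delta q (size os * N) * bv_norm1 u.
Proof.
move=> N0; have [f fE ->] := iter_op u N; rewrite bv_var_class.
rewrite -lee_fin fineK ?Var_fin// -fE iter_transfer_rev EFinD !EFinM -!EFinM.
have uB := bv_fun_inBV (repr u).
have sz : (0 < size (flatten (nseq N os)))%N by rewrite size_flatten_nseq muln_gt0 os0.
have := lasota_yorke q1 sz (unimodular_flatten uos) uB.
rewrite size_flatten_nseq exprM -exprVn => h.
apply: le_trans h _; rewrite /bv_var /bv_norm1 !EFinM.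
by rewrite !fineK ?Var_fin ?norm1_fin.
Qed.

Lemma block_operator : exists T : {linear B -> B},
  [/\ induces (transfer_rev q os) T, continuous T &
      (ess_spectral_radius T <= (q ^- size os)%:E)%E].
Proof.
have [T opT] := bv_linear_pack op_linear.
have bT : bv_bounded T.
  rewrite -opT; have dl := delta_gt0 q1 os0.
  have c0 : 0 <= 4 * (q ^- size os) by rewrite mulr_ge0// invr_ge0 exprn_ge0// ltW.
  have d0 : 0 <= 8 / delta q (size os) by rewrite divr_ge0// ltW.
  exists (4 * (q ^- size os) + (8 / delta q (size os) + 1)).
    by rewrite !addr_ge0.
  move=> u; have := op_var u (ltn0Sn 0); rewrite /= expr1 muln1.
  have := op_norm1 u; have := bv_norm1_ge0 u; have := bv_var_ge0 u.
  move: (4 * q ^- size os) c0 (8 / delta q (size os)) d0 => c c0 d d0 v0 n0 h1 h2.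
  have : 0 <= c * bv_norm1 u by rewrite mulr_ge0.
  have : 0 <= d * bv_var u by rewrite mulr_ge0.
  by rewrite /nrm; lra.
exists T; split.
- by move=> f; exists (BVFun (inBVF f)) => //; rewrite -opT opE.
- exact: bv_bounded_continuous.
- apply: ess_spectral_radius_le => //.
  + by rewrite invr_gt0 exprn_gt0.
  + by rewrite -opT.
  + move=> r r0; exists (8 / delta q (size os * r)).
      by rewrite divr_ge0// ltW// delta_gt0// muln_gt0 os0.
    by move=> u; rewrite -opT; exact: op_var.
Qed.

End BlockOperator.

End EssentialRadius.

Lemma normc_unit (R : realType) (z : R[i]) : `|z| = 1 -> normc z = 1.
Proof. by move=> z1; apply: complexI; exact: z1. Qed.

Theorem theorem3p3 (R : realType) (q : R) (hq : 1 < q) :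
  [/\ (forall (r : nat) (omega : r.-tuple R[i]) (u : R -> R[i]),
         (0 < r)%N -> (forall k : 'I_r, `|tnth omega k| = 1) -> inBV u ->
         (Var (transfer_seq q omega u) <=
            (4 * q ^- r)%:E * Var u + (8 / delta q r)%:E * norm1 u)%E /\
         (norm1 (transfer_seq q omega u) <= norm1 u)%E),
      (forall (zeta eta : R[i]) (N : nat) (u : R -> R[i]),
         `|zeta| = 1 -> `|eta| = 1 -> (0 < N)%N -> inBV u ->
         (Var (iter N (transferQ q zeta eta) u) <=
            (4 * q ^- (2 * N))%:E * Var u +
            (8 / delta q (2 * N))%:E * norm1 u)%E),
      (forall zeta eta : R[i], `|zeta| = 1 -> `|eta| = 1 ->
         exists Q : {linear bv_space R -> bv_space R},
           [/\ induces (transferQ q zeta eta) Q, continuous Q &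
               (ess_spectral_radius Q <= (q ^- 2)%:E)%E]),
      q ^- 2 < 1 &
      (forall omega : R[i], `|omega| = 1 ->
         exists L : {linear bv_space R -> bv_space R},
           [/\ induces (transfer q omega) L, continuous L &
               (ess_spectral_radius L <= (q^-1)%:E)%E])].
Proof.
have q0 : 0 < q by exact: lt_trans ltr01 hq.
have uni2 (zeta eta : R[i]) : `|zeta| = 1 -> `|eta| = 1 -> unimodular [:: zeta; eta].
  by move=> z1 e1 z; rewrite !inE => /orP[] /eqP ->; exact: normc_unit.
split.
- move=> r omega u r0 o1 uB.
  have uos : unimodular (rev omega).
    move=> z; rewrite mem_rev => /tnthP[k ->]; exact: normc_unit.
  have sz : size (rev omega) = r by rewrite size_rev size_tuple.
  rewrite transfer_seqE; split.
    by have := lasota_yorke hq _ uos uB; rewrite sz; apply.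
  by have [_] := norm1_transfer_rev_le q0 uos uB.1.
- move=> zeta eta N u z1 e1 N0 uB.
  have := lasota_yorke hq _ (unimodular_flatten (N := N) (uni2 _ _ z1 e1)) uB.
  by rewrite size_flatten_nseq -iter_transfer_rev; apply; rewrite muln_gt0.
- by move=> zeta eta z1 e1; exact: (block_operator hq (uni2 _ _ z1 e1)).
- by rewrite invf_lt1 ?exprn_gt0// exprn_egt1.
- move=> omega o1; have uos : unimodular [:: omega].
    by move=> z; rewrite inE => /eqP ->; exact: normc_unit.
  exact: (block_operator hq uos isT).
Qed.
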